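(* Let $\pi_{\mathcal U},\pi_{\mathcal V}$ be sub-Gaussian probability distributions on $\mathbb N=\{0,1,2,\dots\}$ with means $\mu_{\mathcal U},\mu_{\mathcal V}>0$ and generating functions $\phi_{\mathcal U}(s)=\sum_{k\ge0}\pi_{\mathcal U}(k)s^k$, $\phi_{\mathcal V}(s)=\sum_{k\ge0}\pi_{\mathcal V}(k)s^k$. For $N\ge1$ let $T=\frac{\mu_{\mathcal U}}{\mu_{\mathcal V}}N$ (assumed to be an integer), and let $\mathrm M_T$ be the matching built by GREEDY on the bipartite configuration model $\mathbf{CM}(\mathbf d^{\mathcal U},\mathbf d^{\mathcal V})$ (all capacities equal to $1$). Let $G$ be the unique solution of the ordinary differential equation $$G'(s)=\frac{1-\phi_{\mathcal V}\!\left(1-\frac{1}{\mu_{\mathcal U}}\phi_{\mathcal U}'(1-G(s))\right)}{\frac{\mu_{\mathcal V}}{\mu_{\mathcal U}}\phi_{\mathcal U}'(1-G(s))},\qquad G(0)=0.$$ Then $\frac{|\mathrm M_T|}{N}\to 1-\phi_{\mathcal U}(1-G(1))$ in probability as $N\to\infty$. Moreover, for every $s\in[0,1]$, if $\mathrm M_T(s)$ denotes the matching obtained by GREEDY after seeing a proportion $s$ of the vertices of $\mathcal V$, then $\frac{|\mathrm M_T(s)|}{N}\to 1-\phi_{\mathcal U}(1-G(s))$ in probability. More precisely, there are constants $\zeta,\xi,\kappa>0$ depending only on the first two moments of $\pi_{\mathcal U}$ and $\pi_{\mathcal V}$, and a universal constant $c>0$ (one may take $c=1/20$), such that with probability at least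 $1-\zeta N\exp(-\xi N^{c/2})$, $$\sup_{s\in[0,1]}\left|\frac{|\mathrm M_T(s)|}{N}-\bigl(1-\phi_{\mathcal U}(1-G(s))\bigr)\right|\le \kappa N^{-c}.$$
   Context: Bipartite configuration model: let $\mathcal U=\{1,\dots,N\}$ and $\mathcal V=\{1,\dots,T\}$. Draw $d^{\mathcal U}_1,\dots,d^{\mathcal U}_N$ i.i.d. with law $\pi_{\mathcal U}$ and, independently, $d^{\mathcal V}_1,\dots,d^{\mathcal V}_T$ i.i.d. with law $\pi_{\mathcal V}$. Set $d^{\mathcal V}_{T+1}=\max\{\sum_{i\le N}d^{\mathcal U}_i-\sum_{j\le T}d^{\mathcal V}_j,0\}$ and $d^{\mathcal U}_{N+1}=\max\{\sum_{j\le T}d^{\mathcal V}_j-\sum_{i\le N}d^{\mathcal U}_i,0\}$. Attach $d_x$ half-edges to each vertex $x$, pair the half-edges of $\mathcal U\cup\{N+1\}$ with those of $\mathcal V\cup\{T+1\}$ by a uniformly random perfect matching, each pair forming an edge (multiple edges allowed), and then delete the vertices $N+1,T+1$ and their edges. The resulting random bipartite multigraph is $\mathbf{CM}(\mathbf d^{\mathcal U},\mathbf d^{\mathcal V})$. Online setting: $\mathcal U$ is known from the start and the vertices $v_1,\dots,v_T$ of $\mathcal V$ arrive one at a time, each revealing its incident edges. A matching is a set of edges in which each vertex lies in at most one edge. GREEDY: start with the empty matching; when $v_t$ arrives, if some edge joins $v_t$ to a currently unmatched vertex of $\mathcal U$, add one such edge chosen uniformly at random to the matching; otherwise leave $v_t$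 unmatched. ''After seeing a proportion $s$'' means after processing the first $\lfloor sT\rfloor$ vertices of $\mathcal V$.
   Formalization: The constant ζ may depend also on the sub-Gaussian constants of π_U and π_V, not only on the first two moments (with only moments the bound fails: rare huge degrees); ξ and κ depend only on the moments. The ODE is imposed on (0,1), since at s=1 it may be 0/0. *)

(* Defs.v *)
From HB Require Import structures.
From mathcomp Require Import all_boot all_order all_algebra.
From mathcomp Require Import all_classical all_reals all_analysis.
Import Order.TTheory GRing.Theory Num.Theory.
Import numFieldNormedType.Exports.

Set Implicit Arguments.
Unset Strict Implicit.
Unset Printing Implicit Defensive.

Local Open Scope classical_set_scope.
Local Open Scope ring_scope.

Lemma esum_scale (R : realType) (I : choiceType) (c : R) (a : I -> \bar R) :
  0 <= c -> (forall i, 0 <= a i)%E ->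
  (\esum_(i in setT) (c%:E * a i) = c%:E * \esum_(i in setT) a i)%E.
Proof.
move=> c0 a0.
have fE (F : set I) : finite_set F ->
    (\sum_(i \in F) (c%:E * a i) = c%:E * \sum_(i \in F) a i)%E.
  by move=> finF; rewrite ge0_mule_fsumr.
have [->|cN0] := eqVneq c 0.
  by rewrite mul0e esum1// => i _; rewrite mul0e.
have cp : 0 < c by rewrite lt_neqAle eq_sym cN0.
apply/eqP; rewrite eq_le; apply/andP; split.
  apply: ge_ereal_sup => _ [F [finF _] <-]; rewrite fE// lee_pmul2l//.
  by apply: ereal_sup_ubound; exists F.
rewrite muleC -lee_pdivlMr//.
apply: ge_ereal_sup => _ [F [finF _] <-].
rewrite lee_pdivlMr// muleC -fE//.
by apply: ereal_sup_ubound; exists F.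
Qed.

Lemma esum_prod_ffun (R : realType) (p : nat -> R) n :
  (forall k, 0 <= p k) -> \esum_(k in setT) (p k)%:E = 1%E ->
  \esum_(a in [set: {ffun 'I_n -> nat}]) (\prod_i p (a i))%:E = 1%E.
Proof.
move=> p0 p1; elim: n => [|n IH].
  rewrite (_ : setT = [set [ffun=> 0%N]]).
    by rewrite esum_set1 ?big_ord0.
  by apply/seteqP; split=> // a _ /=; apply/ffunP => -[].
pose e (x : nat * {ffun 'I_n -> nat}) : {ffun 'I_n.+1 -> nat} :=
  [ffun i => if unlift ord0 i is Some j then x.2 j else x.1].
rewrite (@reindex_esum _ _ _ (setT `*`` (fun=> setT)) _ e); last first.
  split=> //.
    move=> [k a] [k' a'] _ _ /ffunP h; congr pair.
      by have := h ord0; rewrite !ffunE unlift_none.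
    by apply/ffunP => i; have := h (lift ord0 i); rewrite !ffunE liftK.
  move=> a _; exists (a ord0, [ffun i => a (lift ord0 i)]) => //=.
  apply/ffunP => i; rewrite ffunE /=; case: unliftP => [j ->|->//].
  by rewrite ffunE.
have pr0 (a : {ffun 'I_n -> nat}) : 0 <= \prod_i p (a i) by exact: prodr_ge0.
transitivity (\esum_(k in [set: nat]) \esum_(a in [set: {ffun 'I_n -> nat}])
  ((p k)%:E * (\prod_i p (a i))%:E)%E).
  rewrite esum_esum; last by move=> *; rewrite mule_ge0 ?lee_fin.
  apply: eq_esum => -[k a] _ /=; rewrite big_ord_recl -EFinM; congr (_ * _)%:E.
    by rewrite ffunE unlift_none.
  by apply: eq_bigr => i _; rewrite ffunE liftK.
rewrite -[RHS]p1; apply: eq_esum => k _.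
by rewrite esum_scale// IH mule1.
Qed.

Lemma sum_prod_tuple (R : comNzRingType) (X : finType) (q : seq X -> X -> R) n :
  (forall s, (size s < n)%N -> \sum_x q s x = 1) ->
  \sum_(c : n.-tuple X) \prod_(t < n) q (take t c) (tnth c t) = 1.
Proof.
elim: n => [|n IH] q1.
  by under eq_bigr do rewrite big_ord0; rewrite sumr_const card_tuple expn0.
pose e (x : n.-tuple X * X) : n.+1.-tuple X := [tuple of rcons x.1 x.2].
rewrite (reindex e); last first.
  exists (fun c : n.+1.-tuple X => 
    ([tuple tnth c (widen_ord (leqnSn n) i) | i < n], tnth c ord_max)).
    move=> [c x] _; rewrite /e /=; congr pair; last first.
      by rewrite (tnth_nth x) /= nth_rcons size_tuple ltnn eqxx.
    apply: eq_from_tnth => i; rewrite tnth_mktuple !(tnth_nth x) /=.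
    by rewrite nth_rcons size_tuple ltn_ord.
  move=> c _; apply: eq_from_tnth => i; have x0 := tnth c i.
  rewrite /e /fst /snd; set c' := mktuple _.
  rewrite (tnth_nth x0) [tval _]/(rcons c' _) nth_rcons size_tuple.
  case: ltnP => hi.
    rewrite -[nat_of_ord i]/(nat_of_ord (Ordinal hi)) -tnth_nth tnth_mktuple.
    by congr tnth; apply: val_inj.
  have -> : i = ord_max by apply/val_inj/eqP; rewrite eqn_leq hi -ltnS ltn_ord.
  by rewrite eqxx.
rewrite -(pair_bigA _ (fun c x => \prod_(t < n.+1) q (take t (e (c, x))) (tnth (e (c, x)) t))) /=.
rewrite -[RHS](IH (fun s hs => q1 s (ltnW hs))); apply: eq_bigr => c _.
under eq_bigr => x _.
  rewrite big_ord_recr /=.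
  rewrite (_ : tnth _ ord_max = x); last first.
    by rewrite (tnth_nth x) /= nth_rcons size_tuple ltnn eqxx.
  rewrite -cats1 take_size_cat ?size_tuple//.
  under eq_bigr => i _.
    rewrite takel_cat ?size_tuple 1?ltnW//.
    rewrite (_ : tnth _ _ = tnth c i); last first.
      by rewrite !(tnth_nth x) /= nth_rcons size_tuple ltn_ord.
    over.
  over.
by rewrite -big_distrr /= q1 ?mulr1 ?size_tuple.
Qed.

Section degree_laws.
Context {R : realType}.
Implicit Type law : probability nat R.

Definition prob_at law (k : nat) : R := fine (law [set k]).

Lemma prob_at_ge0 law k : 0 <= prob_at law k.
Proof. by rewrite fine_ge0. Qed.

Lemma sum_prob_at law : \esum_(k in setT) (prob_at law k)%:E = 1%E.
Proof.
rewrite -nneseries_esumT; last by move=> k; rewrite lee_fin prob_at_ge0.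
have <- := probability_setT law.
rewrite (_ : [set: nat] = \bigcup_k [set k]); last first.
  by apply/seteqP; split=> // k _; exists k.
rewrite measure_bigcup//=; last by move=> i j _ _ [x [-> ->]].
rewrite [RHS]eseries_mkcond.
apply: eq_eseriesr => k _.
by rewrite mem_set// /prob_at fineK// fin_num_measure.
Qed.

Definition has_mean law (m : R) := ('E_law[(fun k => k%:R : R)%R] = m%:E)%E.

Definition has_second_moment law (m2 : R) :=
  ('E_law[(fun k => k%:R ^+ 2 : R)%R] = m2%:E)%E.

Definition sub_gaussian_with law (K : R) :=
  forall t : R, 0 <= t ->
    (law [set k | (t <= k%:R)%R] <= (2 * expR (- (t / K) ^+ 2))%:E)%E.

Definition sub_gaussian law := exists2 K : R, 0 < K & sub_gaussian_with law K.

(* The series is summed over the whole real line: for a sub-Gaussian law it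
   converges everywhere, and its derivative at 1 is then two-sided. *)
Definition gen_fun law (s : R) : R :=
  limn (series (fun k => prob_at law k * s ^+ k)).

End degree_laws.

Section greedy_ode.
Context {R : realType}.
Variables (piU piV : probability nat R) (muU muV : R).

Definition greedy_rhs (g : R) : R :=
  (1 - gen_fun piV (1 - muU^-1 * derive1 (gen_fun piU) (1 - g)))
  / (muV / muU * derive1 (gen_fun piU) (1 - g)).

(* The equation is imposed on the open interval: at s = 1 the right-hand side
   may be the indeterminate form 0 / 0, for instance if both laws are Dirac
   masses, piU at 2 and piV at 1, in which case G(s) = s. *)
Definition is_greedy_ode_solution (G : R -> R) :=
  [/\ {within `[0, 1], continuous G}, G 0 = 0
    & forall s : R, s \in `]0, 1[ -> is_derive s 1 G (greedy_rhs (G s))].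

End greedy_ode.

(* GREEDY on a finite multigraph with edge set G (a set of edge names, so that
   multiple edges are allowed).  endU gives the offline endpoint of an edge and
   endV the arrival index of its online endpoint.  A run of GREEDY is recorded
   as the sequence of its decisions: entry t is Some e if e is added to the
   matching when vertex t arrives, and None if vertex t is left unmatched. *)
Section greedy.
Variables (E U : finType) (endU : E -> U) (endV : E -> nat) (G : {set E}).
Implicit Type s : seq (option E).

Definition matching_of s : {set E} := [set e | Some e \in s].

Definition available s : {set E} :=
  [set e in G | (endV e == size s) &&
                [forall e' in matching_of s, endU e' != endU e]].

(* Conditional probability that the next decision is x, given that the
   previous ones are s. *)
Definition greedy_step (R : numFieldType) s (x : option E) : R :=
  if x is Some e then (e \in available s)%:R / #|available s|%:R
  else (available s == finset.set0)%:R.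

Definition greedy_run_prob (R : numFieldType) T (c : T.-tuple (option E)) : R :=
  \prod_(t < T) greedy_step R (take t c) (tnth c t).

Lemma greedy_step_ge0 (R : numFieldType) s x : 0 <= greedy_step R s x.
Proof. by case: x => [e|] /=; rewrite ?mulr_ge0 ?invr_ge0 ?ler0n. Qed.

Lemma sum_greedy_step (R : numFieldType) s : \sum_x greedy_step R s x = 1.
Proof.
set A := available s.
rewrite (bigID (pred1 None)) /= big_pred1_eq /= -/A.
rewrite (reindex_omap (fun e => Some e) id) /=; last by case.
under eq_bigl do rewrite eqxx.
rewrite -big_distrl /=.

have -> : \sum_(e : E) (e \in A)%:R = #|A|%:R :> R.
  rewrite -sum1_card natr_sum [RHS]big_mkcond /=.
  by apply: eq_bigr => e _; case: (e \in A).
have [A0|A0] := eqVneq A finset.set0.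
  by rewrite A0 cards0 mul0r addr0.
by rewrite add0r divff// pnatr_eq0 cards_eq0.
Qed.
End greedy.

(* 'I_N.+1 is the set U together with its extra vertex ord_max, and likewise
   'I_T.+1 for V; the half-edges attached to x are the pairs Tagged x k. *)
Section configuration_model.
Variables N T : nat.

Definition degrees : Type := {ffun 'I_N -> nat} * {ffun 'I_T -> nat}.
HB.instance Definition _ := Choice.on degrees.
Implicit Type d : degrees.

Definition degU d (i : 'I_N.+1) : nat :=
  if unlift ord_max i is Some j then d.1 j
  else (\sum_j d.2 j - \sum_j d.1 j)%N.

Definition degV d (i : 'I_T.+1) : nat :=
  if unlift ord_max i is Some j then d.2 j
  else (\sum_j d.1 j - \sum_j d.2 j)%N.

Definition halfU d : finType := {i : 'I_N.+1 & 'I_(degU d i)}.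
Definition halfV d : finType := {j : 'I_T.+1 & 'I_(degV d j)}.

(* As there are as many half-edges on both sides, the injections are exactly
   the perfect matchings. *)
Definition pairings d : {set {ffun halfV d -> halfU d}} :=
  [set f : {ffun halfV d -> halfU d} | injectiveb f].

Lemma card_halfU_halfV d : #|halfU d| = #|halfV d|.
Proof.
rewrite !card_tagged !sumnE !big_map -!big_enum /= !big_enum /=.
under eq_bigr do rewrite card_ord.
under [RHS]eq_bigr do rewrite card_ord.
rewrite !big_ord_recr /=.
have L n (i : 'I_n) : widen_ord (leqnSn n) i = lift ord_max i.
  by apply: val_inj; rewrite /= /bump leqNgt ltn_ord.
rewrite /degU /degV !unlift_none.
under eq_bigr do rewrite L liftK.
under [in RHS]eq_bigr do rewrite L liftK.
by rewrite -!maxnE maxnC.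
Qed.

Lemma card_pairings_gt0 d : (0 < #|pairings d|)%N.
Proof.
apply/card_gt0P.
exists [ffun h => enum_val (cast_ord (esym (card_halfU_halfV d)) (enum_rank h))].
rewrite inE; apply/injectiveP => h h'; rewrite !ffunE.
by move=> /enum_val_inj/cast_ord_inj/enum_rank_inj.
Qed.

(* An edge of the multigraph is named by its half-edge on the V side. *)
Definition cm_edges d (f : {ffun halfV d -> halfU d}) : {set halfV d} :=
  [set h | (tag h != ord_max) && (tag (f h) != ord_max)].

Definition run_type d : Type :=
  {ffun halfV d -> halfU d} * T.-tuple (option (halfV d)).
HB.instance Definition _ d := Finite.on (run_type d).

Definition outcome : Type := {d : degrees & run_type d}.
HB.instance Definition _ := Choice.on outcome.

Let degrees0 : degrees := ([ffun=> 0%N], [ffun=> 0%N]).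
Let outcome0 : outcome :=
  Tagged run_type (xchoose (card_gt0P (card_pairings_gt0 degrees0)),
                   [tuple None | _ < T]).
HB.instance Definition _ := isPointed.Build outcome outcome0.
HB.instance Definition _ := @isMeasurable.Build default_measure_display
  outcome discrete_measurable discrete_measurable0
  discrete_measurableC discrete_measurableU.

Definition matching_at (w : outcome) (t : nat) : {set halfV (tag w)} :=
  matching_of (take t (tagged w).2).

Definition cond_weight (R : numFieldType) d (r : run_type d) : R :=
  (r.1 \in pairings d)%:R / #|pairings d|%:R *
  greedy_run_prob (fun h : halfV d => tag (r.1 h))
    (fun h : halfV d => tag h : nat) (cm_edges r.1) R r.2.

Lemma cond_weight_ge0 (R : numFieldType) d (r : run_type d) : 0 <= cond_weight R r.
Proof.
rewrite !mulr_ge0 ?invr_ge0 ?ler0n// prodr_ge0// => t _.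
exact: greedy_step_ge0.
Qed.

Lemma sum_cond_weight (R : numFieldType) d : \sum_(r : run_type d) cond_weight R r = 1.
Proof.
rewrite /cond_weight -(pair_bigA _ (fun f c => (f \in pairings d)%:R / #|pairings d|%:R *
  greedy_run_prob (fun h : halfV d => tag (f h))
    (fun h : halfV d => tag h : nat) (cm_edges f) R c)) /=.
under eq_bigr => f _.
  rewrite -big_distrr /= sum_prod_tuple ?mulr1; last first.
    by move=> *; exact: sum_greedy_step.
  over.
rewrite -big_distrl /=.
have -> : \sum_(f : {ffun halfV d -> halfU d}) (f \in pairings d)%:R = #|pairings d|%:R :> R.
  rewrite -sum1_card natr_sum [RHS]big_mkcond /=.
  by apply: eq_bigr => f _; case: (f \in _).
by rewrite divff// pnatr_eq0 -lt0n card_pairings_gt0.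
Qed.

Context {R : realType}.
Variables piU piV : probability nat R.

Definition degrees_weight d : R :=
  \prod_i prob_at piU (d.1 i) * \prod_j prob_at piV (d.2 j).

Definition outcome_weight (w : outcome) : R :=
  degrees_weight (tag w) * cond_weight R (tagged w).

Definition cm_greedy (A : set outcome) : \bar R :=
  \esum_(w in A) (outcome_weight w)%:E.

Lemma degrees_weight_ge0 d : 0 <= degrees_weight d.
Proof. by rewrite mulr_ge0// prodr_ge0// => i _; rewrite prob_at_ge0. Qed.

Lemma outcome_weight_ge0 (w : outcome) : 0 <= outcome_weight w.
Proof. by rewrite mulr_ge0 ?degrees_weight_ge0 ?cond_weight_ge0. Qed.

Lemma sum_degrees_weight :
  \esum_(d in [set: degrees]) (degrees_weight d)%:E = 1%E.
Proof.
transitivity (\esum_(a in [set: {ffun 'I_N -> nat}]) \esum_(b in [set: {ffun 'I_T -> nat}])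
  ((\prod_i prob_at piU (a i))%:E * (\prod_i prob_at piV (b i))%:E)%E).
  rewrite esum_esum; last first.
    by move=> *; rewrite mule_ge0// lee_fin prodr_ge0// => *; exact: prob_at_ge0.
  rewrite (_ : _ `*`` _ = setT); last by apply/seteqP; split.
  by apply: eq_esum => d _; rewrite -EFinM.
under eq_esum => a _.
  rewrite esum_scale; last 2 first.
  - by rewrite prodr_ge0// => *; exact: prob_at_ge0.
  - by move=> *; rewrite lee_fin prodr_ge0// => *; exact: prob_at_ge0.
  rewrite esum_prod_ffun ?mule1; last 2 first.
  - exact: prob_at_ge0.
  - exact: sum_prob_at.
  over.
by rewrite esum_prod_ffun//; [exact: prob_at_ge0|exact: sum_prob_at].
Qed.

Local Notation mu := cm_greedy.

Let mu0 : mu set0 = 0%E. Proof. exact: esum_set0. Qed.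

Let mu_ge0 A : (0 <= mu A)%E.
Proof. by apply: esum_ge0 => w _; rewrite lee_fin outcome_weight_ge0. Qed.

Let mu_sigma_additive : semi_sigma_additive mu.
Proof.
move=> F mF tF mUF; rewrite /cm_greedy esum_bigcupT//; last first.
  by move=> w; rewrite lee_fin outcome_weight_ge0.
rewrite -nneseries_esumT; last by move=> n; exact: mu_ge0.
by apply: is_cvg_nneseries => n _ _; exact: mu_ge0.
Qed.

Let mu_setT : mu setT = 1%E.
Proof.
pose J (d : degrees) := [set w : outcome | tag w = d].
rewrite /cm_greedy (@reindex_esum _ _ _ ([set: degrees] `*`` J) _ snd); last first.
  split=> //.
  - by move=> [d w] [d' w'] /set_mem [_ /= <-] /set_mem [_ /= <-] /= <-.
  - by move=> w _; exists (tag w, w).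
rewrite -(esum_esum (a := fun _ w => (outcome_weight w)%:E)); last first.
  by move=> *; rewrite lee_fin outcome_weight_ge0.
rewrite -[RHS]sum_degrees_weight; apply: eq_esum => d _.
rewrite (@reindex_esum _ _ _ [set: run_type d] _ (fun r => Tagged run_type r : outcome)); last first.
  split=> //.
  - by move=> r r' _ _ /eqP; rewrite eq_Tagged => /eqP.
  - by move=> [d' r] /= <-; exists r.
rewrite esum_fset//=; last first.
  by move=> r _; rewrite lee_fin mulr_ge0 ?degrees_weight_ge0 ?cond_weight_ge0.
rewrite (_ : setT = [set` enum {: run_type d}]); last first.
  by apply/seteqP; split=> // r _ /=; rewrite mem_enum.
rewrite -fsbig_seq ?enum_uniq// big_enum /=.
under eq_bigr do rewrite /outcome_weight /= EFinM.
rewrite -ge0_sume_distrr; last first.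
  by move=> r _; rewrite lee_fin cond_weight_ge0.
by rewrite sumEFin sum_cond_weight mule1.
Qed.

HB.instance Definition _ :=
  isMeasure.Build _ _ _ mu mu0 mu_ge0 mu_sigma_additive.
HB.instance Definition _ := Measure_isProbability.Build _ _ _ mu mu_setT.

End configuration_model.

Arguments matching_at {N T} w t.
Arguments cm_greedy N T {R} piU piV A.

(* |M_T(s)| / N *)
Definition matching_fraction (R : realType) (N T : nat) (s : R)
    (w : outcome N T) : R :=
  #|matching_at w (Num.truncn (s * T%:R))|%:R / N%:R.

(* Convergence in probability as N goes to infinity among the integers N for
   which T = rho * N is an integer. *)
Definition cm_cvg_in_probability (R : realType) (piU piV : probability nat R)
    (rho : R) (X : forall N T, outcome N T -> R) (l : R) :=
  forall eps eta : R, 0 < eps -> 0 < eta ->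
    \forall N \near \oo, forall T : nat, T%:R = rho * N%:R ->
      (cm_greedy N T piU piV [set w | (eps < `|X N T w - l|)%R] <= eta%:E)%E.

(* Main.v *)
(* The pairing is revealed while GREEDY runs: when v_t arrives, its half-edges
   are matched one at a time with uniformly chosen unread half-edges of the U
   side, up to the first one attached to an unmatched vertex; by exchangeability
   this vertex has the law of GREEDY's choice, and what has not been read can be
   forgotten. The state is then the set X of unread half-edges, and a vertex of U
   is matched iff one of its half-edges has been read.

   Let y = #|X| / m. At each size X is a uniform random set of half-edges, hence,
   up to a polynomial factor, dominated by a Bernoulli(y) set: outside atypical
   sets of exponentially small probability, N phi_U(y) vertices are unmatched and
   a half-edge is fresh with probability phi_U'(y) / mu_U. Averaging over the degree
   of v_t, the fraction g = 1 - y of half-edges read grows by about G'/T where G'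
   is the right-hand side of the ODE at g. If F is an antiderivative of the
   reciprocal of this right-hand side, F(G(s)) = s and the lag F(g) - t/T has
   almost no drift; exp(+-lambda lag), plus the expected number of atypical sets
   met in the future, is a supermartingale barrier which keeps the lag small.

   Degrees are truncated at L, the integer part of N^(1/40), and with l = L all
   errors are of order l^-3, while failures have probability at most exp(-l - 1),
   so that xi = kappa = 1 work. *)
Require Import Defs.
From mathcomp Require Import all_boot all_order all_algebra.
From mathcomp Require Import all_classical all_reals all_analysis.
From mathcomp Require Import perm zify ring lra.
Import Order.TTheory GRing.Theory Num.Theory.
Import numFieldNormedType.Exports.
Local Open Scope classical_set_scope.
Local Open Scope ring_scope.

Set Implicit Arguments.
Unset Strict Implicit.
Unset Printing Implicit Defensive.

(** * Sampling without replacement *)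

(** Averaging over the degree of v_t only when it arrives requires a set of half-edges of U that
    does not depend on the degrees of V. But vertex N+1 absorbs the excess of V. So its degree [e]
    is frozen: for each of the LT + 1 possible values the chain runs on a fixed set of half-edges
    with independent degrees on the V side, and the failure probabilities are summed over [e]. For
    the same reason the degrees of U have to be typical at all fractions j/m, for every possible
    number m of half-edges.

    The lag is measured through F, not as g - G(t/T), because F turns the ODE into motion at unit
    speed: the mean increment of F(g) is close to muV/m = 1/T wherever g is, so the errors of the T
    arrivals add up and none is amplified.

    With lambda = l^5, each step multiplies the exponential by at most exp(D/n) for a constant D,
    hence all steps together by a bounded factor, while stopping at a lag of l^-3 gains exp(-l^2).
    This beats the union bounds, which cost a power of l, since n is at most (2l)^40. *)

Section sampling.
Context {R : numFieldType} {T : finType}.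
Implicit Types (X : {set T}) (H : seq T -> R).

(* Expected value of H on n letters drawn from X without replacement. *)
Fixpoint samp n X H : R :=
  if n is n'.+1 then
    #|X|%:R^-1 * \sum_(x in X) samp n' (X :\ x) (fun s => H (x :: s))
  else H [::].

Lemma eq_samp n X H1 H2 :
  (forall s, size s = n -> H1 s = H2 s) -> samp n X H1 = samp n X H2.
Proof.
elim: n X H1 H2 => [|n IH] X H1 H2 eqH /=; first exact: eqH.
by congr (_ * _); apply: eq_bigr => x _; apply: IH => s hs; apply: eqH => /=; rewrite hs.
Qed.

Lemma sampD n X H1 H2 :
  samp n X (fun s => H1 s + H2 s) = samp n X H1 + samp n X H2.
Proof.
elim: n X H1 H2 => [//|n IH] X H1 H2 /=.
under eq_bigr do rewrite IH.
by rewrite big_split mulrDr.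
Qed.

Lemma samp_const n X c : (n <= #|X|)%N -> samp n X (fun=> c) = c.
Proof.
elim: n X => [//|n IH] X nX /=.
under eq_bigr => x xX.
  rewrite IH; last by rewrite -ltnS (leq_trans nX)// (cardsD1 x X) xX.
  over.
rewrite sumr_const -[c *+ _]mulr_natl mulKf// pnatr_eq0 -lt0n.
exact: leq_trans nX.
Qed.

(** Sampling is uniform on injective [n]-tuples, so that permuting letters becomes a reindexing of a
    finite sum. If [n] exceeds the size of [X], both sides vanish because the inverse of 0 is 0. *)
Lemma samp_tuple n X H :
  samp n X H = (#|X| ^_ n)%:R^-1 *
     \sum_(t : n.-tuple T | uniq t && all [in X] t) H t.
Proof.
elim: n X H => [|n IH] X H /=.
  rewrite ffactn0 invr1 mul1r (big_pred1 [tuple])// => t.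
  by rewrite tuple0 /= eqxx.
rewrite ffactnS natrM invfM -mulrA; congr (_ * _).
under eq_bigr => x xX.
  rewrite IH (_ : #|X :\ x| = #|X|.-1); last by rewrite (cardsD1 x X) xX.
  over.
rewrite -big_distrr /=; congr (_ * _).
pose e (y : T * n.-tuple T) : n.+1.-tuple T := [tuple of y.1 :: y.2].
rewrite [RHS](reindex e); last first.
  exists (fun t : n.+1.-tuple T => (thead t, [tuple of behead t])).
    by move=> [x t] _; congr pair; apply: val_inj.
  by move=> t _; rewrite /e /= [RHS]tuple_eta; apply: val_inj.
rewrite pair_big_dep /=; apply: eq_big => // -[x t] /=.
apply/idP/idP => [/and3P[xX ut /allP h]|/andP[/andP[xt ut] /andP[xX /allP h]]].
  rewrite xX ut andbT; apply/andP; split; first by apply/negP => /h; rewrite !inE eqxx.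
  by apply/allP => y /h; rewrite !inE => /andP[].
rewrite xX ut; apply/allP => y yt; rewrite !inE (h _ yt) andbT.
by apply: contraNneq xt => <-.
Qed.

Lemma samp_take n k X H : (n + k <= #|X|)%N ->
  samp (n + k) X (fun s => H (take n s)) = samp n X H.
Proof.
elim: n X H => [|n IH] X H nk.
  rewrite (@eq_samp _ X _ (fun=> H [::])) ?samp_const// => s _.
  by rewrite take0.
rewrite addSn /=; congr (_ * _); apply: eq_bigr => x xX.
rewrite -(IH _ (fun s => H (x :: s)))// -ltnS (leq_trans nk)//.
by rewrite (cardsD1 x X) xX.
Qed.

Lemma samp_rot n k X H : samp n X (fun s => H (rot k s)) = samp n X H.
Proof.
rewrite !samp_tuple; congr (_ * _).
rewrite [RHS](reindex (fun t : n.-tuple T => [tuple of rot k t])); last first.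
  exists (fun t : n.-tuple T => [tuple of rotr k t]) => t _;
  by apply: val_inj; rewrite /= ?rotK ?rotrK.
apply: eq_big => // t /=; rewrite rot_uniq; congr (_ && _).
by apply/esym/perm_all; rewrite perm_rot.
Qed.

(** Rotating by [k] moves the dropped letters to the end, where [samp_take] forgets them. *)
Lemma samp_drop k n X H : (k + n <= #|X|)%N ->
  samp (k + n) X (fun s => H (drop k s)) = samp n X H.
Proof.
move=> kn; rewrite -(@samp_take n k)//; last by rewrite addnC.
rewrite [in RHS]addnC -[RHS](samp_rot _ k); apply: eq_samp => s hs.
by rewrite /rot take_size_cat// size_drop hs addKn.
Qed.

Lemma big_take_tuple k n (t : (k + n).-tuple T) (P : pred T) (F : T -> R) :
  \sum_(x <- take k t | P x) F x
  = \sum_(i < k + n | (i < k)%N && P (tnth t i)) F (tnth t i).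
Proof.
have -> : take k t = [tuple tnth t (lshift n i) | i < k].
  case: k t => [|k] t; first by rewrite take0 [tval _]size0nil// size_tuple.
  have x0 := tnth t ord0.
  have hk : size (take k.+1 t) = k.+1 by rewrite size_takel// size_tuple leq_addr.
  apply: (@eq_from_nth _ x0) => [|i]; rewrite hk ?size_tuple// => ik.
  rewrite nth_take//.
  transitivity (tnth [tuple tnth t (lshift n j) | j < k.+1] (Ordinal ik)).
    by rewrite tnth_mktuple (tnth_nth x0).
  by rewrite (tnth_nth x0).
rewrite big_tuple big_mkcond [RHS]big_mkcond big_split_ord /= [X in _ + X]big1 ?addr0.
  by apply: eq_bigr => i _; rewrite ltn_ord !tnth_mktuple.
by move=> i _; rewrite /= ltnNge leq_addr.
Qed.

(* Exchanging letters 0 and i turns the i-th term of the average into the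
   0-th one without changing the number of new letters. *)
Lemma samp_pick_first d n X (new : pred T) (F : T -> seq T -> R) :
  samp (d.+1 + n) X (fun s => if s is x :: _ then
    (new x)%:R * ((size [seq z <- take d.+1 s | new z])%:R^-1 *
       \sum_(z <- [seq z <- take d.+1 s | new z]) F z (drop d.+1 s)) else 0)
  = samp (d.+1 + n) X (fun s => if s is x :: _ then
    (new x)%:R * F x (drop d.+1 s) else 0).
Proof.
rewrite !samp_tuple; congr (_ * _).
set N := (d.+1 + n)%N; pose P (t : N.-tuple T) := uniq t && all [in X] t.
pose o : 'I_N := ord0.
have headE (t : N.-tuple T) (G : T -> R) :
    (if (t : seq T) is x :: _ then G x else 0) = G (tnth t o).
  by rewrite (tnth_nth (tnth t o)) /=; case: t => -[].
under eq_bigr do rewrite headE.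
under [RHS]eq_bigr do rewrite headE.
pose c (t : N.-tuple T) : R := (size [seq z <- take d.+1 t | new z])%:R.
have cE t : c t = \sum_(i < N | (i < d.+1)%N && new (tnth t i)) 1.
  by rewrite /c -sum1_size big_filter natr_sum (big_take_tuple t).
pose sw i (t : N.-tuple T) : N.-tuple T := [tuple tnth t (tperm o i j) | j < N].
have swK i : involutive (sw i).
  by move=> t; apply: eq_from_tnth => j; rewrite !tnth_mktuple tpermK.
have lt_tperm (i j : 'I_N) : (i < d.+1)%N -> (tperm o i j < d.+1)%N = (j < d.+1)%N.
  by move=> id; case: tpermP => [->|->|//]; rewrite id.
have c_sw (i : 'I_N) t : (i < d.+1)%N -> c (sw i t) = c t.
  move=> id; rewrite !cE (reindex_inj (@perm_inj _ (tperm o i))) /=.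
  by apply: eq_bigl => j; rewrite tnth_mktuple tpermK lt_tperm.
have drop_sw (i : 'I_N) t : (i < d.+1)%N -> drop d.+1 (sw i t) = drop d.+1 t.
  move=> id; have x0 := tnth t o.
  apply: (@eq_from_nth _ x0); rewrite !size_drop !size_tuple// => j jn.
  rewrite !nth_drop; have jN : (d.+1 + j < N)%N by rewrite /N ltn_add2l; rewrite /N addKn in jn.
  rewrite -[(d.+1 + j)%N]/(val (Ordinal jN)) -!tnth_nth tnth_mktuple tpermD//.
  by apply/eqP => /(congr1 val) /= h; rewrite h ltnNge leq_addr in id.
have P_sw i t : P (sw i t) = P t.
  have pe : perm_eq (sw i t) t by apply/tuple_permP; exists (tperm o i).
  by rewrite /P (perm_uniq pe) (perm_all _ pe).
transitivity (\sum_(i < N | (i < d.+1)%N) \sum_(t | P t)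
    (new (tnth t o))%:R * (new (tnth t i))%:R / c t * F (tnth t i) (drop d.+1 t)).
  rewrite exchange_big /=; apply: eq_bigr => t _.
  rewrite big_filter (big_take_tuple t new (fun z => F z (drop d.+1 t))) /=.
  rewrite big_mkcondr 2!big_distrr /=; apply: eq_bigr => i _.
  rewrite -/(c t); case: (new (tnth t i)); last by rewrite !(mulr0, mul0r).
  by rewrite !mulr1 mulrA.
transitivity (\sum_(i < N | (i < d.+1)%N) \sum_(t | P t)
    (new (tnth t o))%:R * (new (tnth t i))%:R / c t * F (tnth t o) (drop d.+1 t)).
  apply: eq_bigr => i id.
  rewrite (reindex_inj (can_inj (swK i))) /=; apply: eq_big => [t|t _]; first exact: P_sw.
  rewrite c_sw// drop_sw// /sw !tnth_mktuple tpermL tpermR.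
  by rewrite [(new _)%:R * _]mulrC.
rewrite exchange_big /=; apply: eq_bigr => t _.
case nt: (new (tnth t o)); last by rewrite mul0r big1// => i _; rewrite !mul0r.
rewrite -big_distrl mul1r /=; under eq_bigr do rewrite mul1r.
rewrite -big_distrl /= -[RHS]mul1r; congr (_ * _).
have -> : \sum_(i < N | (i < d.+1)%N) (new (tnth t i))%:R = c t.
  rewrite cE big_mkcondr; apply: eq_bigr => i _.
  by case: (new _).
rewrite divff// cE sumr_const pnatr_eq0 -lt0n.
by apply/card_gt0P; exists o; rewrite unfold_in.
Qed.

(* One arrival: the block of d letters is read, a new letter of it is chosen
   uniformly, and the block is discarded. *)
Definition block_value d (new : pred T) (F : T -> seq T -> R) (F0 : seq T -> R)
    (s : seq T) : R :=
  let A := [seq x <- take d s | new x] in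
  if A is [::] then F0 (drop d s)
  else (size A)%:R^-1 * \sum_(x <- A) F x (drop d s).

(* The same arrival, when letters are read only up to the first new one. *)
Fixpoint lazy_value n d (new : pred T) (F : T -> seq T -> R) (F0 : seq T -> R) X : R :=
  if d is d'.+1 then
    #|X|%:R^-1 * \sum_(x in X)
      if new x then samp n (X :\ x) (F x) else lazy_value n d' new F F0 (X :\ x)
  else samp n X F0.

Lemma samp_block n d new F F0 X : (d + n <= #|X|)%N ->
  samp (d + n) X (block_value d new F F0) = lazy_value n d new F F0 X.
Proof.
elim: d X => [|d IH] X dX.
  by apply: eq_samp => s _; rewrite /block_value take0 drop0.
have cX x : x \in X -> (d + n <= #|X :\ x|)%N.
  by move=> xX; move: dX; rewrite (cardsD1 x X) xX.
pose hd (b : bool) (H : seq T -> R) s := if s is x :: _ then (new x == b)%:R * H s else 0.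
rewrite (@eq_samp _ X _ (fun s => hd true (block_value d.+1 new F F0) s +
   hd false (block_value d.+1 new F F0) s)); last first.
  move=> [//|x s] _ /=; rewrite /hd; case: (new x) => /=.
    by rewrite mul1r mul0r addr0.
  by rewrite mul1r mul0r add0r.
rewrite sampD.
rewrite (@eq_samp _ X (hd true _) (fun s => if s is x :: _ then
    (new x)%:R * ((size [seq z <- take d.+1 s | new z])%:R^-1 *
       \sum_(z <- [seq z <- take d.+1 s | new z]) F z (drop d.+1 s)) else 0)); last first.
  move=> [//|x s] _ /=; rewrite /hd eqb_id /block_value /=.
  by case: (new x); rewrite ?mul0r.
rewrite samp_pick_first /= -mulrDr -big_split /=; congr (_ * _).
apply: eq_bigr => x xX; case: (boolP (new x)) => nx.
  rewrite [X in _ + X](@eq_samp _ _ _ (fun=> 0)) ?samp_const ?addr0 ?cX//; last first.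
    by move=> s _; rewrite mul0r.
  under eq_samp do rewrite mul1r.
  by rewrite -(samp_drop _ (cX x xX)).
rewrite (@eq_samp _ _ _ (fun=> 0)) ?samp_const ?add0r ?cX//; last by move=> s _; rewrite mul0r.
rewrite -IH ?cX//; apply: eq_samp => s _.
by rewrite mul1r /block_value /= (negbTE nx).
Qed.

End sampling.

(** * Hitting probabilities of a process with memory *)

Section hitting.
Context {R : numFieldType} {X : finType}.
Variables (q : seq X -> X -> R) (stop : pred (seq X)).

Fixpoint hit_value n s : R :=
  if stop s then 1
  else if n is n'.+1 then \sum_x q s x * hit_value n' (rcons s x) else 0.

Let run_prob n s (c : n.-tuple X) := \prod_(t < n) q (s ++ take t c) (tnth c t).

Lemma sum_tupleS n (F : n.+1.-tuple X -> R) :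
  \sum_(c : n.+1.-tuple X) F c = \sum_x \sum_(c : n.-tuple X) F [tuple of x :: c].
Proof.
rewrite pair_bigA /= (reindex (fun y : X * n.-tuple X => [tuple of y.1 :: y.2])) //=.
exists (fun t : n.+1.-tuple X => (thead t, [tuple of behead t])).
  by move=> [x t] _; congr pair; apply: val_inj.
by move=> t _; rewrite /= [RHS]tuple_eta; apply: val_inj.
Qed.

Lemma run_prob_cons n s x (c : n.-tuple X) :
  run_prob s [tuple of x :: c] = q s x * run_prob (rcons s x) c.
Proof.
rewrite /run_prob big_ord_recl take0 cats0; congr (_ * _).
by apply: eq_bigr => i _; rewrite -cats1 -catA /= tnthS.
Qed.

Hypothesis q1 : forall s, \sum_x q s x = 1.

Lemma sum_run_prob n s : \sum_(c : n.-tuple X) run_prob s c = 1.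
Proof.
elim: n s => [|n IH] s.
  by under eq_bigr do rewrite /run_prob big_ord0; rewrite sumr_const card_tuple expn0.
rewrite sum_tupleS -[RHS](q1 s); apply: eq_bigr => x _.
by under eq_bigr do rewrite run_prob_cons; rewrite -big_distrr /= IH mulr1.
Qed.

(** Once [stop] holds, the remaining steps have total mass 1, so the recursion may end there. The
    present history and the one after all [n] steps both count, hence the times in ['I_n.+1]. *)
Lemma hit_valueE n s :
  \sum_(c : n.-tuple X) run_prob s c * [exists t : 'I_n.+1, stop (s ++ take t c)]%:R
  = hit_value n s.
Proof.
elim: n s => [|n IH] s /=; case: ifP => ss.
- under eq_bigr => c _.
    rewrite (_ : [exists _, _]); last by apply/existsP; exists ord0; rewrite take0 cats0.
    rewrite mulr1; over.
  exact: sum_run_prob.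
- rewrite big1// => c _; rewrite (_ : [exists _, _] = false) ?mulr0//.
  by apply/existsP => -[t]; rewrite tuple0 /= cats0 ss.
- under eq_bigr => c _.
    rewrite (_ : [exists _, _]); last by apply/existsP; exists ord0; rewrite take0 cats0.
    rewrite mulr1; over.
  exact: sum_run_prob.
- rewrite sum_tupleS; apply: eq_bigr => x _.
  rewrite -IH big_distrr /=; apply: eq_bigr => c _.
  rewrite run_prob_cons -mulrA; congr (_ * (_ * _%:R)).
  congr nat_of_bool; apply/existsP/existsP => -[t].
    case: (unliftP ord0 t) => [j ->|->]; last by rewrite take0 cats0 ss.
    by move=> h; exists j; rewrite -cats1 -catA.
  by rewrite -cats1 -catA => h; exists (lift ord0 t).
Qed.

End hitting.

(** * The chain that reads half-edges one at a time *)

Section lazy_chain.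
Context {R : numFieldType} {H U : finType}.
Variables (tg : H -> U) (real : pred U) (bad : nat -> nat -> bool).
Implicit Types (X : {set H}) (seen : {set U}).

(* Half-edges are read one by one and X is the set of unread ones, so that the
   matched vertices are the real ones with a half-edge outside X. *)
Definition seen_of X : {set U} := [set u | real u && [exists h, (h \notin X) && (tg h == u)]].

Definition fresh seen : pred H := fun x => real (tg x) && (tg x \notin seen).

(** Counterpart of [hit_value] when the letters to come are given in advance as a word [s], cut into
    blocks of lengths [ds]; of the past only the set of matched vertices is kept. *)
Fixpoint block_hit ds t seen (s : seq H) : R :=
  if bad t #|seen| then 1
  else if ds is d :: ds' then
    block_value d (fresh seen) (fun x => block_hit ds' t.+1 (tg x |: seen))
      (block_hit ds' t.+1 seen) s
  else 0.

Fixpoint arrival (K : {set H} -> R) d X : R :=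
  if d is d'.+1 then
    #|X|%:R^-1 * \sum_(x in X)
      if fresh (seen_of X) x then K (X :\ x) else arrival K d' (X :\ x)
  else K X.

Fixpoint lazy_hit ds t X : R :=
  if bad t #|seen_of X| then 1
  else if ds is d :: ds' then arrival (lazy_hit ds' t.+1) d X else 0.

Lemma seen_of_fresh X x : fresh (seen_of X) x ->
  seen_of (X :\ x) = tg x |: seen_of X.
Proof.
move=> /andP[rx _]; apply/finset.setP => u; rewrite !inE.
have [->|ux] := eqVneq u (tg x) => /=.
  by rewrite rx; apply/existsP; exists x; rewrite !inE !eqxx.
congr (_ && _); apply/existsP/existsP => -[h /andP[hX /eqP hu]]; exists h; rewrite hu eqxx andbT.
  move: hX; rewrite !inE negb_and negbK => /orP[/eqP hx|//].
  by move: ux; rewrite -hu hx eqxx.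
by rewrite !inE negb_and hX orbT.
Qed.

(** A stale half-edge sits at the extra vertex or at a vertex with another half-edge already read,
    so it marks nothing new. With [seen_of_fresh] this makes the set of unread half-edges a
    sufficient state. *)
Lemma seen_of_stale X x : ~~ fresh (seen_of X) x -> seen_of (X :\ x) = seen_of X.
Proof.
move=> nx; apply/finset.setP => u; rewrite !inE.
case ru: (real u) => //=; apply/existsP/existsP => -[h /andP[hX /eqP hu]]; last first.
  by exists h; rewrite hu eqxx !inE negb_and hX orbT.
move: hX; rewrite !inE negb_and negbK => /orP[/eqP hx|hX]; last by exists h; rewrite hX hu eqxx.
move: nx; rewrite /fresh -hx hu ru /= negbK !inE => /andP[_ /existsP[h' h'X]].
by exists h'.
Qed.

(** The [k] letters never read will be the partners of the half-edges of the extra vertex of V,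
    whose edges are deleted. *)
Lemma samp_block_hit ds k t X : (sumn ds + k <= #|X|)%N ->
  samp (sumn ds + k) X (block_hit ds t (seen_of X)) = lazy_hit ds t X.
Proof.
elim: ds t X => [|d ds IH] t X dX /=; case: ifP => _.
- exact: samp_const.
- exact: samp_const.
- exact: samp_const.
rewrite -addnA samp_block ?addnA//.
elim: d X dX => [|d IHd] X dX; first exact: IH.
rewrite [RHS]/=; congr (_ * _); apply: eq_bigr => x xX.
have cX : (d + sumn ds + k <= #|X :\ x|)%N by move: dX; rewrite (cardsD1 x X) xX.
case: ifP => fx.
  rewrite -seen_of_fresh// IH//; apply: leq_trans cX.
  by rewrite leq_add2r leq_addl.
rewrite -[in RHS]IHd// seen_of_stale ?fx//.
Qed.

End lazy_chain.

(** * GREEDY on a uniform pairing as a chain of half-edges *)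

Lemma matching_of_rcons_None (E : finType) (s : seq (option E)) : matching_of (rcons s None) = matching_of s.
Proof. by apply/finset.setP => e; rewrite !inE mem_rcons inE. Qed.

Lemma matching_of_rcons_Some (E : finType) (s : seq (option E)) e :
  matching_of (rcons s (Some e)) = e |: matching_of s.
Proof. by apply/finset.setP => e'; rewrite !inE mem_rcons inE. Qed.

Section greedy_on_pairing.
Context {R : numFieldType} {N T : nat} (d : degrees N T) (bad : nat -> nat -> bool).
Implicit Type f : {ffun halfV d -> halfU d}.
Implicit Type s : seq (option (halfV d)).

Let tgU (x : halfU d) : 'I_N.+1 := tag x.
Let real (u : 'I_N.+1) := u != ord_max.
Let endU f (h : halfV d) := tgU (f h).
Let endV (h : halfV d) : nat := tag h.
Let step f := greedy_step (endU f) endV (cm_edges f) R.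
Let avail f := available (endU f) endV (cm_edges f).
Let stop s := bad (size s) #|matching_of s|.
Let matched f s : {set 'I_N.+1} := endU f @: matching_of s.

Let fiber (j : 'I_T.+1) : seq (halfV d) := [seq Tagged (fun j => 'I_(degV d j)) k | k <- enum 'I_(degV d j)].
(** The half-edges of U met by the arrivals from [t] on, in order; those paired with the extra
    vertex of V come last. *)
Let letters f t : seq (halfU d) := [seq f h | h <- flatten [seq fiber j | j <- drop t (enum 'I_T.+1)]].
Let ds := [seq d.2 j | j <- enum 'I_T].

Lemma degV_real t (tT : (t < T)%N) :
  degV d (lift ord_max (Ordinal tT)) = d.2 (Ordinal tT).
Proof. by rewrite /degV liftK. Qed.

Lemma lettersS f t (tT : (t < T)%N) :
  letters f t = [seq f h | h <- fiber (lift ord_max (Ordinal tT))] ++ letters f t.+1.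
Proof.
rewrite /letters (drop_nth ord0) ?size_enum_ord 1?ltnW//= map_cat.
congr (map _ (fiber _) ++ _); apply: val_inj.
by rewrite /= nth_enum_ord 1?ltnW// /bump leqNgt tT.
Qed.

Lemma size_fiber j : size (fiber j) = degV d j.
Proof. by rewrite size_map size_enum_ord. Qed.

Lemma dsS t (tT : (t < T)%N) : drop t ds = d.2 (Ordinal tT) :: drop t.+1 ds.
Proof.
have x0 := Ordinal tT.
rewrite (drop_nth 0%N); last by rewrite size_map -[X in (_ < X)%N](size_enum_ord T) in tT *.
rewrite (nth_map x0) ?size_enum_ord//.
by congr (d.2 _ :: _); apply: val_inj; rewrite /= nth_enum_ord.
Qed.

(** An edge is available when its end in U is an actual vertex not yet matched. The extra vertex of
    U is excluded by [cm_edges] on the side of GREEDY and by [real] on the side of the chain. *)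
Lemma fresh_fiber f s (tT : (size s < T)%N) :
  perm_eq [seq h <- fiber (lift ord_max (Ordinal tT)) | fresh tgU real (matched f s) (f h)]
          (enum (avail f s)).
Proof.
apply: uniq_perm.
- by rewrite filter_uniq// map_inj_uniq ?enum_uniq// => k k' /eqP; rewrite eq_Tagged => /eqP.
- exact: enum_uniq.
move=> h; rewrite mem_filter mem_enum !inE /endV.
have -> : (h \in fiber (lift ord_max (Ordinal tT))) = ((tag h : nat) == size s).
  apply/mapP/eqP => [[k _ ->]|hs]; first by rewrite /= /bump leqNgt tT.
  case: h hs => j k /= js.
  have jE : j = lift ord_max (Ordinal tT).
    by apply: val_inj; rewrite /= /bump leqNgt tT.
  by subst j; exists k; rewrite ?mem_enum.
case: eqP => [hs|]; rewrite ?andbF ?andbT//=.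
have -> /= : tag h != ord_max.
  by apply: contraTneq tT => h'; rewrite -hs h' /= ltnn.
rewrite /fresh; congr (_ && _).
apply/negP/forall_inP => [nh e em|hh /imsetP[e em eE]].
  by apply: contra_not_neq nh => he; apply/imsetP; exists e.
by have := hh e em; rewrite /endU -/(tgU _) eE eqxx.
Qed.

(** GREEDY uses the pairing only through the successive blocks of [letters f]. The hypothesis on
    cardinals is an invariant: [stop] counts edges and [block_hit] counts matched vertices, and the
    two agree because a chosen edge always ends at an unmatched vertex. *)
Lemma hit_value_block f n s : (n + size s = T)%N ->
  #|matched f s| = #|matching_of s| ->
  hit_value (step f) stop n s
  = block_hit tgU real bad (drop (size s) ds) (size s) (matched f s) (letters f (size s)).
Proof.
elim: n s => [|n IH] s nT cs.
  rewrite drop_oversize /= ?/stop ?cs//.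
  by rewrite size_map -[X in (X <= _)%N]/(size (enum 'I_T)) size_enum_ord;
    move/eqP: nT; rewrite add0n eqn_leq => /andP[].
have tT : (size s < T)%N.
  by move/eqP: nT; rewrite addSn eqn_leq => /andP[/(leq_trans _)-> //]; rewrite ltnS leq_addl.
rewrite (dsS tT) /= /stop cs; case: ifP => // _.
have pA := fresh_fiber f tT.
rewrite /block_value.
have -> : take (d.2 (Ordinal tT)) (letters f (size s)) =
    [seq f h | h <- fiber (lift ord_max (Ordinal tT))].
  by rewrite (lettersS f tT) -degV_real -size_fiber -(size_map f) take_size_cat.
have -> : drop (d.2 (Ordinal tT)) (letters f (size s)) = letters f (size s).+1.
  by rewrite (lettersS f tT) -degV_real -size_fiber -(size_map f) drop_size_cat.
rewrite filter_map; set fl := [seq h <- _ | _].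
have {}pA : perm_eq fl (enum (avail f s)) by [].
rewrite (bigID (pred1 None)) /= big_pred1_eq.
rewrite (reindex_omap Some id) /=; last by case.
under eq_bigl do rewrite eqxx.
rewrite {1}/step /= -/(avail f s).
have szE : size fl = #|avail f s| by rewrite (perm_size pA) -cardE.
have none : hit_value (step f) stop n (rcons s None) =
    block_hit tgU real bad (drop (size s).+1 ds) (size s).+1 (matched f s)
      (letters f (size s).+1).
  have mE : matched f (rcons s None) = matched f s by rewrite /matched matching_of_rcons_None.
  by rewrite IH ?size_rcons ?addnS ?mE// matching_of_rcons_None.
have [A0|A0] := eqVneq (avail f s) finset.set0.
  have -> : fl = [::] by apply: size0nil; rewrite szE A0 cards0.
  rewrite /= mul1r none big1 ?addr0// => e _.
  by rewrite -/(avail f s) A0 inE !mul0r.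
rewrite mul0r add0r.
transitivity (#|avail f s|%:R^-1 * \sum_(e in avail f s) hit_value (step f) stop n (rcons s (Some e))).
  rewrite big_distrr /= [RHS]big_mkcond /=; apply: eq_bigr => e _.
  rewrite -/(avail f s); case: (e \in avail f s); last by rewrite !mul0r.
  by rewrite mul1r.
have sum_fl : \sum_(e in avail f s) hit_value (step f) stop n (rcons s (Some e)) =
    \sum_(x <- map f fl) block_hit tgU real bad (drop (size s).+1 ds) (size s).+1
       (tgU x |: matched f s) (letters f (size s).+1).
  rewrite big_map (perm_big _ pA) /= big_enum /=; apply: eq_bigr => e eA.
  have em : endU f e \notin matched f s.
    move: eA; rewrite /avail !inE => /and3P[_ _ /forall_inP h].
    by apply/imsetP => -[e' /h]; rewrite eq_sym => /eqP.
  have mE : matched f (rcons s (Some e)) = tgU (f e) |: matched f s.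
    by rewrite /matched matching_of_rcons_Some imsetU1.
  have eN : e \notin matching_of s.
    by apply: contra em => em; apply/imsetP; exists e.
  rewrite IH ?size_rcons ?addnS ?mE// matching_of_rcons_Some.
  by rewrite !cardsU1 em eN cs.
rewrite -szE sum_fl; move: A0; rewrite -cards_eq0 -szE.
by case: fl {pA szE sum_fl} => [//|h fl] /= _; rewrite size_map.
Qed.

Lemma letters0 f : letters f 0 = codom f.
Proof.
rewrite /letters drop0 codomE; congr map.
rewrite [RHS]enumT unlock /= /tag_enum; congr flatten.
by rewrite -!enumT; apply: eq_map => j; rewrite /fiber -enumT.
Qed.

Lemma sumn_ds : (sumn ds + degV d ord_max)%N = #|[set: halfU d]%SET|.
Proof.
rewrite cardsT card_halfU_halfV card_tagged !sumnE !big_map -!big_enum /= !big_enum /=.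
rewrite [RHS]big_ord_recr /= card_ord; congr (_ + _)%N.
apply: eq_bigr => j _; rewrite card_ord /degV.
have -> : widen_ord (leqnSn T) j = lift ord_max j.
  by apply: val_inj; rewrite /= /bump leqNgt ltn_ord.
by rewrite liftK.
Qed.

(** Both sides have equally many half-edges, so the words [codom f] of the pairings are all the
    orderings of the half-edges of U: a uniform pairing is a complete sample without replacement.
    The number of pairings comes from the same identity for the constant 1. *)
Lemma sum_pairings (F : seq (halfU d) -> R) :
  #|pairings d|%:R^-1 * \sum_(f in pairings d) F (codom f)
  = samp #|halfU d| finset.setT F.
Proof.
have -> : #|halfU d| = #|halfV d| by exact: card_halfU_halfV.
rewrite samp_tuple cardsT.
have sumE (G : seq (halfU d) -> R) : \sum_(f in pairings d) G (codom f) =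
    \sum_(t : #|halfV d|.-tuple (halfU d) | uniq t && all [in finset.setT] t) G t.
  rewrite [RHS](reindex fgraph) /=; last first.
    by exists Finfun => ? _; rewrite ?fgraphK ?FinfunK.
  apply: eq_big => f //=; rewrite inE /injectiveb /dinjectiveb.
  rewrite -codom_ffun codomE; set b := uniq _.
  rewrite (_ : all _ _ = true) ?andbT//.
  by apply/allP => x _; rewrite inE.
rewrite -sumE; congr (_^-1 * _).
have := sumE (fun=> 1); rewrite sumr_const => ->.
have := samp_const (n := #|halfV d|) (X := [set: halfU d]%SET) (1 : R).
rewrite cardsT card_halfU_halfV leqnn => /(_ isT).
rewrite samp_tuple cardsT card_halfU_halfV => h.
have n0 : (#|halfV d| ^_ #|halfV d|)%:R != 0 :> R by rewrite pnatr_eq0 -lt0n ffact_gt0.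
by rewrite -[RHS]mulr1 -[X in _ = _ * X]h mulVKf.
Qed.

(** All that has to be known about the pairing and about GREEDY is in this identity: given the
    degrees, the probability of meeting a bad state is that of the lazy chain started with nothing
    read. *)
Lemma sum_cond_weight_hit :
  \sum_(r : run_type d) cond_weight R r *
      [exists t : 'I_T.+1, bad t #|matching_of (take t r.2)|]%:R
  = lazy_hit tgU real bad ds 0 finset.setT.
Proof.
rewrite -(samp_block_hit _ _ _ (k := degV d ord_max)) ?sumn_ds ?leqnn//.
have -> : seen_of tgU real finset.setT = finset.set0.
  apply/finset.setP => u; rewrite !inE; apply/negP => /andP[_ /existsP[h]].
  by rewrite inE.
rewrite cardsT -sum_pairings big_distrr /=.
rewrite -(pair_bigA _ (fun f c => cond_weight R (f, c) *
      [exists t : 'I_T.+1, bad t #|matching_of (take t c)|]%:R)) /=.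
rewrite [RHS]big_mkcond /=; apply: eq_bigr => f _.
rewrite -letters0; under eq_bigr => c _.
  rewrite /cond_weight /=.
  over.
case: (f \in pairings d); last by rewrite big1// => c _; rewrite !mul0r.
transitivity (#|pairings d|%:R^-1 * hit_value (step f) stop T [::]); last first.
  congr (_ * _).
  have m0 : matching_of ([::] : seq (option (halfV d))) = finset.set0.
    by apply/finset.setP => e; rewrite !inE.
  rewrite hit_value_block ?addn0//= ?drop0 /matched m0 imset0//.
  by rewrite !cards0.
rewrite -hit_valueE; last by move=> s; exact: sum_greedy_step.
rewrite big_distrr /=; apply: eq_bigr => c _.
rewrite mul1r -!mulrA; congr (_ * (_ * _%:R)).
congr nat_of_bool; apply: eq_existsb => t; rewrite /stop /= size_takel//.
by rewrite size_tuple -ltnS.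
Qed.

End greedy_on_pairing.

(** * The expected effect of one arrival *)

Section arrival_theory.
Context {R : numFieldType} {H U : finType}.
Variables (tg : H -> U) (real : pred U).
Implicit Types (X : {set H}) (K : {set H} -> R).

Local Notation arrival := (@arrival R H U tg real).
Local Notation fresh_in X := (fresh tg real (seen_of tg real X)).

(** Only the sets reachable in one arrival are compared, which lets bounds that hold near [X] be
    used. *)
Lemma le_arrival K K' d X :
  (forall X', X' \subset X -> (#|X| <= #|X'| + d)%N -> K X' <= K' X') ->
  arrival K d X <= arrival K' d X.
Proof.
elim: d X => [|d IH] X KK' /=; first by apply: KK'; rewrite ?addn0.
rewrite ler_wpM2l ?invr_ge0//; apply: ler_sum => x xX.
have cX : #|X| = #|X :\ x|.+1 by rewrite (cardsD1 x X) xX.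
have sX : X :\ x \subset X by rewrite subD1set.
case: ifP => _; first by apply: KK' => //; rewrite cX addnS ltnS leq_addr.
apply: IH => X' X'X h; apply: KK'; first exact: fintype.subset_trans X'X sX.
by rewrite cX addnS ltnS.
Qed.

Lemma arrivalZD a K K' d X :
  arrival (fun X => a * K X + K' X) d X = a * arrival K d X + arrival K' d X.
Proof.
elim: d X => [//|d IH] X /=.
rewrite mulrCA -mulrDr; congr (_ * _).
rewrite big_distrr /= -big_split /=; apply: eq_bigr => x _.
by case: ifP.
Qed.

Lemma arrival_sum (I : Type) (r : seq I) (K : I -> {set H} -> R) d X :
  arrival (fun X => \sum_(i <- r) K i X) d X = \sum_(i <- r) arrival (K i) d X.
Proof.
elim: d X => [//|d IH] X /=.
rewrite -big_distrr /= exchange_big; congr (_ * _); apply: eq_bigr => x _.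
by case: ifP.
Qed.

Lemma arrival0 d X : arrival (fun=> 0) d X = 0.
Proof.
elim: d X => [//|d IH] X /=.
by rewrite big1 ?mulr0// => x _; rewrite IH; case: ifP.
Qed.

Lemma arrivalZ a K d X : arrival (fun X => a * K X) d X = a * arrival K d X.
Proof.
rewrite -[RHS]addr0 -(arrival0 d X) -arrivalZD; congr (arrival _ d X).
by apply/funext => X'; rewrite addr0.
Qed.

Lemma arrival_const c d X : (d <= #|X|)%N -> arrival (fun=> c) d X = c.
Proof.
elim: d X => [//|d IH] X dX /=.
under eq_bigr => x xX.
  rewrite IH; last by move: dX; rewrite (cardsD1 x X) xX.
  rewrite if_same; over.
rewrite sumr_const -[c *+ _]mulr_natl mulKf// pnatr_eq0 -lt0n.
exact: leq_trans dX.
Qed.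

Lemma arrival_le1 K d X : (forall X, K X <= 1) -> arrival K d X <= 1.
Proof.
move=> K1; elim: d X => [//|d IH] X /=.
have [->|X0] := eqVneq X finset.set0; first by rewrite big_set0 mulr0 ler01.
rewrite ler_pdivrMl ?ltr0n ?card_gt0// mulr1.
rewrite -[leRHS]sumr_const; apply: ler_sum => x _.
by case: ifP.
Qed.

Definition nfresh X : nat := #|[set x in X | fresh_in X x]|.

(** As long as an arrival has read only stale half-edges, no fresh one has been gained or lost. So,
    if the first i reads were stale, the next is fresh with probability [nfresh X / (#|X| - i)], the
    ratio that [arrival_read] assumes close to [x]. *)
Lemma nfresh_stale X x : ~~ fresh_in X x -> nfresh (X :\ x) = nfresh X.
Proof.
move=> nx; rewrite /nfresh seen_of_stale//.
apply: eq_card => y; rewrite !inE; case: eqVneq => //= ->.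
by rewrite (negbTE nx) andbF.
Qed.

(* a_d(x) = 1 + (1-x) + ... + (1-x)^(d-1) is the mean number of letters read by
   an arrival of degree d when each letter is fresh with probability x. *)
Definition mean_read (d : nat) (x : R) : R := \sum_(j < d) (1 - x) ^+ j.

Lemma mean_readS d x : mean_read d.+1 x = 1 + (1 - x) * mean_read d x.
Proof.
rewrite /mean_read big_ord_recl expr0 big_distrr /=; congr (_ + _).
by apply: eq_bigr => j _; rewrite -exprS.
Qed.

Lemma mean_read_ge0 d x : 0 <= x <= 1 -> 0 <= mean_read d x.
Proof. by move=> x01; apply: sumr_ge0 => j _; rewrite exprn_ge0//; move: x01; rewrite subr_ge0 => /andP[]. Qed.

Lemma mean_read_le d x : 0 <= x <= 1 -> mean_read d x <= d%:R.
Proof.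
move=> /andP[x0 x1]; rewrite -[d in leRHS]card_ord -sumr_const; apply: ler_sum => j _.
by rewrite exprn_ile1// ?subr_ge0// gerBl.
Qed.

(** Induction on [d] along [mean_readS]. Replacing the probability that the first letter is stale by
    [1 - x] costs [eta] times [mean_read d x], at most [d * eta], and these costs sum to at most
    [d ^ 2 * eta]. *)
Lemma arrival_read d X x eta : 0 <= x <= 1 -> (d <= #|X|)%N ->
  (forall i, (i < d)%N -> `|(nfresh X)%:R / (#|X| - i)%:R - x| <= eta) ->
  `|(#|X|%:R - arrival (fun X' => #|X'|%:R) d X) - mean_read d x| <= (d ^ 2)%:R * eta.
Proof.
move=> x01; elim: d X => [|d IH] X dX hX.
  by rewrite /mean_read big_ord0 /= subrr subr0 normr0 mul0r.
have eta0 : 0 <= eta by apply: le_trans (hX 0%N isT); rewrite normr_ge0.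
have X0 : (0 < #|X|)%N by exact: leq_trans dX.
have r0 : #|X|%:R != 0 :> R by rewrite pnatr_eq0 -lt0n.
set r : R := #|X|%:R; set u : R := (nfresh X)%:R.
have uE : u = \sum_(y in X) (fresh_in X y)%:R.
  rewrite /u /nfresh -sum1_card natr_sum big_mkcond [RHS]big_mkcond /=.
  by apply: eq_bigr => y _; rewrite inE; case: (y \in X) => //=; case: (fresh_in X y).
have rE : r = \sum_(y in X) 1 by rewrite sumr_const.
(* The first letter is always read; the others are read only if it is stale. *)
have -> : r - arrival (fun X' => #|X'|%:R) d.+1 X =
    1 + r^-1 * \sum_(y in X) (~~ fresh_in X y)%:R *
        (#|X :\ y|%:R - arrival (fun X' => #|X'|%:R) d (X :\ y)).
  rewrite [arrival _ d.+1 X]/=.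
  have -> : r - r^-1 * \sum_(y in X) (if fresh_in X y then #|X :\ y|%:R
        else arrival (fun X' => #|X'|%:R) d (X :\ y)) =
      r^-1 * \sum_(y in X) (r - (if fresh_in X y then #|X :\ y|%:R
        else arrival (fun X' => #|X'|%:R) d (X :\ y))).
    by rewrite sumrB sumr_const -mulr_natr mulrBr mulrA mulVf// mul1r.
  rewrite -[X in _ = X + _](mulVf r0) -mulrDr -/r [in X in _ = _ * (X + _)]rE -big_split /=.
  congr (_ * _); apply: eq_bigr => y yX.
  have -> : r = 1 + #|X :\ y|%:R by rewrite /r (cardsD1 y X) yX natrD.
  by case: (fresh_in X y) => /=; ring.
rewrite mean_readS.
have -> : 1 + r^-1 * (\sum_(y in X) (~~ fresh_in X y)%:R *
    (#|X :\ y|%:R - arrival (fun X' => #|X'|%:R) d (X :\ y))) - (1 + (1 - x) * mean_read d x)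
  = r^-1 * (\sum_(y in X) (~~ fresh_in X y)%:R *
    ((#|X :\ y|%:R - arrival (fun X' => #|X'|%:R) d (X :\ y)) - mean_read d x))
    - (u / r - x) * mean_read d x.
  under [in RHS]eq_bigr do rewrite mulrBr.
  rewrite sumrB -big_distrl /=.
  have -> : \sum_(y in X) (~~ fresh_in X y)%:R = r - u.
    rewrite rE uE -sumrB; apply: eq_bigr => y _.
    by case: (fresh_in X y); rewrite /= ?subrr ?subr0.
  by rewrite -/r; field.
apply: le_trans (ler_normB _ _) _.
have -> : (d.+1 ^ 2 = d ^ 2 + (2 * d + 1))%N by rewrite -addn1 sqrnD; lia.
rewrite natrD [leRHS]mulrDl lerD//; last first.
  rewrite normrM (ger0_norm (mean_read_ge0 _ x01)) mulrC.
  have /= := hX 0%N isT; rewrite subn0 -/u -/r => h.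
  apply: le_trans (ler_pM _ _ (mean_read_le d x01) h) _ => //.
    exact: mean_read_ge0.
  by rewrite ler_wpM2r// ler_nat; lia.
rewrite normrM ger0_norm ?invr_ge0// ler_pdivrMl ?ltr0n//.
apply: le_trans (ler_norm_sum _ _ _) _.
rewrite -/r {1}rE big_distrl /=; apply: ler_sum => y yX; rewrite mul1r normrM normr_nat.
have cX : #|X| = #|X :\ y|.+1 by rewrite (cardsD1 y X) yX.
case fy: (fresh_in X y); first by rewrite mul0r mulr_ge0.
rewrite mul1r; apply: IH; first by rewrite cX in dX.
move=> i id; rewrite nfresh_stale ?fy//.
by have := hX i.+1 id; rewrite cX subSS.
Qed.

End arrival_theory.

(** * Averaging over the degrees of the arrivals *)

Section annealed.
Context {R : realFieldType} {H U : finType}.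
Variables (tg : H -> U) (real : pred U) (bad : nat -> nat -> bool).
Variables (p : nat -> R) (L : nat).
Implicit Types (X : {set H}) (F : seq nat -> R).

Local Notation arrival := (@arrival R H U tg real).
Local Notation lazy_hit := (@lazy_hit R H U tg real bad).

(** Average over [n] independent degrees restricted to values at most [L]. The weights may sum to
    less than 1, the rest being the mass lost by truncation. *)
Fixpoint wsum n F : R :=
  if n is n'.+1 then \sum_(k < L.+1) p k * wsum n' (fun s => F ((k : nat) :: s)) else F [::].

Hypothesis p_ge0 : forall k, 0 <= p k.
Hypothesis p_le1 : \sum_(k < L.+1) p k <= 1.

Lemma wsum_le1 n F : (forall s, F s <= 1) -> wsum n F <= 1.
Proof.
elim: n F => [|n IH] F F1 /=; first exact: F1.
by apply: le_trans p_le1; apply: ler_sum => k _; rewrite ler_piMr ?IH.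
Qed.

(** The degrees to come do not influence the current arrival and can be averaged inside it; this
    makes the annealed chain Markov in the set of unread half-edges. *)
Lemma wsum_arrival n (K : seq nat -> {set H} -> R) d X :
  wsum n (fun s => arrival (K s) d X) = arrival (fun X' => wsum n (K^~ X')) d X.
Proof.
elim: n K => [//|n IH] K /=.
under eq_bigr do rewrite IH -arrivalZ.
by rewrite -arrival_sum.
Qed.

Lemma lazy_hit_le1 ds t X : lazy_hit ds t X <= 1.
Proof.
elim: ds t X => [|d ds IH] t X /=; case: ifP => // _.
exact: arrival_le1.
Qed.

(* The last hypothesis says that B is a supermartingale of the annealed chain
   as long as it is less than 1. *)
Lemma barrier_le T (B : nat -> {set H} -> R) :
  (forall t X, 0 <= B t X) ->
  (forall t X, bad t #|seen_of tg real X| -> 1 <= B t X) ->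
  (forall t X, (t < T)%N -> B t X < 1 ->
     \sum_(k < L.+1) p k * arrival (B t.+1) k X <= B t X) ->
  forall n t X, (n + t = T)%N -> wsum n (fun ds => lazy_hit ds t X) <= B t X.
Proof.
move=> B0 Bbad Bstep; elim=> [|n IH] t X nt.
  by rewrite /=; case: ifP => [/Bbad|].
have [B1|B1] := ltP (B t X) 1; last first.
  by apply: le_trans B1; apply: wsum_le1 => s; exact: lazy_hit_le1.
have tT : (t < T)%N by rewrite -nt addSn ltnS leq_addl.
apply: le_trans (Bstep t X tT B1).
case bE: (bad t #|seen_of tg real X|); first by have := Bbad _ _ bE; rewrite leNgt B1.
rewrite /= bE; apply: ler_sum => k _; rewrite ler_wpM2l// wsum_arrival.
by apply: le_arrival => X' _ _; apply: IH; rewrite addnS.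
Qed.

End annealed.

(** * Uniform random sets of a given size *)

Section subset_averages.
Context {R : numFieldType} {H : finType}.
Implicit Types (X : {set H}) (B : {set H} -> R).
Local Notation m := #|H|.

(* Expected number of sets satisfying the weight B met when the elements of X
   are removed one by one in uniformly random order. *)
Fixpoint future B k X : R :=
  B X + if k is k'.+1 then #|X|%:R^-1 * \sum_(x in X) future B k' (X :\ x) else 0.

Lemma future_ge0 B k X : (forall X, 0 <= B X) -> 0 <= future B k X.
Proof.
move=> B0; elim: k X => [|k IH] X /=; first by rewrite addr0.
by rewrite addr_ge0// mulr_ge0 ?invr_ge0// sumr_ge0.
Qed.

Lemma le_future B k X : (forall X, 0 <= B X) -> B X <= future B k X.
Proof.
move=> B0; case: k => [|k] /=; first by rewrite addr0.
by rewrite lerDl mulr_ge0 ?invr_ge0// sumr_ge0// => x _; exact: future_ge0.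
Qed.

(** The recursion of [future] dominates its own mean after the removal of a uniform element,
    whatever rule decides when an arrival stops reading. The number of removals left is always the
    number of unread elements. *)
Lemma arrival_future (U : finType) (tg : H -> U) (real : pred U) B d X :
  (forall X, 0 <= B X) ->
  arrival tg real (fun X => future B #|X| X) d X <= future B #|X| X.
Proof.
move=> B0; elim: d X => [//|d IH] X /=.
have [->|/finset.set0Pn[x0 x0X]] := eqVneq X finset.set0.
  by rewrite big_set0 mulr0 future_ge0.
rewrite {2}(cardsD1 x0 X) x0X add1n /=; apply: ler_wpDl => //.
rewrite ler_wpM2l ?invr_ge0//; apply: ler_sum => x xX.
have -> : #|X :\ x0| = #|X :\ x|.
  have cE y : y \in X -> #|X :\ y| = #|X|.-1 by move=> yX; rewrite (cardsD1 y X) yX.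
  by rewrite !cE.
by case: ifP.
Qed.

Definition avg r B : R := 'C(m, r)%:R^-1 * \sum_(X : {set H} | #|X| == r) B X.

Lemma avgD r B1 B2 : avg r (fun X => B1 X + B2 X) = avg r B1 + avg r B2.
Proof. by rewrite /avg big_split mulrDr. Qed.

Lemma avg_setT B : avg m B = B finset.setT.
Proof.
rewrite /avg binn invr1 mul1r (big_pred1 finset.setT)// => X.
by rewrite /= eqEcard finset.subsetT cardsT /= eqn_leq max_card.
Qed.

(** Double counting: an r-set arises from m - r pairs formed by a larger set and the element
    removed, and (r+1) C(m, r+1) = (m - r) C(m, r). *)
Lemma avg_remove r B : (r < m)%N ->
  avg r.+1 (fun X => #|X|%:R^-1 * \sum_(x in X) B (X :\ x)) = avg r B.
Proof.
move=> rm; rewrite /avg.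
under eq_bigr => X /eqP -> do [].
rewrite -big_distrr /= (exchange_big_dep xpredT) //=.
have -> : \sum_x \sum_(X : {set H} | (#|X| == r.+1) && (x \in X)) B (X :\ x) =
    \sum_x \sum_(Y : {set H} | (#|Y| == r) && (x \notin Y)) B Y.
  apply: eq_bigr => x _.
  rewrite (reindex_onto (fun Y => x |: Y) (fun X => X :\ x)) /=; last first.
    by move=> X /andP[_ xX]; rewrite finset.setD1K.
  apply: eq_big => [Y|Y /andP[_ /eqP->]//].
  rewrite setU11 andbT cardsU1; case: (boolP (x \in Y)) => xY /=.
    rewrite andbF; apply/negbTE; rewrite negb_and; apply/orP; right.
    by apply: contraTneq xY => <-; rewrite !inE eqxx.
  by rewrite finset.setU1K// eqxx !andbT add1n eqSS.
rewrite (exchange_big_dep (fun Y : {set H} => #|Y| == r)) /=; last by move=> x Y _ /andP[].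
under [X in _ * (_ * X)]eq_bigr => Y /eqP Yr.
  rewrite Yr eqxx /= sumr_const (_ : #|_| = (m - r)%N); last first.
    have := cardsC Y; rewrite Yr => <-; rewrite addKn.
    by apply: eq_card => x; rewrite !inE.
  rewrite -mulr_natl; over.
rewrite -big_distrr /= !mulrA; congr (_ * _).
have b0 : 'C(m, r)%:R != 0 :> R by rewrite pnatr_eq0 -lt0n bin_gt0 ltnW.
have b1 : 'C(m, r.+1)%:R != 0 :> R by rewrite pnatr_eq0 -lt0n bin_gt0.
have := mul_bin_left m r => /(congr1 (fun n : nat => n%:R : R)).
rewrite !natrM => e; apply: (mulIf b0); rewrite mulVf// -!mulrA -e.
by rewrite mulKf// mulVf.
Qed.

Lemma avg_future B r : (r <= m)%N -> avg r (future B r) = \sum_(j < r.+1) avg j B.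
Proof.
elim: r => [|r IH] rm; rewrite big_ord_recr /=.
  rewrite big_ord0 add0r; congr (_ * _); apply: eq_bigr => X _; exact: addr0.
rewrite avgD avg_remove// IH 1?ltnW// addrC.
by [].
Qed.

End subset_averages.

(** * Exponential bounds *)

Section exponential_bounds.
Context {R : realType}.
Implicit Types x t : R.

Lemma expR_le_quadratic x : x <= 2^-1 -> expR x <= 1 + x + 2 * x ^+ 2.
Proof.
move=> x2; have x1 : 0 < 1 - x by lra.
apply: (@le_trans _ _ (1 - x)^-1).
  rewrite -[x in leLHS]opprK expRN lef_pV2 ?posrE ?expR_gt0//.
  exact: expR_ge1Dx.
rewrite -[leLHS]mul1r ler_pdivrMr//.
have -> : (1 + x + 2 * x ^+ 2) * (1 - x) = 1 + x ^+ 2 * (1 - 2 * x) by ring.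
by rewrite lerDl mulr_ge0 ?sqr_ge0//; lra.
Qed.

Lemma le_indic_expR th x t : 0 <= th ->
  (t < `|x|)%R%:R <= expR (th * x - th * t) + expR (- th * x - th * t).
Proof.
move=> th0; case: ltP => /= h; last by rewrite addr_ge0 ?expR_ge0.
case: (leP 0 x) h => x0.
  rewrite ger0_norm// => h; apply: ler_wpDr; first exact: expR_ge0.
  by apply: le_trans (expR_ge1Dx _); rewrite lerDl -mulrBr mulr_ge0// subr_ge0 ltW.
rewrite ltr0_norm// => h; apply: ler_wpDl; first exact: expR_ge0.
by apply: le_trans (expR_ge1Dx _); rewrite lerDl mulNr -mulrN -mulrBr mulr_ge0// subr_ge0 ltW.
Qed.

End exponential_bounds.

Section iid_tail.
Context {R : realType} {I : finType}.
Variables (p : nat -> R) (L : nat).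
Hypothesis p_ge0 : forall k, 0 <= p k.
Hypothesis p_le1 : \sum_(k < L.+1) p k <= 1.

(** Chernoff's bound around a value [al] that is not the mean under the truncated weights: it will
    be the mean of the full law, and [del] is the bias. As the weights sum to at most 1, each
    coordinate contributes a factor at most 1 + th del + 2 (th A)^2. *)
Lemma iid_tail (a : nat -> R) (al A del th t : R) :
  (forall k, (k <= L)%N -> `|a k - al| <= A) ->
  `|\sum_(k < L.+1) p k * (a k - al)| <= del -> 0 <= th -> th * A <= 2^-1 ->
  \sum_(b : {ffun I -> 'I_L.+1}) (\prod_i p (b i)) *
     (t < `|\sum_i a (b i) - #|I|%:R * al|)%R%:R
  <= 2 * expR (#|I|%:R * (th * del + 2 * (th * A) ^+ 2) - th * t).
Proof.
move=> aA ade th0 thA.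
have A0 : 0 <= A by apply: le_trans (aA 0%N isT); rewrite normr_ge0.
have main (s : R) : `|s| = th ->
    \sum_(b : {ffun I -> 'I_L.+1}) (\prod_i p (b i)) *
      expR (s * (\sum_i a (b i) - #|I|%:R * al) - th * t)
    <= expR (#|I|%:R * (th * del + 2 * (th * A) ^+ 2) - th * t).
  move=> sth.
  under eq_bigr => b _.
    rewrite expRD (_ : #|I|%:R * al = \sum_(i : I) al); last first.
      by rewrite sumr_const -[RHS]mulr_natl.
    rewrite -sumrB mulr_sumr expR_sum mulrA -big_split /=; over.
  rewrite -big_distrl /= expRD ler_wpM2r ?expR_ge0//.
  rewrite -(bigA_distr_bigA (fun (i : I) (k : 'I_L.+1) => p k * expR (s * (a k - al)))).
  rewrite prodr_const expRM_natl lerXn2r ?nnegrE ?expR_ge0//.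
    by apply: sumr_ge0 => k _; rewrite mulr_ge0 ?expR_ge0.
  apply: le_trans (expR_ge1Dx _).
  apply: (@le_trans _ _ (\sum_(k < L.+1) (p k * (1 + 2 * (th * A) ^+ 2) + s * (p k * (a k - al))))).
    apply: ler_sum => k _; rewrite [X in _ <= _ + X]mulrCA -mulrDr ler_wpM2l//.
    have sA : `|s * (a k - al)| <= th * A.
      by rewrite normrM sth ler_wpM2l// aA// -ltnS.
    have s2 : s * (a k - al) <= 2^-1 by exact: le_trans (ler_norm _) (le_trans sA thA).
    apply: le_trans (expR_le_quadratic s2) _.
    rewrite addrAC lerD2r lerD2l ler_wpM2l// -real_normK ?num_real//.
    by rewrite lerXn2r ?nnegrE ?mulr_ge0.
  rewrite big_split -mulr_suml -mulr_sumr /=.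
  have sd : s * (\sum_(k < L.+1) p k * (a k - al)) <= th * del.
    by apply: le_trans (ler_norm _) _; rewrite normrM sth ler_wpM2l.
  have := ler_piMl (_ : 0 <= 1 + 2 * (th * A) ^+ 2) p_le1.
  by rewrite addr_ge0 ?mulr_ge0 ?sqr_ge0// => /(_ isT) h; lra.
rewrite [leRHS]mulrDl mul1r.
have n1 := main th (ger0_norm th0).
have n2 := main (- th) (etrans (normrN _) (ger0_norm th0)).
apply: le_trans (lerD n1 n2); rewrite -big_split /=; apply: ler_sum => b _.
rewrite -mulrDr ler_wpM2l ?prodr_ge0//.
exact: le_indic_expR.
Qed.

End iid_tail.

(** * Comparison with Bernoulli sets of half-edges *)

Lemma prodrD_subsets (R : comNzRingType) (I : finType) (F G : I -> R) :
  \prod_i (F i + G i) = \sum_(J : {set I}) \prod_i (if i \in J then F i else G i).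
Proof. exact: (@bigA_distr R 0 1 *%R +%R I F G). Qed.

Section bernoulli.
Context {R : realFieldType} {H : finType}.
Implicit Types (X : {set H}) (B : {set H} -> R).
Local Notation m := #|H|.

Definition bern (y : R) B : R :=
  \sum_(X : {set H}) y ^+ #|X| * (1 - y) ^+ (m - #|X|) * B X.

Lemma bernE y B :
  bern y B = \sum_(X : {set H}) (\prod_h (if h \in X then y else 1 - y)) * B X.
Proof.
apply: eq_bigr => X _; congr (_ * _).
rewrite (bigID (mem X)) /=.
have -> : (m - #|X| = #|~: X|)%N by rewrite -(cardsC X) addKn.
rewrite -!prodr_const; congr (_ * _); first by apply: eq_bigr => h ->.
by apply: eq_big => h; rewrite inE// => /negbTE ->.
Qed.

(** Consecutive terms have ratio (m - j) r / ((j + 1)(m - r)), at least 1 for j < r and at most 1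
    from [r] on: [r] is the mode of the binomial law with parameters m and r/m, written here without
    the denominator m^m. *)
Lemma binomial_mode r k : (r <= m)%N -> (k <= m)%N ->
  ('C(m, k) * (r ^ k * (m - r) ^ (m - k)) <= 'C(m, r) * (r ^ r * (m - r) ^ (m - r)))%N.
Proof.
move=> rm km; pose a k := ('C(m, k) * (r ^ k * (m - r) ^ (m - k)))%N.
rewrite -/(a k) -/(a r).
have stepE j : (j < m)%N -> (j.+1 * a j.+1 = (m - j) * r * ('C(m, j) * (r ^ j * (m - r) ^ (m - j.+1))))%N /\
    (j.+1 * a j = j.+1 * (m - r) * ('C(m, j) * (r ^ j * (m - r) ^ (m - j.+1))))%N.
  move=> jm; split.
    by rewrite /a mulnA mul_bin_left expnS; ring.
  by rewrite /a -(subnSK jm) expnS; ring.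
have [kr|/ltnW rk] := leqP k r.
  move: (r - k)%N (subnK kr) => j kj.
  elim: j k kr km kj => [|j IH] k kr km kj; first by rewrite -kj add0n.
  have kr' : (k < r)%N by rewrite -kj addSn ltnS leq_addl.
  have km' : (k < m)%N by exact: leq_trans rm.
  apply: leq_trans (IH k.+1 kr' km' _); last by rewrite addnS -addSn.
  have [e1 e2] := stepE _ km'; rewrite -(leq_pmul2l (ltn0Sn k)) e1 e2 leq_mul2r.
  apply/orP; right; rewrite mulnC leq_mul//; exact: leq_sub2l.
move: (k - r)%N (subnK rk) => j kj.
elim: j k rk km kj => [|j IH] k rk km kj; first by rewrite -kj add0n.
case: k rk km kj => [//|k] rk km; rewrite addSn => -[kj].
have rk' : (r <= k)%N by rewrite -kj leq_addl.
apply: leq_trans (IH k rk' (ltnW km) kj).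
have [e1 e2] := stepE _ km; rewrite -(leq_pmul2l (ltn0Sn k)) e1 e2 leq_mul2r.
apply/orP; right; rewrite [leqRHS]mulnC leq_mul//; exact: leq_sub2l.
Qed.

(** A Bernoulli set conditioned to have [r] elements is uniform, and [r], the most likely of the m +
    1 sizes, has probability at least 1/(m + 1). *)
Lemma avg_le_bern r B : (0 < m)%N -> (r <= m)%N -> (forall X, 0 <= B X) ->
  avg r B <= m.+1%:R * bern (r%:R / m%:R) B.
Proof.
move=> m0 rm B0; set y : R := r%:R / m%:R.
have mR : m%:R != 0 :> R by rewrite pnatr_eq0 -lt0n.
have y0 : 0 <= y by rewrite mulr_ge0 ?invr_ge0.
have y1E : 1 - y = (m - r)%:R / m%:R by rewrite natrB// mulrBl divff.
have y1 : 0 <= 1 - y by rewrite y1E mulr_ge0 ?invr_ge0.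
pose b k : R := y ^+ k * (1 - y) ^+ (m - k).
have bE k : (k <= m)%N -> 'C(m, k)%:R * b k =
    ('C(m, k) * (r ^ k * (m - r) ^ (m - k)))%:R / m%:R ^+ m.
  move=> km; rewrite /b y1E !expr_div_n !natrM !natrX.
  have -> : m%:R ^+ m = m%:R ^+ k * m%:R ^+ (m - k) :> R by rewrite -exprD subnKC.
  by rewrite invfM; ring.
have b1 : 1 <= m.+1%:R * ('C(m, r)%:R * b r).
  have e1 : 1 = ((1 - y) + y) ^+ m by rewrite subrK expr1n.
  rewrite [leLHS]e1 exprDn -[m.+1 in leRHS]card_ord mulr_natl -sumr_const.
  apply: ler_sum => k _; have km : (k <= m)%N by rewrite -ltnS.
  rewrite -mulr_natl [X in _ * X]mulrC -/(b k) !bE// ler_wpM2r ?invr_ge0 ?exprn_ge0//.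
  by rewrite ler_nat binomial_mode.
have C0 : 0 < 'C(m, r)%:R :> R by rewrite ltr0n bin_gt0.
rewrite /avg ler_pdivrMl//.
apply: (@le_trans _ _ (m.+1%:R * ('C(m, r)%:R * b r) * \sum_(X : {set H} | #|X| == r) B X)).
  by rewrite ler_peMl// sumr_ge0.
rewrite -!mulrA mulrCA ler_wpM2l// ler_wpM2l//.
rewrite mulr_sumr /bern [leRHS](bigID (fun X : {set H} => #|X| == r)) /=.
rewrite -[leLHS]addr0 lerD//.
  by rewrite mulr_sumr; apply: ler_sum => X /eqP ->; rewrite mulrA.
by apply: sumr_ge0 => X _; rewrite !mulr_ge0 ?exprn_ge0.
Qed.

Context {U : finType}.
Variable tg : H -> U.

Definition intact X u := [forall h, (tg h == u) ==> (h \in X)].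

Definition multiplicity u : nat := #|[set h | tg h == u]%SET|.

(** Each half-edge belongs to one vertex, so the events [intact] are independent. Expanding over the
    set [J] of vertices that contribute [al] leaves a product over half-edges, with factor y + (1 -
    y) = 1 if the vertex is in [J] and y otherwise. *)
Lemma bern_prod y (al ga : U -> R) :
  bern y (fun X => \prod_u (al u + ga u * (intact X u)%:R))
  = \prod_u (al u + ga u * y ^+ multiplicity u).
Proof.
rewrite bernE prodrD_subsets.
under eq_bigr do rewrite prodrD_subsets big_distrr /=.
rewrite exchange_big /=; apply: eq_bigr => J _.
transitivity ((\prod_u (if u \in J then al u else ga u)) *
  \sum_(X : {set H}) \prod_h (if h \in X then y else (1 - y) * (tg h \in J)%:R)).
  rewrite mulr_sumr; apply: eq_bigr => X _.
  have -> : \prod_u (if u \in J then al u else ga u * (intact X u)%:R) =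
      (\prod_u (if u \in J then al u else ga u)) *
      \prod_h (if h \in X then 1 else (tg h \in J)%:R).
    have -> : \prod_h (if h \in X then 1 else (tg h \in J)%:R) =
        \prod_u (if u \in J then 1 else (intact X u)%:R) :> R.
      rewrite (partition_big tg xpredT) //=; apply: eq_bigr => u _.
      case uJ: (u \in J).
        by rewrite big1// => h /eqP ->; rewrite uJ if_same.
      case: (boolP (intact X u)) => [/forallP hX|].
        by rewrite big1// => h hu; have := hX h; rewrite hu /= => ->.
      case/forallPn => h; rewrite negb_imply => /andP[hu /negbTE hX].
      by rewrite (bigD1 h)//= hX (eqP hu) uJ mul0r.
    rewrite -big_split; apply: eq_bigr => u _ /=.
    by case: ifP => _; rewrite ?mulr1.
  rewrite mulrCA; congr (_ * _); rewrite -big_split; apply: eq_bigr => h _ /=.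
  by case: ifP => _; rewrite ?mulr1.
rewrite -(prodrD_subsets (fun=> y) (fun h => (1 - y) * (tg h \in J)%:R)).
rewrite (partition_big tg xpredT) //= -big_split; apply: eq_bigr => u _ /=.
under eq_bigr => h /eqP -> do [].
rewrite (eq_bigl [in [set h | tg h == u]%SET]); last by move=> h; rewrite inE.
rewrite prodr_const; case: ifP => _; last by rewrite mulr0 addr0.
by rewrite mulr1 addrC subrK expr1n mulr1.
Qed.

End bernoulli.

Section bernoulli_tail.
Context {R : realType} {H U : finType}.
Variable tg : H -> U.

Lemma bern_tail (y : R) (a : U -> R) (A th t : R) : 0 <= y <= 1 ->
  (forall u, 0 <= a u <= A) -> 0 <= th -> th * A <= 2^-1 ->
  bern y (fun X => (t < `|\sum_u a u * (intact tg X u)%:R -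
                         \sum_u a u * y ^+ multiplicity tg u|)%R%:R)
  <= 2 * expR (#|U|%:R * (2 * (th * A) ^+ 2) - th * t).
Proof.
move=> y01 aA th0 thA; have /andP[y0 y1] := y01.
pose q u := y ^+ multiplicity tg u.
have q0 u : 0 <= q u by rewrite exprn_ge0.
have q1 u : q u <= 1 by rewrite exprn_ile1.
have main (s : R) : `|s| = th ->
    bern y (fun X => expR (s * (\sum_u a u * (intact tg X u)%:R - \sum_u a u * q u) - th * t))
    <= expR (#|U|%:R * (2 * (th * A) ^+ 2) - th * t).
  (* As a function of a bit b, exp(s a (b - q)) is affine: [al] is its value at 0 and [ga] its
     increment, so [bern_prod] applies. *)
  move=> sth; pose al u := expR (- (s * a u * q u)).
  pose ga u := al u * (expR (s * a u) - 1).
  have -> : (fun X => expR (s * (\sum_u a u * (intact tg X u)%:R - \sum_u a u * q u) - th * t))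
     = (fun X => expR (- (th * t)) * \prod_u (al u + ga u * (intact tg X u)%:R)).
    apply/funext => X; rewrite expRD mulrC; congr (_ * _).
    rewrite -sumrB mulr_sumr expR_sum; apply: eq_bigr => u _.
    rewrite /ga /al; case: (intact tg X u).
      rewrite !mulr1 [RHS](_ : _ = expR (- (s * a u * q u)) * expR (s * a u)); last by ring.
      by rewrite -expRD; congr expR; ring.
    by rewrite !mulr0 addr0 sub0r mulrN mulrA.
  rewrite /bern; under eq_bigr do rewrite mulrCA.
  rewrite -mulr_sumr -/(bern y _) bern_prod expRD mulrC ler_wpM2r ?expR_ge0//.
  rewrite expRM_natl -prodr_const; apply: ler_prod => u _.
  have e : al u + ga u * q u = al u * (1 + (expR (s * a u) - 1) * q u) by rewrite /ga; ring.
  rewrite -/(q u) e; have /andP[a0 aA'] := aA u.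
  have sa : `|s * a u| <= th * A by rewrite normrM sth ger0_norm// ler_wpM2l.
  have sa2 : s * a u <= 2^-1 by exact: le_trans (ler_norm _) (le_trans sa thA).
  have B0 : 0 <= 1 + (expR (s * a u) - 1) * q u.
    have -> : 1 + (expR (s * a u) - 1) * q u = (1 - q u) + expR (s * a u) * q u by ring.
    by rewrite addr_ge0 ?subr_ge0// mulr_ge0 ?expR_ge0.
  rewrite mulr_ge0 ?expR_ge0//=.
  rewrite /al expRN mulrC ler_pdivrMr ?expR_gt0// -expRD.
  apply: le_trans (expR_ge1Dx _); rewrite lerD2l.
  have := expR_le_quadratic sa2; rewrite -[(s * a u) ^+ 2]real_normK ?num_real// => ex.
  have : `|s * a u| ^+ 2 <= (th * A) ^+ 2.
    by rewrite lerXn2r ?nnegrE//; apply: le_trans sa.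
  by have := q0 u; have := q1 u; nra.
rewrite [leRHS]mulrDl mul1r.
have n1 := main th (ger0_norm th0).
have n2 := main (- th) (etrans (normrN _) (ger0_norm th0)).
apply: le_trans (lerD n1 n2); rewrite /bern -big_split /=; apply: ler_sum => X _.
rewrite -mulrDr ler_wpM2l ?le_indic_expR//.
by rewrite mulr_ge0 ?exprn_ge0 ?subr_ge0.
Qed.

End bernoulli_tail.

(** * Means and generating functions of sub-Gaussian laws *)

Section law_means.
Context {R : realType}.
Implicit Type law : probability nat R.

Definition mean_of law (f : nat -> R) : R :=
  limn (series (fun k => prob_at law k * f k)).

(** Bounds the mean of (k+1)^16. With z = (k/K)^2, (k+1)^2 <= (2 + 18 K^2)(1 + z/9) and (1 + z/9)^9
    <= exp(z), so (k+1)^18 <= (2 + 18 K^2)^9 exp(z). The factor 4 is the 2 of the tail bound times a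
    bound 2 for the sum of the (k+1)^-2. *)
Definition mom (K : R) : R := 4 * (2 + 18 * K ^+ 2) ^+ 9.

(** The sixteenth power is chosen so that truncating a function of quadratic growth at L costs
    L^-14. *)
Definition tame (A : R) (f : nat -> R) := forall k, `|f k| <= A * k.+1%:R ^+ 16.

Lemma mom_ge0 K : 0 <= mom K.
Proof. by rewrite mulr_ge0// exprn_ge0// addr_ge0// mulr_ge0// sqr_ge0. Qed.

Lemma prob_at_tail law K k : sub_gaussian_with law K ->
  prob_at law k <= 2 * expR (- (k%:R / K) ^+ 2).
Proof.
move=> sg; rewrite -lee_fin /prob_at fineK ?fin_num_measure//.
apply: le_trans (sg k%:R (ler0n _ _)); apply: le_measure; rewrite ?inE//.
by move=> _ ->; exact: lexx.
Qed.

Lemma prob_at_poly law K k : 0 < K -> sub_gaussian_with law K ->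
  prob_at law k * k.+1%:R ^+ 16 <= mom K / 2 / k.+1%:R ^+ 2.
Proof.
move=> K0 /prob_at_tail pk; rewrite ler_pdivlMr ?exprn_gt0// -mulrA -exprD.
apply: le_trans (ler_wpM2r _ (pk k)) _; first by rewrite exprn_ge0.
set z := (k%:R / K) ^+ 2.
have z0 : 0 <= z by rewrite sqr_ge0.
have kz : k%:R ^+ 2 = K ^+ 2 * z.
  by rewrite /z expr_div_n mulrCA divff ?mulr1// expf_neq0// gt_eqF.
have h : k.+1%:R ^+ 2 <= (2 + 18 * K ^+ 2) * (1 + z / 9).
  have := sqr_ge0 (k%:R - 1 : R); have := sqr_ge0 K.
  by rewrite -natr1 => ? ?; nra.
have e5 : (1 + z / 9) ^+ 9 <= expR z.
  rewrite -[z in leRHS](@divfK _ 9)// expRM_natr lerXn2r ?nnegrE ?expR_ge0//.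
    by rewrite addr_ge0 ?divr_ge0.
  exact: expR_ge1Dx.
rewrite expRN mulrAC ler_pdivrMr ?expR_gt0//.
have -> : (16 + 2 = 2 * 9)%N by [].
have -> : mom K / 2 = 2 * (2 + 18 * K ^+ 2) ^+ 9 by rewrite /mom; field.
rewrite -mulrA ler_pM2l// exprM.
have c0 : 0 <= 2 + 18 * K ^+ 2 by rewrite addr_ge0// mulr_ge0// sqr_ge0.
apply: (@le_trans _ _ (((2 + 18 * K ^+ 2) * (1 + z / 9)) ^+ 9)).
  by rewrite lerXn2r ?nnegrE ?exprn_ge0// mulr_ge0// addr_ge0// divr_ge0.
by rewrite exprMn ler_wpM2l// exprn_ge0.
Qed.

Lemma sum_inv_sq n : \sum_(0 <= k < n) (k.+1%:R ^+ 2)^-1 <= 2 - n%:R^-1 :> R.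
Proof.
elim: n => [|n IH]; first by rewrite big_nil invr0 subr0.
rewrite big_nat_recr//=; case: n IH => [_|n IH].
  by rewrite big_nil add0r expr1n invr1; lra.
apply: le_trans (lerD IH (lexx _)) _; rewrite -lerBrDl.
have -> : n.+2%:R = n.+1%:R + 1 :> R by rewrite -natr1.
have -> : 2 - (n.+1%:R + 1)^-1 - (2 - n.+1%:R^-1) = (n.+1%:R * (n.+1%:R + 1))^-1 :> R.
  by field; rewrite !gt_eqF// addr_gt0.
by rewrite lef_pV2 ?posrE ?exprn_gt0 ?mulr_gt0 ?addr_gt0// expr2 ler_wpM2r ?lerDl//.
Qed.

Context {law : probability nat R} {K : R}.
Hypotheses (K0 : 0 < K) (sg : sub_gaussian_with law K).
Local Notation p := (prob_at law).
Local Notation M := (mom K).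

Lemma sum_moment n : \sum_(0 <= k < n) p k * k.+1%:R ^+ 16 <= M.
Proof.
apply: (@le_trans _ _ (\sum_(0 <= k < n) M / 2 / k.+1%:R ^+ 2)).
  by apply: ler_sum => k _; exact: prob_at_poly.
rewrite -mulr_sumr -[leRHS](divfK (_ : 2 != 0))// ler_wpM2l ?divr_ge0 ?mom_ge0//.
by apply: le_trans (sum_inv_sq n) _; rewrite gerBl.
Qed.

Lemma tame_norm_cvg A f : tame A f -> cvgn [normed series (fun k => p k * f k)].
Proof.
move=> fA; have A0 : 0 <= A.
  by have := le_trans (normr_ge0 _) (fA 0%N); rewrite pmulr_lge0// exprn_gt0.
apply: nondecreasing_is_cvgn; first by apply: nondecreasing_series => k _ _; rewrite normr_ge0.
exists (A * M) => _ [n _ <-]; rewrite /series /=.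
apply: (@le_trans _ _ (\sum_(0 <= k < n) A * (p k * k.+1%:R ^+ 16))).
  apply: ler_sum => k _; rewrite normrM ger0_norm ?prob_at_ge0// mulrCA.
  by rewrite ler_wpM2l ?prob_at_ge0//; exact: fA.
by rewrite -mulr_sumr ler_wpM2l// sum_moment.
Qed.

Lemma tame_cvg A f : tame A f -> cvgn (series (fun k => p k * f k)).
Proof. by move=> /tame_norm_cvg; exact: normed_cvg. Qed.

Lemma mean_ofD A B f g : tame A f -> tame B g ->
  mean_of law (fun k => f k + g k) = mean_of law f + mean_of law g.
Proof.
move=> /tame_cvg cf /tame_cvg cg; rewrite /mean_of -lim_seriesD//.
by congr (limn (series _)); apply/funext => k; rewrite mulrDr.
Qed.

Lemma mean_ofZ A c f : tame A f -> mean_of law (fun k => c * f k) = c * mean_of law f.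
Proof.
move=> /tame_cvg cf; rewrite /mean_of.
rewrite -[RHS](@lim_seriesZ _ (fun k => p k * f k) c)//.
by congr (limn (series _)); apply/funext => k; rewrite mulrCA.
Qed.

Lemma mean_ofB A B f g : tame A f -> tame B g ->
  mean_of law (fun k => f k - g k) = mean_of law f - mean_of law g.
Proof.
move=> /tame_cvg cf /tame_cvg cg; rewrite /mean_of -lim_seriesB//.
by congr (limn (series _)); apply/funext => k; rewrite mulrBr.
Qed.

Lemma le_mean_of A B f g : tame A f -> tame B g -> (forall k, f k <= g k) ->
  mean_of law f <= mean_of law g.
Proof.
move=> /tame_cvg cf /tame_cvg cg fg; apply: lim_series_le => // k.
by rewrite ler_wpM2l ?prob_at_ge0.
Qed.

Lemma mean_of_dist A B C f g h : tame A f -> tame B g -> tame C h ->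
  (forall k, `|f k - g k| <= h k) -> `|mean_of law f - mean_of law g| <= mean_of law h.
Proof.
move=> tf tg th fgh; have tNh : tame C (fun k => -1 * h k).
  by move=> k; rewrite mulN1r normrN; exact: th.
have tfg : tame (A + B) (fun k => f k - g k).
  by move=> k; rewrite mulrDl; apply: le_trans (ler_normB _ _) _; exact: lerD (tf k) (tg k).
rewrite -(mean_ofB tf tg) ler_norml -mulN1r -(mean_ofZ _ th); apply/andP; split.
  by apply: (le_mean_of tNh tfg) => k; have := fgh k; rewrite ler_norml mulN1r => /andP[].
by apply: (le_mean_of tfg th) => k; have := fgh k; rewrite ler_norml => /andP[].
Qed.

Lemma mean_of_norm A f : tame A f -> `|mean_of law f| <= A * M.
Proof.
move=> fA; have A0 : 0 <= A.
  by have := le_trans (normr_ge0 _) (fA 0%N); rewrite pmulr_lge0// exprn_gt0.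
apply: le_trans (lim_series_norm (tame_norm_cvg fA)) _.
apply: limr_le; first exact: tame_norm_cvg fA.
apply: nearW => n; rewrite /series /=.
apply: (@le_trans _ _ (\sum_(0 <= k < n) A * (p k * k.+1%:R ^+ 16))).
  apply: ler_sum => k _; rewrite normrM ger0_norm ?prob_at_ge0// mulrCA.
  by rewrite ler_wpM2l ?prob_at_ge0//; exact: fA.
by rewrite -mulr_sumr ler_wpM2l// sum_moment.
Qed.

Lemma mean_of_fin n f :
  mean_of law (fun k => if (k < n)%N then f k else 0) = \sum_(k < n) p k * f k.
Proof.
apply: cvg_lim => //; rewrite -(cvg_shiftn n) /=.
rewrite [X in X @ _ --> _](_ : _ = fun=> \sum_(k < n) p k * f k); first exact: cvg_cst.
apply/funext => j; rewrite /series /= addnC (big_cat_nat _ (n := n)) ?leq_addr//=.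
rewrite [X in _ + X]big_nat [X in _ + X]big1 ?addr0; last first.
  by move=> k /andP[nk _]; rewrite ltnNge nk mulr0.
by rewrite big_mkord; apply: eq_bigr => k _; rewrite ltn_ord.
Qed.

Lemma mean_of_tail n A f : (forall k, `|f k| <= A * k.+1%:R ^+ 2) ->
  `|mean_of law f - \sum_(k < n) p k * f k| <= A * M / n.+1%:R ^+ 14.
Proof.
move=> fA; have A0 : 0 <= A.
  by have := le_trans (normr_ge0 _) (fA 0%N); rewrite pmulr_lge0// exprn_gt0.
have tf : tame A f.
  move=> k; apply: le_trans (fA k) _; rewrite ler_wpM2l// ler_weXn2l//.
  by rewrite ler1n.
have tf1 : tame A (fun k => if (k < n)%N then f k else 0).
  by move=> k; case: ifP => _; rewrite ?tf// normr0 mulr_ge0// exprn_ge0.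
rewrite -mean_of_fin -(mean_ofB tf tf1) mulrAC.
apply: mean_of_norm => k; case: ltnP => kn.
  by rewrite subrr normr0 !mulr_ge0 ?invr_ge0 ?exprn_ge0// ltW.
rewrite subr0; apply: le_trans (fA k) _.
rewrite -mulrA ler_wpM2l// ler_pdivlMl// (_ : 16 = 14 + 2)%N// exprD.
by rewrite ler_wpM2r ?exprn_ge0// lerXn2r ?nnegrE// ler_nat.
Qed.

End law_means.

Section generating_functions.
Context {R : realType}.
Context {law : probability nat R} {K : R}.
Hypotheses (K0 : 0 < K) (sg : sub_gaussian_with law K).
Local Notation p := (prob_at law).
Local Notation M := (mom K).
Implicit Types x y z : R.

(** Infinite radius of convergence, in a form that passes to formal derivatives. *)
Definition entire (c : nat -> R) :=
  forall z, 0 <= z -> exists C, forall k, `|c k| * z ^+ k <= C.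

Lemma entire_prob_at : entire p.
Proof.
move=> z z0; pose b := K * z; exists (2 * expR (z ^+ 2 * K ^+ 2)) => k.
rewrite ger0_norm ?prob_at_ge0//.
apply: (@le_trans _ _ (2 * expR (- (k%:R / K) ^+ 2) * z ^+ k)).
  by rewrite ler_wpM2r ?exprn_ge0// prob_at_tail.
rewrite -mulrA ler_pM2l// expRN mulrC ler_pdivrMr ?expR_gt0// -expRD.
(* z <= exp(2z), and 2zk <= (k/K)^2 + (zK)^2. *)
apply: (@le_trans _ _ (expR (2 * z) ^+ k)).
  rewrite lerXn2r ?nnegrE ?expR_ge0//.
  by have := expR_ge1Dx (2 * z); lra.
rewrite -expRM_natr ler_expR.
have kE : k%:R = K * (k%:R / K) by rewrite mulrCA divff ?mulr1// gt_eqF.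
rewrite [in X in X <= _]kE; set u := k%:R / K.
by have := sqr_ge0 (u - K * z); nra.
Qed.

Lemma entire_diffs c : entire c -> entire (pseries_diffs c).
Proof.
move=> ec z z0; have z1 : 0 <= 2 * (z + 1) by rewrite mulr_ge0// addr_ge0.
have [C cC] := ec _ z1; exists C => k; apply: le_trans (cC k.+1).
rewrite /pseries_diffs normrM normr_nat mulrAC mulrC ler_wpM2l// exprMn.
apply: ler_pM => //; first by rewrite exprn_ge0.
  by rewrite -natrX ler_nat ltnW// ltn_expl.
apply: (@le_trans _ _ ((z + 1) ^+ k)).
  by rewrite lerXn2r ?nnegrE ?addr_ge0// lerDl.
by rewrite ler_weXn2l// lerDr.
Qed.

Lemma entire_cvg c z : entire c -> cvgn (pseries c z).
Proof.
move=> ec; have z2 : 0 <= 2 * `|z| by rewrite mulr_ge0.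
have [C cC] := ec _ z2.
have C0 : 0 <= C by apply: le_trans (cC 0%N); rewrite mulr_ge0.
apply: normed_cvg; apply: (@series_le_cvg _ _ (geometric C 2^-1)) => [k|k|k|].
- exact: normr_ge0.
- by rewrite /geometric /= mulr_ge0 ?exprn_ge0 ?invr_ge0.
- rewrite /geometric /= normrM normrX exprVn ler_pdivlMr ?exprn_gt0//.
  by rewrite -mulrA -exprMn [_ * 2]mulrC.
- by apply: is_cvg_geometric_series; rewrite ger0_norm ?invr_ge0// invf_lt1// ltr1n.
Qed.

Lemma entire_is_derive c z : entire c ->
  is_derive z 1 (fun x => limn (pseries c x)) (limn (pseries (pseries_diffs c) z)).
Proof.
move=> ec; apply: (@pseries_snd_diffs _ _ (`|z| + 1)).
- exact: entire_cvg.
- by apply: entire_cvg; exact: entire_diffs.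
- by apply: entire_cvg; do 2 apply: entire_diffs.
- by rewrite [ltRHS]ger0_norm ?addr_ge0// ltrDl.
Qed.

Definition dgen_fun (y : R) : R := mean_of law (fun k => k%:R * y ^+ k.-1).

Lemma dgen_funE : dgen_fun = fun y => limn (pseries (pseries_diffs p) y).
Proof.
apply/funext => y; apply: cvg_lim => //.
have -> : (fun k => p k * (k%:R * y ^+ k.-1)) = (fun k => k%:R * p k * y ^+ k.-1).
  by apply/funext => k; rewrite mulrA [_ * p k]mulrC.
by apply: pseries_diffs_equiv; apply: entire_cvg; exact: entire_diffs entire_prob_at.
Qed.

Lemma is_derive_gen_fun y : is_derive y 1 (gen_fun law) (dgen_fun y).
Proof. by rewrite dgen_funE; exact: entire_is_derive entire_prob_at. Qed.

Lemma derive1_gen_fun : derive1 (gen_fun law) = dgen_fun.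
Proof.
by apply/funext => y; rewrite derive1E; have [_ ->] := is_derive_gen_fun y.
Qed.

Lemma continuous_gen_fun : continuous (gen_fun law).
Proof.
move=> y; have [d _] := is_derive_gen_fun y.
by apply: differentiable_continuous; exact/derivable1_diffP.
Qed.

Lemma continuous_dgen_fun : continuous dgen_fun.
Proof.
move=> y; rewrite dgen_funE; have [d _] := @entire_is_derive _ y (entire_diffs entire_prob_at).
by apply: differentiable_continuous; exact/derivable1_diffP.
Qed.

End generating_functions.

Section moments.
Context {R : realType}.
Implicit Type law : probability nat R.

Lemma limn_EFin_series (u : nat -> R) (l : R) :
  (forall k, 0 <= u k) -> (\sum_(k <oo) (u k)%:E = l%:E)%E -> limn (series u) = l.
Proof.
move=> u0 ul; apply: cvg_lim => //.
have : (fun n => (\sum_(0 <= k < n) (u k)%:E)%E) @ \oo --> l%:E.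
  by rewrite -ul; apply: is_cvg_nneseries => k _ _; rewrite lee_fin.
have -> : series u = fine \o (fun n => (\sum_(0 <= k < n) (u k)%:E)%E).
  by apply/funext => n /=; rewrite sumEFin.
exact: fine_cvg.
Qed.

Lemma mean_of1 law : mean_of law (fun=> 1) = 1.
Proof.
have h := sum_prob_at law; rewrite -nneseries_esumT in h; last first.
  by move=> k; rewrite lee_fin prob_at_ge0.
apply: limn_EFin_series => [k|]; first by rewrite mulr1 prob_at_ge0.
by rewrite -[RHS]h; apply: eq_eseriesr => k _; rewrite mulr1.
Qed.

Lemma mean_of_expectation law (f : nat -> R) (m : R) : (forall k, 0 <= f k) ->
  ('E_law[f] = m%:E)%E -> mean_of law f = m.
Proof.
move=> f0; rewrite unlock => fm; apply: limn_EFin_series => [k|].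
  by rewrite mulr_ge0 ?prob_at_ge0.
rewrite -fm (_ : [set: nat] = \bigcup_k [set k]); last first.
  by apply/seteqP; split=> // k _; exists k.
rewrite ge0_integral_bigcup//=.
- apply: eq_eseriesr => k _; rewrite EFinM /prob_at fineK ?fin_num_measure//.
  rewrite (@eq_integral _ _ _ _ [set k] (cst (f k)%:E)) ?integral_cst//.
    by rewrite muleC.
  by move=> j /set_mem ->.
- by move=> k _; rewrite lee_fin.
- by move=> i j _ _ [x [-> ->]].
Qed.

Context {law : probability nat R} {K mu : R}.
Hypotheses (K0 : 0 < K) (sg : sub_gaussian_with law K) (mE : has_mean law mu).
Local Notation p := (prob_at law).
Local Notation M := (mom K).
Local Notation phi := (gen_fun law).
Local Notation dphi := (@dgen_fun R law).
Implicit Types x y z : R.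

Lemma mean_of_id : mean_of law (fun k => k%:R) = mu.
Proof. by apply: mean_of_expectation mE. Qed.

Lemma tame_const (c : R) : tame `|c| (fun=> c).
Proof. by move=> k; rewrite ler_peMr// exprn_ege1// ler1n. Qed.

Lemma tame_le_sq (A : R) f : (forall k, `|f k| <= A * k%:R ^+ 2) -> tame A f.
Proof.
move=> fA k; have A0 : 0 <= A.
  by have := le_trans (normr_ge0 _) (fA 1%N); rewrite expr1n mulr1.
apply: le_trans (fA k) _; rewrite ler_wpM2l//.
apply: (@le_trans _ _ (k.+1%:R ^+ 2)); first by rewrite lerXn2r ?nnegrE// ler_nat.
by rewrite ler_weXn2l// ler1n.
Qed.

Lemma tame_le_id (A : R) f : (forall k, `|f k| <= A * k%:R) -> tame A f.
Proof.
move=> fA; have A0 : 0 <= A.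
  by have := le_trans (normr_ge0 _) (fA 1%N); rewrite mulr1.
apply: tame_le_sq => k; apply: le_trans (fA k) _; rewrite ler_wpM2l//.
by rewrite -natrX ler_nat; case: k => // k; rewrite leq_pmull.
Qed.

Lemma tame_id : tame (1 : R) (fun k => k%:R).
Proof. by apply: tame_le_id => k; rewrite mul1r normr_nat. Qed.

Lemma tame_pow y : 0 <= y <= 1 -> tame 1 (fun k => y ^+ k).
Proof.
move=> /andP[y0 y1] k; rewrite ger0_norm ?exprn_ge0// mul1r.
by apply: (@le_trans _ _ 1); [rewrite exprn_ile1|rewrite exprn_ege1// ler1n].
Qed.

Lemma tame_dpow y : 0 <= y <= 1 -> tame 1 (fun k => k%:R * y ^+ k.-1).
Proof.
move=> /andP[y0 y1]; apply: tame_le_id => k.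
by rewrite mul1r ger0_norm ?mulr_ge0 ?exprn_ge0// ler_piMr// exprn_ile1.
Qed.

Lemma lipschitz_pow k y z : 0 <= y <= 1 -> 0 <= z <= 1 ->
  `|y ^+ k - z ^+ k| <= k%:R * `|y - z|.
Proof.
move=> /andP[y0 y1] /andP[z0 z1]; rewrite subrXX normrM mulrC ler_wpM2r//.
apply: le_trans (ler_norm_sum _ _ _) _.
rewrite -[k in leRHS]card_ord -sumr_const; apply: ler_sum => i _.
by rewrite ger0_norm ?mulr_ge0 ?exprn_ge0// mulr_ile1 ?exprn_ge0// exprn_ile1.
Qed.

Lemma gen_fun_lipschitz y z : 0 <= y <= 1 -> 0 <= z <= 1 ->
  `|phi y - phi z| <= mu * `|y - z|.
Proof.
move=> y01 z01; rewrite -mean_of_id mulrC -(mean_ofZ K0 sg _ tame_id).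
have tB : tame `|y - z| (fun k => y ^+ k - z ^+ k).
  by apply: tame_le_id => k; rewrite mulrC lipschitz_pow.
have tZ : tame `|y - z| (fun k => `|y - z| * k%:R).
  by apply: tame_le_id => k; rewrite ger0_norm ?mulr_ge0.
by apply: (mean_of_dist K0 sg (tame_pow y01) (tame_pow z01) tZ) => k; rewrite mulrC lipschitz_pow.
Qed.

Lemma dgen_fun_lipschitz y z : 0 <= y <= 1 -> 0 <= z <= 1 ->
  `|dphi y - dphi z| <= M * `|y - z|.
Proof.
move=> y01 z01.
have t2 : tame (1 : R) (fun k => k%:R ^+ 2) by apply: tame_le_sq => k; rewrite ger0_norm ?mul1r// exprn_ge0.
have tZ : tame `|y - z| (fun k => `|y - z| * k%:R ^+ 2).
  by apply: tame_le_sq => k; rewrite ger0_norm ?mulr_ge0 ?exprn_ge0.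
apply: (@le_trans _ _ (mean_of law (fun k => `|y - z| * k%:R ^+ 2))).
  apply: (mean_of_dist K0 sg (tame_dpow y01) (tame_dpow z01) tZ) => k.
  rewrite -mulrBr normrM normr_nat mulrC expr2 mulrA ler_wpM2r//.
  apply: le_trans (lipschitz_pow _ y01 z01) _; rewrite mulrC ler_wpM2l// ler_nat.
  exact: leq_pred.
rewrite (mean_ofZ K0 sg _ t2) mulrC ler_wpM2r//.
by apply: le_trans (ler_norm _) _; rewrite -[leRHS]mul1r; apply: (mean_of_norm K0 sg t2).
Qed.

Lemma dgen_fun_ge0 y : 0 <= y <= 1 -> 0 <= dphi y.
Proof.
move=> y01; have /andP[y0 y1] := y01.
have t0 : tame 0 (fun=> 0 : R) by move=> k; rewrite normr0 mul0r.
have <- : mean_of law (fun=> 0) = 0.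
  by apply/eqP; rewrite -normr_le0 -[leRHS](mul0r M); exact: (mean_of_norm K0 sg t0).
by apply: (le_mean_of K0 sg t0 (tame_dpow y01)) => k; rewrite mulr_ge0 ?exprn_ge0.
Qed.

Lemma dgen_fun_le y : 0 <= y <= 1 -> dphi y <= mu.
Proof.
move=> y01; have /andP[y0 y1] := y01; rewrite -mean_of_id.
by apply: (le_mean_of K0 sg (tame_dpow y01) tame_id) => k; rewrite ler_piMr// exprn_ile1.
Qed.

Lemma dgen_fun1 : dphi 1 = mu.
Proof.
rewrite -mean_of_id; congr (mean_of law _).
by apply/funext => k; rewrite expr1n mulr1.
Qed.

(** A positive mean gives some k >= 1 of positive weight, whose term k y^(k-1) is already positive.
    At y = 0 only k = 1 contributes, hence the strict lower bound on [y]. *)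
Lemma dgen_fun_gt0 y : 0 < mu -> 0 < y <= 1 -> 0 < dphi y.
Proof.
move=> mu0 /andP[y0 y1]; have y01 : 0 <= y <= 1 by rewrite ltW.
have [k pk] : exists k, 0 < p k * k%:R.
  apply: contrapT => h; move: mu0; rewrite -mean_of_id.
  suff -> : mean_of law (fun k => k%:R) = 0 by rewrite ltxx.
  rewrite /mean_of (_ : (fun k => _) = fun=> 0); last first.
    apply/funext => k; apply/eqP; rewrite eq_le mulr_ge0 ?prob_at_ge0// andbT.
    by rewrite leNgt; apply/negP => pk; apply: h; exists k.
  apply: cvg_lim => //; rewrite (_ : series _ = fun=> 0); first exact: cvg_cst.
  by apply/funext => n; rewrite /series /= big1.
pose f j : R := if (j < k.+1)%N then j%:R * y ^+ j.-1 else 0.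
have f0 j : 0 <= f j by rewrite /f; case: ifP => // _; rewrite mulr_ge0 ?exprn_ge0// ltW.
have fle j : f j <= j%:R * y ^+ j.-1.
  by rewrite /f; case: ifP => // _; rewrite mulr_ge0 ?exprn_ge0// ltW.
have tf : tame 1 f.
  move=> j; apply: le_trans (tame_dpow y01 j).
  by rewrite !ger0_norm//; apply: le_trans (fle j).
apply: lt_le_trans (le_mean_of K0 sg tf (tame_dpow y01) fle).
rewrite mean_of_fin big_ord_recr /= ltr_wpDl//.
  by apply: sumr_ge0 => j _; rewrite !mulr_ge0 ?prob_at_ge0 ?exprn_ge0// ltW.
by rewrite mulrA mulr_gt0 ?exprn_gt0.
Qed.

(** By [mean_readsE] this is (1 - phi(1 - x)) / x, extended by the mean at x = 0: the quotient in
    the ODE freed of its indeterminacy. *)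
Definition mean_reads (x : R) : R := mean_of law (fun d => mean_read d x).

Lemma tame_read x : 0 <= x <= 1 -> tame 1 (fun d => mean_read d x).
Proof.
move=> x01; apply: tame_le_id => k.
by rewrite mul1r ger0_norm ?mean_read_le ?mean_read_ge0.
Qed.

Lemma mean_readE d x : x * mean_read d x = 1 - (1 - x) ^+ d.
Proof.
elim: d => [|d IH]; first by rewrite /mean_read big_ord0 mulr0 subrr.
rewrite mean_readS mulrDr mulrCA IH exprS; ring.
Qed.

Lemma mean_readsE x : 0 <= x <= 1 -> x * mean_reads x = 1 - phi (1 - x).
Proof.
move=> x01; have /andP[x0 x1] := x01.
have y01 : 0 <= 1 - x <= 1 by rewrite subr_ge0 x1 gerBl.
rewrite -(mean_ofZ K0 sg _ (tame_read x01)).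
transitivity (mean_of law (fun=> 1) - mean_of law (fun k => (1 - x) ^+ k)); last first.
  by rewrite mean_of1.
rewrite -(mean_ofB K0 sg (tame_const 1) (tame_pow y01)); congr (mean_of law _).
by apply/funext => d; rewrite mean_readE.
Qed.

Lemma mean_read_lipschitz d x y : 0 <= x <= 1 -> 0 <= y <= 1 ->
  `|mean_read d x - mean_read d y| <= d%:R ^+ 2 * `|x - y|.
Proof.
move=> x01 y01; rewrite /mean_read -sumrB.
apply: le_trans (ler_norm_sum _ _ _) _.
rewrite expr2 -mulrA mulr_natl -[X in _ *+ X]card_ord -sumr_const.
apply: ler_sum => j _.
have c z : 0 <= z <= 1 -> 0 <= 1 - z <= 1 by move=> /andP[z0 z1]; rewrite subr_ge0 z1 gerBl.
apply: le_trans (lipschitz_pow _ (c _ x01) (c _ y01)) _.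
have -> : `|1 - x - (1 - y)| = `|x - y| by rewrite distrC; congr (`|_|); ring.
by rewrite ler_wpM2r// ler_nat ltnW.
Qed.

Lemma mean_reads_lipschitz x y : 0 <= x <= 1 -> 0 <= y <= 1 ->
  `|mean_reads x - mean_reads y| <= M * `|x - y|.
Proof.
move=> x01 y01.
have t2 : tame (1 : R) (fun k => k%:R ^+ 2) by apply: tame_le_sq => k; rewrite ger0_norm ?mul1r// exprn_ge0.
have tZ : tame `|x - y| (fun k => `|x - y| * k%:R ^+ 2).
  by apply: tame_le_sq => k; rewrite ger0_norm ?mulr_ge0 ?exprn_ge0.
apply: (@le_trans _ _ (mean_of law (fun k => `|x - y| * k%:R ^+ 2))).
  apply: (mean_of_dist K0 sg (tame_read x01) (tame_read y01) tZ) => k.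
  by rewrite mulrC mean_read_lipschitz.
rewrite (mean_ofZ K0 sg _ t2) mulrC ler_wpM2r//.
by apply: le_trans (ler_norm _) _; rewrite -[leRHS]mul1r; apply: (mean_of_norm K0 sg t2).
Qed.

Lemma mean_reads_le x : 0 <= x <= 1 -> mean_reads x <= mu.
Proof.
move=> x01; rewrite -mean_of_id.
by apply: (le_mean_of K0 sg (tame_read x01) tame_id) => k; exact: mean_read_le.
Qed.

Lemma mom_gt0 : 0 < M.
Proof. by rewrite mulr_gt0// exprn_gt0// ltr_pwDl// mulr_ge0// sqr_ge0. Qed.

(* AM-GM: k <= a [k >= 1] + k^2 / (4 a) with a = M / (2 mu). *)
Lemma mean_reads_ge x : 0 < mu -> 0 <= x <= 1 -> mu ^+ 2 / M <= mean_reads x.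
Proof.
move=> mu0 x01; have M0 := mom_gt0; pose a := M / (2 * mu).
have a0 : 0 < a by apply: divr_gt0 => //; exact: mulr_gt0.
have t2 : tame (1 : R) (fun k => k%:R ^+ 2) by apply: tame_le_sq => k; rewrite ger0_norm ?mul1r// exprn_ge0.
have tr := tame_read x01.
have ta : tame a (fun k => a * mean_read k x).
  by move=> k; rewrite normrM (gtr0_norm a0) ler_pM2l// -[leRHS]mul1r; exact: tr.
have t4 : tame (4 * a)^-1 (fun k => (4 * a)^-1 * k%:R ^+ 2).
  by apply: tame_le_sq => k; rewrite ger0_norm// mulr_ge0 ?invr_ge0 ?exprn_ge0// mulr_ge0// ltW.
have tS : tame (a + (4 * a)^-1) (fun k => a * mean_read k x + (4 * a)^-1 * k%:R ^+ 2).
  by move=> k; rewrite [leRHS]mulrDl; apply: le_trans (ler_normD _ _) _; exact: lerD (ta k) (t4 k).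
have : mu <= a * mean_reads x + (4 * a)^-1 * M.
  rewrite -mean_of_id.
  apply: (@le_trans _ _ (mean_of law (fun k => a * mean_read k x + (4 * a)^-1 * k%:R ^+ 2))).
    apply: (le_mean_of K0 sg tame_id tS) => -[|k].
      by rewrite /mean_read big_ord0 mulr0 add0r expr0n mulr0.
    have r1 : 1 <= mean_read k.+1 x.
      rewrite mean_readS lerDl mulr_ge0 ?mean_read_ge0//.
      by move: x01; rewrite subr_ge0 => /andP[].
    apply: (@le_trans _ _ (a + (4 * a)^-1 * k.+1%:R ^+ 2)); last by rewrite lerD2r ler_peMr// ltW.
    rewrite -subr_ge0.
    have -> : a + (4 * a)^-1 * k.+1%:R ^+ 2 - k.+1%:R = (2 * a - k.+1%:R) ^+ 2 / (4 * a).
      by field; rewrite gt_eqF.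
    by rewrite divr_ge0 ?sqr_ge0// mulr_ge0// ltW.
  rewrite (mean_ofD K0 sg ta t4) (mean_ofZ K0 sg _ tr) (mean_ofZ K0 sg _ t2) lerD2l.
  apply: ler_wpM2l; first by rewrite invr_ge0 mulr_ge0// ltW.
  by apply: le_trans (ler_norm _) _; rewrite -[leRHS]mul1r; apply: (mean_of_norm K0 sg t2).
have -> : (4 * a)^-1 * M = mu / 2 by rewrite /a; field; rewrite !gt_eqF.
move=> h; rewrite ler_pdivrMr// -(ler_pM2l (_ : 0 < (2 * mu)^-1)) ?invr_gt0 ?mulr_gt0//.
have -> : (2 * mu)^-1 * mu ^+ 2 = mu / 2 by field; rewrite gt_eqF.
have -> : (2 * mu)^-1 * (mean_reads x * M) = a * mean_reads x by rewrite /a; ring.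
by rewrite -subr_ge0 in h *; lra.
Qed.

End moments.

(** * The differential equation *)

Section autonomous_ode.
Context {R : realType}.
Implicit Types (f df F G H : R -> R) (a b c d e g h s t u x y z : R).

Lemma within_continuous_eps H a b s e : {within `[a, b], continuous H} ->
  s \in `[a, b] -> 0 < e ->
  exists2 d, 0 < d & forall t, t \in `[a, b] -> `|t - s| < d -> `|H t - H s| < e.
Proof.
move=> /subspace_continuousP cH sab e0.
have /cvgrPdist_lt/(_ e e0) := cH s sab.
rewrite near_withinE => /nbhs_ballP[d d0 hd]; exists d => // t tab td.
by rewrite distrC; apply: hd => //=; rewrite /ball /= distrC.
Qed.

Lemma is_derive_within_continuous f df a b :
  (forall x, x \in `[a, b] -> is_derive x 1 f (df x)) -> {within `[a, b], continuous f}.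
Proof.
by move=> fdf; apply: derivable_within_continuous => x xab; have [] := fdf x xab.
Qed.

(** Integrating from [a < 0] makes 0 an interior point, so that the derivative there is
    two-sided. *)
Lemma antiderivative_exists f a : continuous f -> a < 0 ->
  exists2 F, F 0 = 0 & forall x, a < x -> is_derive x 1 F (f x).
Proof.
move=> cf a0; pose I x := (\int[lebesgue_measure]_(t in [set` `[a, x]]) (f t))%R.
have dI x : a < x -> is_derive x 1 I (f x).
  move=> ax; have xu : x < x + 1 by rewrite ltrDl.
  have fi : lebesgue_measure.-integrable `[a, x + 1] (EFin \o f).
    apply: continuous_compact_integrable; first exact: segment_compact.
    exact: continuous_subspaceT.
  have [d e] := continuous_FTC1_closed xu fi ax (cf x).
  by constructor; [exact: d|rewrite -derive1E; exact: e].
exists (fun x => I x - I 0); first by rewrite subrr.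
move=> x ax; have := dI x ax => dx.
rewrite -[f x]subr0; apply: is_deriveB.
Qed.

Section potential.
Variables (F rho : R -> R) (C Lip : R).
Hypothesis F0 : F 0 = 0.
Hypothesis dF : forall x, -2 < x -> is_derive x 1 F (rho x).
Hypothesis rho1C : forall x, 1 <= rho x <= C.
Hypothesis rho_lip : forall x y, `|rho x - rho y| <= Lip * `|x - y|.

Lemma potential_mvt g h : -2 < g -> g <= h ->
  exists2 c, g <= c <= h & F h - F g = rho c * (h - g).
Proof.
move=> g2 gh; have [||c] := @MVT_segment _ F rho g h gh.
- by move=> x; rewrite in_itv => /andP[gx _]; apply: dF; exact: lt_trans gx.
- apply: is_derive_within_continuous => x; rewrite in_itv => /andP[gx _].
  by apply: dF; exact: lt_le_trans gx.
by rewrite in_itv /=; exists c.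
Qed.

Lemma potential_incr g h : -2 < g -> g <= h -> h - g <= F h - F g <= C * (h - g).
Proof.
move=> g2 gh; have [c _ ->] := potential_mvt g2 gh.
have /andP[r1 rC] := rho1C c; have h0 : 0 <= h - g by rewrite subr_ge0.
by rewrite ler_peMl// ler_wpM2r.
Qed.

Lemma potential_taylor g h : -2 < g -> g <= h ->
  `|F h - F g - rho g * (h - g)| <= Lip * (h - g) ^+ 2.
Proof.
move=> g2 gh; have [c /andP[gc ch] ->] := potential_mvt g2 gh.
have h0 : 0 <= h - g by rewrite subr_ge0.
rewrite -mulrBl normrM (ger0_norm h0) expr2 mulrA ler_wpM2r//.
apply: le_trans (rho_lip _ _) _; rewrite ger0_norm ?subr_ge0// ler_wpM2l ?lerD2r//.
by have := le_trans (normr_ge0 _) (rho_lip 1 0); rewrite subr0 normr1 mulr1.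
Qed.

(** As [rho >= 1], [F] never contracts distances; this turns a bound on the lag into a bound on the
    fraction read. *)
Lemma potential_dist g h : -2 < g -> -2 < h -> `|g - h| <= `|F g - F h|.
Proof.
move=> g2 h2; wlog gh : g h g2 h2 / g <= h.
  move=> W; have [/W|/ltW/W] := leP g h; first exact.
  by rewrite distrC [in leRHS]distrC; exact.
rewrite distrC [in leRHS]distrC ger0_norm ?subr_ge0//.
by apply: le_trans (ler_norm _); have /andP[] := potential_incr g2 gh.
Qed.

Variable rhs : R -> R.
Hypothesis rhsE : forall x, 0 <= x < 1 -> rhs x = (rho x)^-1.
Hypothesis rhs_gt0 : exists2 d, 0 < d & forall x, `|x| < d -> 0 < rhs x.

Let sol H := [/\ {within `[0, 1], continuous H}, H 0 = 0
    & forall s, s \in `]0, 1[ -> is_derive s 1 H (rhs (H s))].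

(** The solution is the inverse of [F]. Since F' >= 1 and F(0) = 0, the image of [-1, 2] contains
    [-1, 2]; the margin around [0, 1] allows two-sided derivatives of the inverse at both ends. *)
Lemma solution_exists : exists G, sol G.
Proof.
have F_ivt s : exists2 g, -2 < g & (-1 <= s <= 2 -> -1 <= g <= 2 /\ F g = s).
  (* The value 0 outside [-1, 2] is a dummy. *)
  have [s12|] := boolP (-1 <= s <= 2); last by exists 0; rewrite ?ltrN10//; lra.
  have m12 : -1 <= 2 :> R by lra.
  have c12 : {within `[-1, 2], continuous F}.
    apply: is_derive_within_continuous => x; rewrite in_itv /= => /andP[x1 _].
    by apply: dF; lra.
  have g2 : -2 < -1 :> R by lra.
  have g0 : -2 < 0 :> R by lra.
  have le02 : 0 <= 2 :> R by lra.
  have le10 : -1 <= 0 :> R by lra.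
  have /andP[h1 _] := potential_incr g0 le02.
  have /andP[h2 _] := potential_incr g2 le10.
  have hs : Num.min (F (-1)) (F 2) <= s <= Num.max (F (-1)) (F 2).
    move: s12 h1 h2; rewrite F0 => /andP[s1 s2] h1 h2; rewrite ge_min le_max.
    by apply/andP; split; apply/orP; [left|right]; lra.
  have [c c12' cE] := IVT m12 c12 hs; exists c; first by move: c12'; rewrite in_itv /= => /andP[]; lra.
  by move=> _; split => //; move: c12'; rewrite in_itv.
pose G s := projT1 (cid2 (F_ivt s)).
have G2 s : -2 < G s by rewrite /G; case: cid2.
have FG s : -1 <= s <= 2 -> -1 <= G s <= 2 /\ F (G s) = s by rewrite /G; case: cid2.
have Finj g h : -2 < g -> -2 < h -> F g = F h -> g = h.
  move=> g2 h2 gh; apply/eqP; rewrite -subr_eq0 -normr_le0.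
  by have := potential_dist g2 h2; rewrite gh subrr normr0.
have m20 : -2 < 0 :> R by lra.
have G0 : G 0 = 0.
  by apply: Finj => //; rewrite F0; apply: (FG 0 _).2; lra.
have G01 s : 0 <= s <= 1 -> 0 <= G s <= s.
  move=> s01; have [_ e] : -1 <= G s <= 2 /\ F (G s) = s by apply: FG; lra.
  have [Gs|Gs] := leP 0 (G s).
    by have := potential_incr m20 Gs; rewrite F0 e; lra.
  by have := potential_incr (G2 s) (ltW Gs); rewrite F0 e; lra.
have dG s : 0 <= s <= 1 -> is_derive s 1 G (rho (G s))^-1.
  move=> s01; have [_ e] : -1 <= G s <= 2 /\ F (G s) = s by apply: FG; lra.
  have Gs := G01 s s01.
  rewrite -{1}e; apply: is_derive_inverse.
  - have cF : {for G s, continuous F}.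
      have [d _] := dF (G2 s).
      by apply: differentiable_continuous; exact/derivable1_diffP.
    have n1 : \forall z \near G s, -1 < z by apply: lt_nbhsr; lra.
    have nF1 : \forall z \near G s, -1 < F z.
      suff /cF : nbhs (F (G s)) [set y | -1 < y] by [].
      by rewrite e; apply: lt_nbhsr; lra.
    have nF2 : \forall z \near G s, F z < 2.
      suff /cF : nbhs (F (G s)) [set y | y < 2] by [].
      by rewrite e; apply: lt_nbhsl; lra.
    near=> z.
    have z1 : -1 < z by near: z.
    have z2 : -1 < F z by near: z.
    have z3 : F z < 2 by near: z.
    by apply: Finj => //; [lra|apply: (FG _ _).2; lra].
  - have n1 : \forall z \near G s, -1 < z by apply: lt_nbhsr; lra.
    near=> z.
    have z1 : -1 < z by near: z.
    have z2 : -2 < z by lra.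
    have [d _] := dF z2.
    by apply: differentiable_continuous; exact/derivable1_diffP.
  - exact: dF.
  - by rewrite gt_eqF//; have := rho1C (G s); lra.
exists G; split => //.
  by apply: is_derive_within_continuous => x; rewrite in_itv /= => x01; exact: dG.
move=> s; rewrite in_itv /= => s01; have Gs : 0 <= G s <= s by apply: G01; lra.
rewrite rhsE; last by lra.
by apply: dG; lra.
Unshelve. all: by end_near. Qed.

(** The right-hand side is controlled only on [0, 1[ and, by [rhs_gt0], near 0, so a solution must
    be shown to stay there. Let c be the supremum of the times up to which the bounds hold. Just
    after c, H lies in ]-d, 1[, where its derivative is positive; so H remains nonnegative, and then
    its derivative 1/rho is at most 1. *)
Lemma solution_bounds H : sol H -> forall s, 0 <= s <= 1 -> 0 <= H s <= s.
Proof.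
move=> [cH H0 dH].
pose S := [set s : R | 0 <= s <= 1 /\ forall u, 0 <= u <= s -> 0 <= H u <= u].
have S0 : S 0.
  split=> [|u u0]; first by lra.
  by rewrite (_ : u = 0) ?H0 ?lexx//; lra.
have ubS : ubound S 1 by move=> s [s01 _]; lra.
have supS : has_sup S by split; [exists 0|exists 1].
pose c := sup S.
have c0 : 0 <= c by apply: ub_le_sup => //; exists 1.
have c1 : c <= 1 by apply: ge_sup => //; exists 0.
have cI : c \in `[0, 1] by rewrite in_itv /= c0.
have ltc u : 0 <= u < c -> 0 <= H u <= u.
  move=> /andP[u0 uc]; have cu : 0 < c - u by rewrite subr_gt0.
  have [s [_ hs] us] := sup_adherent cu supS.
  by apply: hs; rewrite u0 /=; move: us; rewrite -/c; lra.
have leS x : S x -> x <= c by move=> Sx; apply: ub_le_sup => //; exists 1.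
clearbody c.
have Hc : 0 <= H c <= c.
  have [->|cN0] := eqVneq c 0; first by rewrite H0 lexx.
  have cp : 0 < c by rewrite lt_neqAle eq_sym cN0.
  have near_c e : 0 < e -> exists2 u, 0 <= u < c & `|H u - H c| < e.
    move=> e0; have [d d0 hd] := within_continuous_eps cH cI e0.
    pose u := Num.max 0 (c - d / 2).
    have u0 : 0 <= u by rewrite le_max lexx.
    have uc : u < c by rewrite gt_max cp; lra.
    have ud : c - d / 2 <= u by rewrite le_max lexx orbT.
    exists u; first by rewrite u0.
    apply: hd; first by rewrite in_itv /=; lra.
    by rewrite ltr0_norm; lra.
  apply/andP; split; rewrite leNgt; apply/negP => hc.
    have [|u uc] := near_c (- H c); first by lra.
    by have := ltc u uc; rewrite ltr_norml; lra.
  have [|u uc] := near_c (H c - c); first by lra.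
  by have := ltc u uc; rewrite ltr_norml; lra.
have Hc' u : 0 <= u <= c -> 0 <= H u <= u.
  move=> /andP[u0]; rewrite le_eqVlt => /orP[/eqP ->//|uc].
  by apply: ltc; rewrite u0.
suff c1E : c = 1 by move=> s s01; apply: Hc'; rewrite c1E.
apply/eqP; rewrite eq_le c1 leNgt /=; apply/negP => c1'.
have [d d0 rd] := rhs_gt0.
(* Within [e] of H c, H stays above -d because H c >= 0, and below 1 because H c <= c. *)
pose e := Num.min d (1 - c).
have e0 : 0 < e by rewrite lt_min d0 subr_gt0.
have [de de0 hde] := within_continuous_eps cH cI e0.
pose b := Num.min 1 (c + de / 2).
have b1 : b <= 1 by rewrite ge_min lexx.
have cb : c < b by rewrite lt_min c1'; lra.
have bd : b <= c + de / 2 by rewrite ge_min lexx orbT.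
have Hnear u : c <= u <= b -> - d < H u < 1.
  move=> ub; have : `|H u - H c| < e.
    apply: hde; first by rewrite in_itv /=; lra.
    by rewrite ger0_norm; lra.
  by rewrite lt_min => /andP[]; rewrite !ltr_norml; lra.
clearbody e b.
have rpos x : - d < x < 1 -> 0 < rhs x.
  move=> x01; have [x0|x0] := ltP x 0.
    by apply: rd; rewrite ltr0_norm//; lra.
  by rewrite rhsE ?invr_gt0; [have := rho1C x; lra|lra].
have mvt u : c <= u <= b ->
    exists2 v, c < v < u \/ v = c & H u - H c = rhs (H v) * (u - c).
  move=> /andP[]; rewrite le_eqVlt => /orP[/eqP <- _|cu ub].
    by exists c; [right|rewrite !subrr mulr0].
  have dHcu x : x \in `]c, u[ -> is_derive x 1 H (rhs (H x)).
    rewrite in_itv /= => xu. apply: dH. rewrite in_itv /=. lra.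
  have cHcu : {within `[c, u], continuous H}.
    apply: continuous_subspaceW cH => x /=. rewrite !in_itv /=. lra.
  have [v] := MVT cu dHcu cHcu.
  by rewrite in_itv /= => vu ->; exists v => //; left.
have Hge u : c <= u <= b -> 0 <= H u.
  move=> ub; have [v vu e'] := mvt u ub.
  have rv : 0 < rhs (H v) by apply/rpos/Hnear; case: vu; lra.
  have : 0 <= rhs (H v) * (u - c) by apply: mulr_ge0; lra.
  lra.
have Sb : S b.
  split=> [|u ub]; first by lra.
  have [uc|cu] := leP u c; first by apply: Hc'; lra.
  have cub : c <= u <= b by lra.
  rewrite Hge//=; have [v vu e'] := mvt u cub.
  have vb : c <= v <= b by case: vu; lra.
  have rv : rhs (H v) <= 1.
    have := Hnear v vb; have := Hge v vb => h1 h2.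
    rewrite rhsE; last by lra.
    by rewrite invf_le1; have := rho1C (H v); lra.
  have : rhs (H v) * (u - c) <= u - c by rewrite ler_piMl; lra.
  lra.
by have := leS b Sb; rewrite leNgt cb.
Qed.

(** The derivative of [F \o H] is rho(H) times 1/rho(H). Uniqueness follows, since [F] is
    injective. *)
Lemma solution_potential H : sol H -> forall s, 0 <= s <= 1 -> F (H s) = s.
Proof.
move=> solH s /andP[s0 s1]; have Hb := solution_bounds solH.
have [cH H0 dH] := solH.
have [->|sN0] := eqVneq s 0; first by rewrite H0 F0.
have sp : 0 < s by rewrite lt_neqAle eq_sym sN0.
have [||c] := @MVT _ (F \o H) (fun=> 1) 0 s sp.
- move=> x; rewrite in_itv /= => x0s.
  have x01 : x \in `]0, 1[ by rewrite in_itv /=; lra.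
  have Hx : 0 <= H x <= x by apply: Hb; lra.
  have dx := dH x x01.
  have dFx : is_derive (H x) 1 F (rho (H x)) by apply: dF; lra.
  have e1 : rho (H x) * rhs (H x) = 1.
    by rewrite rhsE ?mulfV//; [rewrite gt_eqF//; have := rho1C (H x); lra|lra].
  by rewrite -[X in is_derive _ _ _ X]e1; exact: is_derive1_comp.
- apply: within_continuous_comp; last first.
    by apply: continuous_subspaceW cH => y /=; rewrite !in_itv /=; lra.
  move=> y /set_mem[x /=]; rewrite in_itv /= => xs <-.
  have Hx : 0 <= H x <= x by apply: Hb; lra.
  have Hx2 : -2 < H x by lra.
  have [d _] := dF Hx2.
  by apply: differentiable_continuous; exact/derivable1_diffP.
by move=> _; rewrite /= H0 F0 subr0 mul1r subr0.
Qed.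

Lemma solution_unique H1 H2 : sol H1 -> sol H2 ->
  forall s, 0 <= s <= 1 -> H1 s = H2 s.
Proof.
move=> s1 s2 s s01; apply/eqP; rewrite -subr_eq0 -normr_le0.
have b1 := solution_bounds s1 s01; have b2 := solution_bounds s2 s01.
have h1 : -2 < H1 s by lra.
have h2 : -2 < H2 s by lra.
apply: le_trans (potential_dist h1 h2) _.
by rewrite (solution_potential s1 s01) (solution_potential s2 s01) subrr normr0.
Qed.

End potential.
End autonomous_ode.

(** * The chain of unread half-edges *)

Section annealed_chain.
Context {R : realType} {H U : finType}.
Variables (tg : H -> U) (real : pred U).
Variables (p : nat -> R) (L T : nat) (F : R -> R).
Implicit Types (X : {set H}) (s : R).

Local Notation m := #|H|.
Local Notation arrival := (@arrival R H U tg real).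
Local Notation nfresh := (@nfresh H U tg real).

Hypothesis p_ge0 : forall k, 0 <= p k.
Hypothesis p_le1 : \sum_(k < L.+1) p k <= 1.

(* The process approximated by the solution of the ODE. *)
Definition read_frac X : R := 1 - #|X|%:R / m%:R.

Definition lag t X : R := F (read_frac X) - t%:R / T%:R.

(** Because [rho * abar = muV], the mean increment of the lag is muV/m - 1/T up to errors. The terms
    bounded by [a] are the Taylor error of [F], the second order of the exponential, the errors on
    the fresh probability ([eta]) and on the truncated mean ([del']), the mismatch between muV/m and
    1/T, and the mass lost by truncation ([del]). *)
Lemma one_step (C Lip rho x abar muV eta del' del lam s a : R) t X :
  (0 < m)%N -> 0 < T%:R :> R -> (L < #|X|)%N ->
  (forall h, read_frac X <= h -> h - read_frac X <= F h - F (read_frac X) <= C * (h - read_frac X)) ->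
  (forall h, read_frac X <= h ->
     `|F h - F (read_frac X) - rho * (h - read_frac X)| <= Lip * (h - read_frac X) ^+ 2) ->
  0 <= Lip -> 0 <= C -> 0 <= rho -> 0 <= x <= 1 -> rho * abar = muV ->
  (forall i, (i < L)%N -> `|(nfresh X)%:R / (#|X| - i)%:R - x| <= eta) -> 0 <= eta ->
  `|\sum_(k < L.+1) p k * mean_read k x - abar| <= del' ->
  1 - del <= \sum_(k < L.+1) p k -> `|s| = lam ->
  lam * (C * L%:R / m%:R + T%:R^-1) <= 2^-1 ->
  lam * (Lip * (L%:R / m%:R) ^+ 2) + 2 * (lam * (C * L%:R / m%:R + T%:R^-1)) ^+ 2
   + lam * (rho / m%:R * (L%:R ^+ 2 * eta + del') + `|muV / m%:R - T%:R^-1| + del / T%:R) <= a ->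
  \sum_(k < L.+1) p k * arrival (fun X' => expR (s * lag t.+1 X')) k X
  <= expR a * expR (s * lag t X).
Proof.
move=> m0 T0 LX Finc Ftay Lip0 C0 rho0 x01 rhoA hfresh eta0 hread hP sl lam1 aE.
have mR : 0 < m%:R :> R by rewrite ltr0n.
have lam0 : 0 <= lam by rewrite -sl normr_ge0.
set r : R := #|X|%:R; set E0 := expR (s * lag t X).
set g := read_frac X in Finc Ftay *.
set q := C * L%:R / m%:R + T%:R^-1 in lam1 aE *.
pose kap := lam * (Lip * (L%:R / m%:R) ^+ 2) + 2 * (lam * q) ^+ 2.
have Tinv0 : 0 <= T%:R^-1 :> R by rewrite invr_ge0 ltW.
have q0 : 0 <= q by rewrite addr_ge0// mulr_ge0 ?mulr_ge0 ?invr_ge0.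
have kap0 : 0 <= kap.
  by rewrite addr_ge0 ?mulr_ge0 ?sqr_ge0.
(* The exponential is first bounded by an affine function of [#|X'|], because [arrival_read]
   estimates the mean of the size only. *)
pose a1 := - (E0 * (s * rho / m%:R)).
pose b1 := E0 * (1 + kap - s / T%:R + s * rho / m%:R * r).
have pointwise (k : 'I_L.+1) X' : X' \subset X -> (#|X| <= #|X'| + k)%N ->
    expR (s * lag t.+1 X') <= a1 * #|X'|%:R + b1.
  move=> X'X cX'; have le1 : (#|X'| <= #|X|)%N by exact: subset_leq_card.
  pose j : R := r - #|X'|%:R.
  have j0 : 0 <= j by rewrite subr_ge0 ler_nat.
  have jL : j <= L%:R.
    rewrite lerBlDl -natrD ler_nat; apply: leq_trans cX' _.
    by rewrite leq_add2l -ltnS.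
  pose h := read_frac X'.
  have hg : h - g = j / m%:R by rewrite /h /g /read_frac /j /r mulrBl; ring.
  have jm0 : 0 <= j / m%:R by rewrite divr_ge0 // ltW.
  have gh : g <= h by rewrite -subr_ge0 hg.
  have /andP[D1 D2] := Finc h gh; have D3 := Ftay h gh; rewrite hg in D1 D2 D3.
  set D := F h - F g in D1 D2 D3.
  have jmL : j / m%:R <= L%:R / m%:R by rewrite ler_pM2r ?invr_gt0.
  have lagE : lag t.+1 X' = lag t X + (D - T%:R^-1).
    rewrite /lag -/h -/g -natr1 mulrDl mul1r /D; ring.
  pose y := s * (D - T%:R^-1).
  have -> : expR (s * lag t.+1 X') = E0 * expR y by rewrite lagE mulrDr expRD.
  have -> : a1 * #|X'|%:R + b1 = E0 * (1 + kap + (s * (rho * (j / m%:R)) - s / T%:R)).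
    by rewrite /a1 /b1 /j; field; rewrite !gt_eqF.
  rewrite ler_wpM2l ?expR_ge0//.
  have DT : `|D - T%:R^-1| <= q.
    rewrite ler_norml /q; apply/andP; split.
      have : 0 <= C * L%:R / m%:R by rewrite mulr_ge0 ?mulr_ge0 ?invr_ge0.
      by move=> ?; lra.
    have : C * (j / m%:R) <= C * L%:R / m%:R by rewrite -mulrA ler_wpM2l.
    by move=> ?; lra.
  have ylam : `|y| <= lam * q by rewrite normrM sl ler_wpM2l.
  have y2 : y <= 2^-1 by exact: le_trans (ler_norm _) (le_trans ylam lam1).
  apply: le_trans (expR_le_quadratic y2) _.
  have ysq : y ^+ 2 <= (lam * q) ^+ 2.
    by rewrite -real_normK ?num_real// lerXn2r ?nnegrE ?mulr_ge0.
  have e1 : s * (D - rho * (j / m%:R)) <= lam * (Lip * (L%:R / m%:R) ^+ 2).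
    apply: le_trans (ler_norm _) _; rewrite normrM sl ler_wpM2l//.
    by apply: le_trans D3 _; rewrite ler_wpM2l// lerXn2r ?nnegrE.
  rewrite /kap; have -> : y = s * (D - rho * (j / m%:R)) + (s * (rho * (j / m%:R)) - s / T%:R).
    by rewrite /y; ring.
  by rewrite /y in ysq; lra.
have step (k : 'I_L.+1) : arrival (fun X' => expR (s * lag t.+1 X')) k X <=
    E0 * (1 + kap - s / T%:R + s * rho / m%:R * (r - arrival (fun X' => #|X'|%:R) k X)).
  apply: le_trans (@le_arrival R H U tg real _ _ k X (pointwise k)) _.
  rewrite arrivalZD arrival_const; last by rewrite ltnW// (leq_ltn_trans _ LX)// -ltnS.
  by rewrite le_eqVlt /a1 /b1; apply/orP; left; apply/eqP; ring.
pose e (k : nat) := r - arrival (fun X' => #|X'|%:R) k X.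
have eE : `|\sum_(k < L.+1) p k * e k - abar| <= L%:R ^+ 2 * eta + del'.
  have -> : \sum_(k < L.+1) p k * e k - abar =
      \sum_(k < L.+1) p k * (e k - mean_read k x) + (\sum_(k < L.+1) p k * mean_read k x - abar).
    rewrite addrA; congr (_ - _); rewrite -big_split /=.
    by apply: eq_bigr => k _; rewrite -mulrDr subrK.
  apply: le_trans (ler_normD _ _) _; apply: lerD => //.
  apply: le_trans (ler_norm_sum _ _ _) _.
  apply: (@le_trans _ _ (\sum_(k < L.+1) p k * (L%:R ^+ 2 * eta))); last first.
    by rewrite -mulr_suml ler_piMl// mulr_ge0 ?exprn_ge0.
  apply: ler_sum => k _; rewrite normrM ger0_norm// ler_wpM2l//.
  have kL : (k <= L)%N by rewrite -ltnS.
  apply: le_trans (arrival_read x01 _ _) _.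
  - by rewrite ltnW// (leq_ltn_trans kL).
  - by move=> i ik; apply: hfresh; exact: leq_trans kL.
  by rewrite ler_wpM2r// -natrX ler_nat leq_sqr.
apply: (@le_trans _ _ (E0 * (1 + a))); last first.
  by rewrite mulrC ler_wpM2r ?expR_ge0// expR_ge1Dx.
apply: (@le_trans _ _ (\sum_(k < L.+1) p k *
    (E0 * (1 + kap - s / T%:R + s * rho / m%:R * e k)))).
  by apply: ler_sum => k _; rewrite ler_wpM2l// step.
have -> : \sum_(k < L.+1) p k * (E0 * (1 + kap - s / T%:R + s * rho / m%:R * e k)) =
    E0 * ((1 + kap - s / T%:R) * \sum_(k < L.+1) p k + s * rho / m%:R * \sum_(k < L.+1) p k * e k).
  rewrite mulrDr !mulr_sumr -big_split /=; apply: eq_bigr => k _; ring.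
rewrite ler_wpM2l ?expR_ge0//.
set P := \sum_(k < L.+1) p k in hP *; have P1 : P <= 1 := p_le1.
set S := \sum_(k < L.+1) p k * e k in eE *.
have k1 : (1 + kap) * P <= 1 + kap by rewrite ler_piMr// addr_ge0.
have n1 : s * (muV / m%:R - T%:R^-1) <= lam * `|muV / m%:R - T%:R^-1|.
  by apply: le_trans (ler_norm _) _; rewrite normrM sl.
have n2 : s * ((1 - P) / T%:R) <= lam * (del / T%:R).
  apply: le_trans (ler_norm _) _; rewrite normrM sl ler_wpM2l// ger0_norm.
    by rewrite ler_wpM2r//; lra.
  by rewrite mulr_ge0 // subr_ge0.
have n3 : s * (rho / m%:R * (S - abar)) <= lam * (rho / m%:R * (L%:R ^+ 2 * eta + del')).
  apply: le_trans (ler_norm _) _; rewrite normrM sl ler_wpM2l// normrM.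
  by rewrite ger0_norm ?mulr_ge0 ?invr_ge0// ?ler_wpM2l ?mulr_ge0 ?invr_ge0// ltW.
have -> : (1 + kap - s / T%:R) * P + s * rho / m%:R * S =
    (1 + kap) * P + s * (muV / m%:R - T%:R^-1) + s * ((1 - P) / T%:R)
      + s * (rho / m%:R * (S - abar)).
  by rewrite -rhoA; field; rewrite !gt_eqF.
move: aE; rewrite !mulrDr -/kap => aE.
have : kap + lam * (rho / m%:R * (L%:R ^+ 2 * eta + del')) +
     lam * `|muV / m%:R - T%:R^-1| + lam * (del / T%:R) <= a.
  by apply: le_trans aE; rewrite /kap !mulrDr; lra.
by move=> ?; lra.
Qed.

(** While the barrier is below 1, the set is not atypical and the lag is below [eps], so the step
    estimate is required only there. The factor [c t] pays in advance exp(a) for each step left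
    before [T']; after [T'] nothing is bad and the barrier is 0. *)
Lemma chain_bound (bad : nat -> nat -> bool) (Bad : pred {set H}) (T' : nat) (lam eps a : R) :
  (0 < m)%N -> 0 <= a -> 0 <= lam -> F 0 = 0 ->
  (forall t M, bad t M -> (t <= T')%N) ->
  (forall t X, (t <= T')%N -> ~~ Bad X -> `|lag t X| < eps ->
     ~~ bad t #|seen_of tg real X|) ->
  (forall t X s, (t < T')%N -> ~~ Bad X -> `|lag t X| < eps -> `|s| = lam ->
     \sum_(k < L.+1) p k * arrival (fun X' => expR (s * lag t.+1 X')) k X
     <= expR a * expR (s * lag t X)) ->
  wsum p L T (fun ds => lazy_hit tg real bad ds 0 finset.setT)
  <= \sum_(j < m.+1) avg j (fun X => (Bad X)%:R) + 2 * expR (a * T'%:R - lam * eps).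
Proof.
move=> m0 a0 lam0 F0 badT' Hbad Hstep.
pose Badr X : R := (Bad X)%:R.
have Badr0 X : 0 <= Badr X by rewrite ler0n.
pose c (t : nat) := expR (- lam * eps + a * (T' - t)%:R).
have c0 t : 0 < c t := expR_gt0 _.
pose B (t : nat) X := if (t <= T')%N then future Badr #|X| X +
   c t * (expR (lam * lag t X) + expR (- lam * lag t X)) else 0.
have B0 t X : 0 <= B t X.
  by rewrite /B; case: ifP => // _; rewrite addr_ge0 ?future_ge0// mulr_ge0 ?addr_ge0 ?expR_ge0.
have small t X : (t <= T')%N -> B t X < 1 -> ~~ Bad X /\ `|lag t X| < eps.
  move=> tT'; rewrite /B tT' => B1; split.
    apply/negP => bX; move: B1; rewrite ltNge => /negP; apply.
    apply: (@le_trans _ _ (Badr X)); first by rewrite /Badr bX.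
    apply: le_trans (le_future #|X| X Badr0) _.
    by rewrite lerDl mulr_ge0 ?addr_ge0 ?expR_ge0.
  rewrite ltNge; apply/negP => el; move: B1; rewrite ltNge => /negP; apply.
  apply: ler_wpDl; first exact: future_ge0.
  rewrite mulrDr /c -!expRD.
  have aT : 0 <= a * (T' - t)%:R by rewrite mulr_ge0.
  have le1 : 0 <= - lam * eps + a * (T' - t)%:R + lam * `|lag t X|.
    by have := ler_wpM2l lam0 el; lra.
  have [l0|l0] := leP 0 (lag t X).
    apply: ler_wpDr; first exact: expR_ge0.
    apply: le_trans (expR_ge1Dx _); rewrite lerDl.
    by rewrite ger0_norm in le1.
  apply: ler_wpDl; first exact: expR_ge0.
  apply: le_trans (expR_ge1Dx _); rewrite lerDl.
  by move: le1; rewrite ltr0_norm//; lra.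
have -> : \sum_(j < m.+1) avg j (fun X => (Bad X)%:R) + 2 * expR (a * T'%:R - lam * eps) =
    B 0 finset.setT.
  rewrite /B leq0n -avg_future// cardsT avg_setT; congr (_ + _).
  rewrite /lag /read_frac cardsT divff ?pnatr_eq0 -?lt0n// subrr F0 mul0r subrr !mulr0 expR0.
  by rewrite /c subn0 mulrC addrC mulNr.
apply: (@barrier_le R H U tg real bad p L p_ge0 p_le1 T B) => //; last by rewrite addn0.
- move=> t X bX; rewrite leNgt; apply/negP => B1.
  have tT' := badT' _ _ bX; have [nB nl] := small t X tT' B1.
  by have := Hbad t X tT' nB nl; rewrite bX.
- move=> t X _ B1.
  have [tT'|tT'] := ltnP t T'; last first.
    rewrite big1 ?B0// => k _; have -> : B t.+1 = fun=> 0.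
      by apply/funext => X'; rewrite /B ltnNge tT'.
    by rewrite arrival0 mulr0.
  have [nB nl] := small t X (ltnW tT') B1.
  have -> : B t.+1 = fun X' => c t.+1 * (1 * expR (lam * lag t.+1 X') + expR (- lam * lag t.+1 X'))
        + future Badr #|X'| X'.
    by apply/funext => X'; rewrite /B tT' mul1r addrC.
  have h1 := Hstep t X lam tT' nB nl (ger0_norm lam0).
  have h2 := Hstep t X (- lam) tT' nB nl (etrans (normrN _) (ger0_norm lam0)).
  under eq_bigr do rewrite arrivalZD arrivalZD mul1r mulrDr mulrCA.
  rewrite big_split /= -mulr_sumr addrC /B (ltnW tT'); apply: lerD.
    apply: (@le_trans _ _ (\sum_(k < L.+1) p k * future Badr #|X| X)).
      by apply: ler_sum => k _; rewrite ler_wpM2l// arrival_future.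
    by rewrite -mulr_suml ler_piMl// future_ge0.
  have -> : c t = c t.+1 * expR a.
    rewrite /c -expRD; congr expR; rewrite -addrA; congr (_ + _).
    by rewrite -subnSK// -natr1; ring.
  rewrite -mulrA ler_pM2l//.
  under eq_bigr do rewrite mulrDr.
  by rewrite big_split mulrDr; apply: lerD.
Qed.

End annealed_chain.

(** * Concentration of unmatched vertices and fresh half-edges *)

Section concentration.
Context {R : realType} {H U : finType}.
Variables (tg : H -> U) (real : pred U).
Implicit Types X : {set H}.
Local Notation m := #|H|.
Local Notation d := (multiplicity tg).

Lemma mem_seen_of X u : (u \in seen_of tg real X) = real u && ~~ intact tg X u.
Proof.
rewrite inE; congr (_ && _); rewrite /intact negb_forall.
by apply: eq_existsb => h; rewrite negb_imply andbC.
Qed.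

Definition nintact X : nat := \sum_(u | real u) intact tg X u.

Lemma card_seen_of X : (#|seen_of tg real X| + nintact X = #|real|)%N.
Proof.
rewrite -sum1_card /nintact -sum1_card.
rewrite [RHS](bigID (intact tg X)) /= addnC; congr (_ + _)%N.
  by rewrite big_mkcondr; apply: eq_bigr => u _; case: ifP.
by apply: eq_bigl => u; rewrite mem_seen_of.
Qed.

(** The fresh half-edges are all the half-edges of intact real vertices. Hence both statistics of a
    set are linear in the indicators [intact], as [bern_tail] requires. *)
Lemma nfreshE X : nfresh tg real X = (\sum_(u | real u) d u * intact tg X u)%N.
Proof.
rewrite /nfresh -sum1_card.
rewrite (partition_big tg real) /=; last first.
  by move=> h; rewrite inE => /and3P[].
apply: eq_bigr => u ru; case: (boolP (intact tg X u)) => iu; last first.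
  rewrite muln0 big1// => h /andP[]; rewrite inE /fresh => /and3P[_ _ nh] /eqP hu.
  by move: nh; rewrite mem_seen_of hu ru iu.
rewrite muln1 /multiplicity -sum1_card; apply: eq_bigl => h; rewrite !inE.
case: eqP => [hu|]; rewrite ?andbF// andbT.
rewrite /fresh mem_seen_of hu ru iu !andbT.
by move/forallP: iu => /(_ h); rewrite hu eqxx.
Qed.

Section bad_sets.
Variables (psi0 psi1 : R -> R) (t1 : R).

Definition left_frac X : R := #|X|%:R / m%:R.

Definition atypical X : bool :=
  (t1 < `|(nintact X)%:R - psi0 (left_frac X)|) ||
  (t1 < `|(nfresh tg real X)%:R - psi1 (left_frac X)|).

(** The deviation [t1] is shared: [t2] for the degrees, whose sums over the vertices differ from
    their limits, and [t1 - t2] for the random set. One factor m + 1 counts the sizes, the other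
    comes from [avg_le_bern]; the 4 stands for two statistics with two-sided tails. *)
Lemma sum_avg_atypical (L : nat) (t2 th : R) : (0 < m)%N -> (0 < L)%N ->
  (forall u, real u -> (d u <= L)%N) ->
  (forall j, (j <= m)%N ->
     `|\sum_(u | real u) (j%:R / m%:R) ^+ d u - psi0 (j%:R / m%:R)| <= t2) ->
  (forall j, (j <= m)%N ->
     `|\sum_(u | real u) (d u)%:R * (j%:R / m%:R) ^+ d u - psi1 (j%:R / m%:R)| <= t2) ->
  0 <= th -> th * L%:R <= 2^-1 ->
  \sum_(j < m.+1) avg j (fun X => (atypical X)%:R)
  <= m.+1%:R ^+ 2 * (4 * expR (#|U|%:R * (2 * (th * L%:R) ^+ 2) - th * (t1 - t2))).
Proof.
move=> m0 L0 dL h0 h1 th0 thL.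
rewrite expr2 -mulrA -[m.+1 in X in _ <= X%:R * _]card_ord mulr_natl -sumr_const.
apply: ler_sum => j _; have jm : (j <= m)%N by rewrite -ltnS.
set y : R := j%:R / m%:R.
have mR : 0 < m%:R :> R by rewrite ltr0n.
have y01 : 0 <= y <= 1.
  apply/andP; split; first by rewrite divr_ge0 // ltW.
  by rewrite ler_pdivrMr// mul1r ler_nat.
pose a0 u : R := (real u)%:R; pose a1 u : R := (real u)%:R * (d u)%:R.
pose dev (a : U -> R) X : R :=
  (t1 - t2 < `|\sum_u a u * (intact tg X u)%:R - \sum_u a u * y ^+ d u|)%R%:R.
have tail a : (forall u, 0 <= a u <= L%:R) ->
    bern y (dev a) <= 2 * expR (#|U|%:R * (2 * (th * L%:R) ^+ 2) - th * (t1 - t2)).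
  by move=> aL; apply: bern_tail.
apply: (@le_trans _ _ (avg j (fun X => dev a0 X + dev a1 X))).
  rewrite /avg ler_wpM2l ?invr_ge0//; apply: ler_sum => X /eqP Xj.
  have lt_dev (x v w : R) : `|w - v| <= t2 -> t1 < `|x - v| -> t1 - t2 < `|x - w|.
    move=> wv xv; rewrite ltrBlDr; apply: lt_le_trans xv _.
    rewrite -[x - v](subrK (w - v)) (_ : x - v - (w - v) = x - w); last by ring.
    by apply: le_trans (ler_normD _ _) _; rewrite lerD2l.
  have sum_real (c : U -> R) : \sum_u (real u)%:R * c u = \sum_(u | real u) c u.
    by rewrite [RHS]big_mkcond; apply: eq_bigr => u _; case: (real u); rewrite ?mul1r ?mul0r.
  rewrite /atypical /left_frac Xj -/y; case: ltP => /= [b0|_].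
    rewrite -[leLHS]addr0 lerD// /dev.
    have E1 : (nintact X)%:R = \sum_u a0 u * (intact tg X u)%:R :> R.
      by rewrite /nintact natr_sum sum_real.
    by rewrite -E1 /a0 sum_real (lt_dev _ _ _ (h0 j jm) b0).
  case: ltP => /= [b1|_]; last by rewrite addr_ge0.
  rewrite -[leLHS]add0r lerD// /dev.
  have E1 : (nfresh tg real X)%:R = \sum_u a1 u * (intact tg X u)%:R :> R.
    rewrite nfreshE natr_sum /a1; under [RHS]eq_bigr do rewrite -mulrA.
    by rewrite sum_real; apply: eq_bigr => u _; rewrite natrM.
  rewrite -E1; have -> : \sum_u a1 u * y ^+ d u = \sum_(u | real u) (d u)%:R * y ^+ d u.
    by rewrite /a1; under eq_bigr do rewrite -mulrA; rewrite sum_real.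
  by rewrite (lt_dev _ _ _ (h1 j jm) b1).
apply: le_trans (avg_le_bern m0 jm _) _; first by move=> X; rewrite addr_ge0.
rewrite ler_wpM2l// -/y.
have -> : bern y (fun X => dev a0 X + dev a1 X) = bern y (dev a0) + bern y (dev a1).
  by rewrite /bern -big_split; apply: eq_bigr => X _; rewrite mulrDr.
have L1 : 1 <= L%:R :> R by rewrite ler1n.
have t0 : bern y (dev a0) <= 2 * expR (#|U|%:R * (2 * (th * L%:R) ^+ 2) - th * (t1 - t2)).
  by apply: tail => u; rewrite /a0 ler0n /=; case: (real u); [exact: L1|rewrite ler0n].
have t3 : bern y (dev a1) <= 2 * expR (#|U|%:R * (2 * (th * L%:R) ^+ 2) - th * (t1 - t2)).
  apply: tail => u; rewrite /a1 mulr_ge0//=; case: (boolP (real u)) => ru; last by rewrite mul0r.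
  by rewrite mul1r ler_nat dL.
lra.
Qed.

End bad_sets.
End concentration.

(** * Regularity of the rate in the ODE *)

Section greedy_rate.
Context {R : realType}.
Variables (piU piV : probability nat R) (KU KV muU muV : R).
Hypotheses (KU0 : 0 < KU) (KV0 : 0 < KV) (muU0 : 0 < muU) (muV0 : 0 < muV).
Hypotheses (sgU : sub_gaussian_with piU KU) (sgV : sub_gaussian_with piV KV).
Hypotheses (mU : has_mean piU muU) (mV : has_mean piV muV).
Local Notation MU := (mom KU).
Local Notation MV := (mom KV).
Implicit Types (g h x y : R).

Definition hit_prob y : R := @dgen_fun R piU y / muU.

Definition clamp01 g : R := Num.min 1 (Num.max 0 g).

(* The reciprocal of the right-hand side of the ODE on [0, 1[, extended by
   constants; unlike greedy_rhs it is not indeterminate where dgen_fun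
   vanishes. *)
Definition slowness g : R := muV / @mean_reads R piV (hit_prob (1 - clamp01 g)).

(** [muV] divided by the lower bound [muV ^+ 2 / MV] of [mean_reads]. *)
Definition slowness_max : R := MV / muV.

(** Lipschitz constant of muV/A with A = [mean_reads] of [hit_prob]: A has constant MV * MU / muU,
    and the denominator is the square of its lower bound. *)
Definition slowness_lip : R := muV * (MV * (MU / muU)) / (muV ^+ 2 / MV) ^+ 2.

Lemma clamp01P g : 0 <= clamp01 g <= 1.
Proof. by rewrite /clamp01 ge_min lexx le_min ler01 le_max lexx. Qed.

Lemma clamp01_id g : 0 <= g <= 1 -> clamp01 g = g.
Proof.
by move=> /andP[g0 g1]; rewrite /clamp01 (max_idPr g0) (min_idPr g1).
Qed.

Lemma clamp01_lip g h : `|clamp01 g - clamp01 h| <= `|g - h|.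
Proof.
wlog gh : g h / g <= h.
  move=> W; have [/W//|/ltW/W] := leP g h.
  by rewrite distrC [in leRHS]distrC.
rewrite distrC [in leRHS]distrC [in leRHS]ger0_norm ?subr_ge0// /clamp01.
case: (leP 1 (Num.max 0 g)) => a; case: (leP 1 (Num.max 0 h)) => b; move: a b;
  by case: (leP 0 g) => ?; case: (leP 0 h) => ? a b; rewrite ger0_norm; lra.
Qed.

Lemma hit_prob01 y : 0 <= y <= 1 -> 0 <= hit_prob y <= 1.
Proof.
move=> y01; apply/andP; split; first by rewrite divr_ge0 ?(dgen_fun_ge0 KU0 sgU)// ltW.
by rewrite ler_pdivrMr// mul1r (dgen_fun_le KU0 sgU mU).
Qed.

Lemma hit_prob_lip y x : 0 <= y <= 1 -> 0 <= x <= 1 ->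
  `|hit_prob y - hit_prob x| <= MU / muU * `|y - x|.
Proof.
move=> y01 x01; rewrite -mulrBl normrM normfV (gtr0_norm muU0) mulrAC ler_pM2r ?invr_gt0//.
by apply: (dgen_fun_lipschitz KU0 sgU).
Qed.

Let MV0 : 0 < MV := @mom_gt0 R KV.
Let c0 : 0 < muV ^+ 2 / MV. Proof. by apply: divr_gt0 => //; exact: exprn_gt0. Qed.

Let reads_ge y : 0 <= y <= 1 -> muV ^+ 2 / MV <= @mean_reads R piV (hit_prob y).
Proof. by move=> y01; apply: (mean_reads_ge KV0 sgV mV muV0); exact: hit_prob01. Qed.

Let reads_gt0 y : 0 <= y <= 1 -> 0 < @mean_reads R piV (hit_prob y).
Proof. by move=> y01; apply: lt_le_trans c0 _; exact: reads_ge. Qed.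

Let onem01 g : 0 <= g <= 1 -> 0 <= 1 - g <= 1. Proof. lra. Qed.

Lemma slowness_bounds g : 1 <= slowness g <= slowness_max.
Proof.
have y01 := onem01 (clamp01P g).
have r0 := reads_gt0 y01; rewrite /slowness; apply/andP; split.
  by rewrite ler_pdivlMr// mul1r (mean_reads_le KV0 sgV mV)// hit_prob01.
have h := reads_ge y01; rewrite ler_pdivrMr//; apply: le_trans (ler_wpM2l _ h).
  by rewrite /slowness_max le_eqVlt; apply/orP; left; apply/eqP; field; rewrite !gt_eqF.
by rewrite divr_ge0 ?ltW.
Qed.

Lemma slowness_lip_ge0 : 0 <= slowness_lip.
Proof.
apply: divr_ge0; last by rewrite exprn_ge0// ltW.
apply: mulr_ge0; first exact: ltW.
by apply: mulr_ge0; [exact: mom_ge0|apply: divr_ge0; [exact: mom_ge0|exact: ltW]].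
Qed.

Lemma slowness_lipschitz g h : `|slowness g - slowness h| <= slowness_lip * `|g - h|.
Proof.
have yg := onem01 (clamp01P g); have yh := onem01 (clamp01P h).
rewrite /slowness.
have A0 := reads_gt0 yg; have B0 := reads_gt0 yh.
have AB : (muV ^+ 2 / MV) ^+ 2 <= @mean_reads R piV (hit_prob (1 - clamp01 g)) * @mean_reads R piV (hit_prob (1 - clamp01 h)).
  by rewrite expr2; apply: ler_pM; rewrite ?(ltW c0)// reads_ge.
have num : `|muV * (@mean_reads R piV (hit_prob (1 - clamp01 h)) - @mean_reads R piV (hit_prob (1 - clamp01 g)))|
    <= muV * (MV * (MU / muU)) * `|g - h|.
  rewrite normrM (gtr0_norm muV0) -mulrA ler_pM2l// distrC.
  apply: le_trans (mean_reads_lipschitz KV0 sgV (hit_prob01 yg) (hit_prob01 yh)) _.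
  rewrite -mulrA ler_pM2l//; apply: le_trans (hit_prob_lip yg yh) _.
  have q0 : 0 <= MU / muU by rewrite divr_ge0 ?mom_ge0// ltW.
  rewrite ler_wpM2l//.
  have -> : 1 - clamp01 g - (1 - clamp01 h) = - (clamp01 g - clamp01 h) by ring.
  by rewrite normrN clamp01_lip.
move: A0 B0 AB num; set A := mean_reads _; set B := mean_reads _; move: A B => A B A0 B0 AB num.
have -> : muV / A - muV / B = muV * (B - A) / (A * B) by field; rewrite !gt_eqF.
rewrite normrM normfV (gtr0_norm (mulr_gt0 A0 B0)) ler_pdivrMr ?mulr_gt0//.
apply: le_trans num _; rewrite /slowness_lip.
set W := muV * (MV * (MU / muU)); set c := (muV ^+ 2 / MV) ^+ 2.
have cp : 0 < c by rewrite exprn_gt0.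
have W0 : 0 <= W / c * `|g - h| by apply: mulr_ge0 => //; exact: slowness_lip_ge0.
have -> : W * `|g - h| = W / c * `|g - h| * c by field; rewrite gt_eqF.
exact: ler_wpM2l.
Qed.

Lemma continuous_slowness : continuous slowness.
Proof.
move=> x; apply/cvgrPdist_lt => e e0.
have Lp : 0 < slowness_lip + 1.
  by apply: ltr_wpDl => //; exact: slowness_lip_ge0.
have e1 : 0 < e / (slowness_lip + 1) by rewrite divr_gt0.
near=> y.
apply: le_lt_trans (slowness_lipschitz _ _) _.
apply: (@le_lt_trans _ _ ((slowness_lip + 1) * `|x - y|)).
  by rewrite ler_wpM2r// lerDl.
rewrite -ltr_pdivlMl// mulrC; near: y.
by apply/nbhs_ballP; exists (e / (slowness_lip + 1)).
Unshelve. all: by end_near. Qed.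

Lemma slownessE g : 0 <= g <= 1 -> slowness g * @mean_reads R piV (hit_prob (1 - g)) = muV.
Proof.
move=> g01; rewrite /slowness clamp01_id// divfK// gt_eqF//.
by apply: reads_gt0; exact: onem01.
Qed.

Lemma greedy_rhsE g : 0 <= g < 1 -> greedy_rhs piU piV muU muV g = (slowness g)^-1.
Proof.
move=> /andP[g0 g1]; have g01 : 0 <= g <= 1 by rewrite g0 ltW.
have y01 := onem01 g01.
rewrite /greedy_rhs (derive1_gen_fun KU0 sgU).
have d0 : 0 < @dgen_fun R piU (1 - g) by apply: (dgen_fun_gt0 KU0 sgU mU) => //; lra.
have -> : muU^-1 * @dgen_fun R piU (1 - g) = hit_prob (1 - g) by rewrite mulrC.
rewrite -(mean_readsE KV0 sgV (hit_prob01 y01)) /slowness clamp01_id// invf_div.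
by rewrite /hit_prob; field; rewrite !gt_eqF.
Qed.

(** At 0 the denominator equals muV > 0, so the right-hand side is continuous there with a positive
    value. This covers small negative arguments, where [slowness] is clamped and no longer its
    reciprocal. *)
Lemma greedy_rhs_gt0_near0 : exists2 d, 0 < d & forall g, `|g| < d -> 0 < greedy_rhs piU piV muU muV g.
Proof.
have c : {for 0, continuous (greedy_rhs piU piV muU muV)}.
  have cx : continuous (fun g => @dgen_fun R piU (1 - g)).
    move=> g; apply: continuous_comp; last exact: continuous_dgen_fun KU0 sgU _.
    by apply: cvgB; [exact: cvg_cst|exact: cvg_id].
  rewrite /greedy_rhs (derive1_gen_fun KU0 sgU); apply: cvgM.
    apply: cvgB; first exact: cvg_cst.
    apply: (continuous_comp (f := fun g => 1 - muU^-1 * @dgen_fun R piU (1 - g))).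
      apply: cvgB; first exact: cvg_cst.
      by apply: cvgM; [exact: cvg_cst|exact: cx].
    exact: continuous_gen_fun KV0 sgV _.
  apply: cvgV; last by apply: cvgM; [exact: cvg_cst|exact: cx].
  by rewrite subr0 (dgen_fun1 mU) divfK ?gt_eqF.
have r0 : 0 < greedy_rhs piU piV muU muV 0.
  by rewrite greedy_rhsE ?lexx ?ltr01// invr_gt0; have := slowness_bounds 0; lra.
have /nbhs_ballP[d /= d0 hd] : \forall g \near 0, 0 < greedy_rhs piU piV muU muV g.
  exact: cvgr_gt c _ r0.
exists d => [//|g gd]; apply: hd; rewrite /ball /= sub0r normrN.
exact: gd.
Qed.

Lemma greedy_potential_exists :
  exists2 F : R -> R, F 0 = 0 & forall x, -2 < x -> is_derive x 1 F (slowness x).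
Proof. by apply: antiderivative_exists; [exact: continuous_slowness|lra]. Qed.

End greedy_rate.

(** * Half-edges of U with a frozen extra degree *)

Section half_edges.
Variable N : nat.

(** Agrees with [degU] when [e] is the excess of the degrees of V, but mentions V no more. *)
Definition ext_degree (b : 'I_N -> nat) (e : nat) (i : 'I_N.+1) : nat :=
  if unlift ord_max i is Some j then b j else e.

Definition half_edges (dg : 'I_N.+1 -> nat) : finType := {i : 'I_N.+1 & 'I_(dg i)}.

Definition is_real (u : 'I_N.+1) : bool := u != ord_max.

Lemma multiplicity_half_edges dg (u : 'I_N.+1) :
  multiplicity (fun h : half_edges dg => tag h) u = dg u.
Proof.
rewrite /multiplicity -[RHS]card_ord -(card_imset _ (_ : injective (fun k : 'I_(dg u) => Tagged (fun i => 'I_(dg i)) k))); last first.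
  by move=> k k' /eqP; rewrite eq_Tagged => /eqP.
apply: eq_card => -[i k]; rewrite !inE /=; apply/eqP/imsetP => [iu|[k' _ ek]]; last exact: (congr1 tag ek).
by subst i; exists k.
Qed.

Lemma sum_is_real (R : nmodType) (F : 'I_N.+1 -> R) :
  \sum_(u | is_real u) F u = \sum_(i < N) F (lift ord_max i).
Proof.
rewrite big_mkcond big_ord_recr /= /is_real eqxx /= GRing.addr0.
apply: eq_bigr => i _; have -> : widen_ord (leqnSn N) i = lift ord_max i.
  by apply: val_inj; rewrite /= /bump leqNgt ltn_ord.
by rewrite eq_sym neq_lift.
Qed.

Lemma card_half_edges b e : #|half_edges (ext_degree b e)| = (\sum_i b i + e)%N.
Proof.
rewrite card_tagged sumnE big_map -!big_enum /= !big_enum /=.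
under eq_bigr do rewrite card_ord.
rewrite big_ord_recr /= /ext_degree unlift_none; congr (_ + _)%N.
apply: eq_bigr => i _; have -> : widen_ord (leqnSn N) i = lift ord_max i.
  by apply: val_inj; rewrite /= /bump leqNgt ltn_ord.
by rewrite liftK.
Qed.

Lemma card_is_real : #|is_real| = N.
Proof.
rewrite -sum1_card; have := sum_is_real (fun=> 1%N).
by rewrite sum1_card => ->; rewrite sum1_card card_ord.
Qed.

End half_edges.

(** * Orders of magnitude in one step *)

Section numeric_step.
Context {R : realType}.
Variables (muU muV C Lp MV l n m T rho : R).
Hypotheses (muU0 : 0 < muU) (muV0 : 0 < muV) (C0 : 0 <= C) (Lp0 : 0 <= Lp) (MV0 : 0 <= MV).
Hypotheses (l16 : 16 <= l) (nl : l ^+ 40 <= n).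
Hypotheses (m_ge : muU * n / 2 <= m) (m_near : `|m - muU * n| <= l^-1 ^+ 12 * n).
Hypotheses (TE : T = muU / muV * n) (rho0 : 0 <= rho) (rhoC : rho <= C).

(** In units of l/n, the largest change of the lag in one arrival: C l/m from [F], using m >= muU
    n/2, and 1/T from the clock. *)
Definition step_size : R := 2 * C / muU + muV / muU.

(** In units of 1/n, its five terms bound the errors listed in [one_step] for [lam = l ^+ 5], those
    of [eta] and [del'] being taken together. *)
Definition drift_const : R :=
  4 * Lp / muU ^+ 2 + 2 * step_size ^+ 2 + 2 * C / muU * (8 / muU + MV)
  + 2 * muV / muU ^+ 2 + MV * muV / muU.

Lemma drift_const_ge0 : 0 <= drift_const.
Proof.
have u1 := ltW muU0; have v1 := ltW muV0.
apply: addr_ge0; [apply: addr_ge0; [apply: addr_ge0; [apply: addr_ge0|]|]|].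
- by apply: divr_ge0; rewrite ?mulr_ge0 ?exprn_ge0.
- by rewrite mulr_ge0// sqr_ge0.
- by apply: mulr_ge0; [apply: divr_ge0; rewrite ?mulr_ge0|rewrite addr_ge0// divr_ge0].
- by apply: divr_ge0; rewrite ?mulr_ge0 ?exprn_ge0.
- by apply: divr_ge0; rewrite ?mulr_ge0.
Qed.

Let l0 : 0 < l. Proof. by apply: lt_le_trans l16. Qed.
Let l1 : 1 <= l. Proof. by apply: le_trans l16; rewrite ler1n. Qed.
Let n0 : 0 < n. Proof. by apply: lt_le_trans nl; rewrite exprn_gt0. Qed.
Let ln k : (k <= 40)%N -> l ^+ k <= n.
Proof. by move=> k40; apply: le_trans nl; rewrite ler_weXn2l. Qed.
Let m0 : 0 < m. Proof. by apply: lt_le_trans m_ge; rewrite divr_gt0 ?mulr_gt0. Qed.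
Let im : m^-1 <= 2 / muU / n.
Proof.
rewrite -[leRHS]invrK lef_pV2 ?posrE ?invr_gt0 ?divr_gt0//.
by apply: le_trans m_ge; rewrite le_eqVlt; apply/orP; left; apply/eqP; field; rewrite !gt_eqF.
Qed.
Let TV : T^-1 = muV / muU / n.
Proof. by rewrite TE; field; rewrite !gt_eqF. Qed.

Lemma step_size_bound : C * l / m + T^-1 <= step_size * (l / n).
Proof.
have h1 : C * l / m <= 2 * C / muU * (l / n).
  have -> : 2 * C / muU * (l / n) = C * l * (2 / muU / n) by field; rewrite !gt_eqF.
  by rewrite ler_wpM2l// mulr_ge0// ltW.
have h2 : T^-1 <= muV / muU * (l / n).
  rewrite TV -[leLHS]mulr1 -[X in _ <= _ * X]mulrC mulrA ler_wpM2l//.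
  by rewrite !divr_ge0 ?ltW.
by rewrite /step_size mulrDl; apply: lerD.
Qed.

Lemma lag_step_small : step_size <= l -> l ^+ 5 * (C * l / m + T^-1) <= 2^-1.
Proof.
move=> sl; apply: (@le_trans _ _ (l ^+ 5 * (l * (l / n)))).
  rewrite ler_wpM2l ?exprn_ge0 ?(ltW l0)//; apply: le_trans step_size_bound _.
  by rewrite ler_wpM2r// divr_ge0 ?ltW.
have -> : l ^+ 5 * (l * (l / n)) = l ^+ 7 / n by field; rewrite gt_eqF.
rewrite ler_pdivrMr//; apply: le_trans (_ : 2^-1 * l ^+ 8 <= _); last first.
  by rewrite ler_wpM2l ?invr_ge0// ln.
rewrite [in leRHS]exprS mulrA ler_peMl ?exprn_ge0 ?(ltW l0)//. have h := l16; lra.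
Qed.

(** The first two terms are of order l^7/n^2 and l^12/n^2, within 1/n because n >= l^40. In the
    others the factor l^5 is absorbed by l^2 l^-9, l^-6 and l^-12. *)
Lemma drift_bound :
  l ^+ 5 * (Lp * (l / m) ^+ 2) + 2 * (l ^+ 5 * (C * l / m + T^-1)) ^+ 2 +
  l ^+ 5 * (rho / m * (l ^+ 2 * (8 / muU * l^-1 ^+ 9) + MV * l^-1 ^+ 6)
     + `|muV / m - T^-1| + (MV * l^-1 ^+ 6) / T) <= drift_const / n.
Proof.
have lN0 : l != 0 by rewrite gt_eqF.
have nN0 : n != 0 by rewrite gt_eqF.
have uN0 : muU != 0 by rewrite gt_eqF.
have vN0 : muV != 0 by rewrite gt_eqF.
have mN0 : m != 0 by rewrite gt_eqF.
have im0 : 0 <= m^-1 by rewrite invr_ge0 ltW.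
have i1 : l^-1 <= 1 by rewrite invf_le1.
have i0 : 0 <= l^-1 by rewrite invr_ge0 ltW.
have t1 : l ^+ 5 * (Lp * (l / m) ^+ 2) <= 4 * Lp / muU ^+ 2 / n.
  apply: (@le_trans _ _ (l ^+ 5 * (Lp * (l * (2 / muU / n)) ^+ 2))).
    rewrite ler_wpM2l ?exprn_ge0 ?(ltW l0)// ler_wpM2l// lerXn2r ?nnegrE//.
    - by rewrite mulr_ge0 ?(ltW l0).
    - by rewrite mulr_ge0 ?(ltW l0)//; exact: le_trans im.
    - by rewrite ler_wpM2l ?(ltW l0).
  have -> : l ^+ 5 * (Lp * (l * (2 / muU / n)) ^+ 2) = 4 * Lp / muU ^+ 2 / n * (l ^+ 7 / n).
    by field; rewrite ?nN0 ?uN0.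
  rewrite ler_piMr//; last by rewrite ler_pdivrMr// mul1r ln.
  by rewrite !mulr_ge0 ?invr_ge0 ?exprn_ge0 ?(ltW muU0) ?(ltW n0).
have t2 : 2 * (l ^+ 5 * (C * l / m + T^-1)) ^+ 2 <= 2 * step_size ^+ 2 / n.
  have s0 : 0 <= step_size.
    by apply: addr_ge0; apply: divr_ge0; rewrite ?mulr_ge0 ?(ltW muU0) ?(ltW muV0).
  have T0 : 0 <= T^-1 by rewrite TV !divr_ge0 ?ltW.
  apply: (@le_trans _ _ (2 * (l ^+ 5 * (step_size * (l / n))) ^+ 2)).
    rewrite ler_wpM2l// lerXn2r ?nnegrE//.
    - by rewrite mulr_ge0 ?exprn_ge0 ?(ltW l0)// addr_ge0// !mulr_ge0 ?(ltW l0).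
    - by rewrite mulr_ge0 ?exprn_ge0 ?(ltW l0)// !mulr_ge0 ?invr_ge0 ?(ltW l0) ?(ltW n0).
    - by rewrite ler_wpM2l ?exprn_ge0 ?(ltW l0)// step_size_bound.
  have -> : 2 * (l ^+ 5 * (step_size * (l / n))) ^+ 2 = 2 * step_size ^+ 2 / n * (l ^+ 12 / n).
    by field; rewrite nN0.
  rewrite ler_piMr//; last by rewrite ler_pdivrMr// mul1r ln.
  by rewrite !mulr_ge0 ?invr_ge0 ?exprn_ge0 ?(ltW n0).
have t3 : l ^+ 5 * (rho / m * (l ^+ 2 * (8 / muU * l^-1 ^+ 9) + MV * l^-1 ^+ 6))
    <= 2 * C / muU * (8 / muU + MV) / n.
  have -> : l ^+ 5 * (rho / m * (l ^+ 2 * (8 / muU * l^-1 ^+ 9) + MV * l^-1 ^+ 6)) =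
      rho / m * (8 / muU * l^-1 ^+ 2 + MV * l^-1).
    by field; rewrite ?lN0 ?mN0 ?uN0.
  have -> : 2 * C / muU * (8 / muU + MV) / n = C * (2 / muU / n) * (8 / muU + MV).
    by field; rewrite ?nN0 ?uN0.
  have u8 : 0 <= 8 / muU by rewrite divr_ge0 ?ltW.
  apply: ler_pM.
  - by rewrite mulr_ge0.
  - by apply: addr_ge0; apply: mulr_ge0 => //; rewrite exprn_ge0.
  - exact: ler_pM.
  - by apply: lerD; rewrite ler_piMr// exprn_ile1.
have t4 : l ^+ 5 * `|muV / m - T^-1| <= 2 * muV / muU ^+ 2 / n.
  have -> : muV / m - T^-1 = muV * (muU * n - m) / (m * (muU * n)).
    by rewrite TV; field; rewrite ?nN0 ?mN0 ?uN0.
  have un0 : 0 < muU * n by rewrite mulr_gt0.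
  rewrite normrM normfV (gtr0_norm (mulr_gt0 m0 un0)) normrM (gtr0_norm muV0) distrC.
  have -> : l ^+ 5 * (muV * `|m - muU * n| / (m * (muU * n))) =
     (l ^+ 5 * `|m - muU * n| / n) * (m^-1 * (muV / muU)) by field; rewrite ?nN0 ?mN0 ?uN0.
  have -> : 2 * muV / muU ^+ 2 / n = 1 * (2 / muU / n * (muV / muU)) by field; rewrite ?nN0 ?uN0.
  have v0 : 0 <= muV / muU by rewrite divr_ge0 ?ltW.
  apply: ler_pM.
  - by rewrite !mulr_ge0 ?invr_ge0 ?exprn_ge0 ?(ltW l0) ?(ltW n0).
  - by rewrite mulr_ge0.
  - rewrite ler_pdivrMr// mul1r.
    apply: (@le_trans _ _ (l ^+ 5 * (l^-1 ^+ 12 * n))).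
      by rewrite ler_wpM2l ?exprn_ge0 ?(ltW l0).
    have -> : l ^+ 5 * (l^-1 ^+ 12 * n) = l^-1 ^+ 7 * n by field; rewrite lN0.
    by rewrite ler_piMl ?(ltW n0)// exprn_ile1.
  - by rewrite ler_wpM2r.
have t5 : l ^+ 5 * (MV * l^-1 ^+ 6 / T) <= MV * muV / muU / n.
  have -> : l ^+ 5 * (MV * l^-1 ^+ 6 / T) = l^-1 * (MV * muV / muU / n).
    by rewrite TE; field; rewrite ?lN0 ?nN0 ?uN0 ?vN0.
  by rewrite ler_piMl// !mulr_ge0 ?invr_ge0 ?(ltW muV0) ?(ltW muU0) ?(ltW n0).
by rewrite !mulrDr /drift_const !mulrDl in t3 *; lra.
Qed.

End numeric_step.

Section fresh_ratio.
Context {R : realType}.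
Variables (muU l n m y d u r i : R).
Hypotheses (muU0 : 0 < muU) (l16 : 16 <= l) (lu : 2 / muU <= l) (nl : l ^+ 40 <= n).
Hypotheses (m_ge : muU * n / 2 <= m) (m_near : `|m - muU * n| <= l^-1 ^+ 12 * n).
Hypotheses (y_ge : l^-1 ^+ 3 <= y) (rE : r = m * y).

Lemma unread_ge : 2 * l <= r.
Proof.
have l0 : 0 < l by apply: lt_le_trans l16.
have l1 : 1 <= l by apply: le_trans l16; rewrite ler1n.
have lN0 : l != 0 by rewrite gt_eqF.
have ul : l^-1 <= muU / 2 by rewrite -invf_div lef_pV2// posrE divr_gt0.
rewrite rE; apply: le_trans (_ : l^-1 * n * l^-1 ^+ 3 <= _); last first.
  apply: ler_pM => //.
  - by rewrite mulr_ge0 ?invr_ge0 ?(ltW l0)//; apply: le_trans nl; rewrite exprn_ge0 ?(ltW l0).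
  - by rewrite exprn_ge0 ?invr_ge0 ?(ltW l0).
  - apply: le_trans m_ge; rewrite mulrAC ler_wpM2r//.
    by apply: le_trans nl; rewrite exprn_ge0 ?(ltW l0).
apply: (@le_trans _ _ (l^-1 * l ^+ 40 * l^-1 ^+ 3)); last first.
  by rewrite ler_wpM2r ?exprn_ge0 ?invr_ge0 ?(ltW l0)// ler_wpM2l ?invr_ge0 ?(ltW l0).
have -> : l^-1 * l ^+ 40 * l^-1 ^+ 3 = l ^+ 35 * l by field.
rewrite ler_pM2r//; apply: (@le_trans _ _ (l ^+ 1)); first by have := l16; rewrite expr1; lra.
by rewrite ler_weXn2l.
Qed.

Hypotheses (d0 : 0 <= d) (du : d <= muU) (u0 : 0 <= u) (ur : u <= r) (i0 : 0 <= i) (il : i <= l).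
Hypothesis u_near : `|u - n * (y * d)| <= l^-1 ^+ 12 * n.

(** A deviation l^-12 n of [u], relative to at least m l^-3 unread half-edges, is of order l^-9. The
    deviation of m from muU n and the [i <= l] half-edges read by the current arrival contribute no
    more. *)
Lemma fresh_ratio : `|u / (r - i) - d / muU| <= 8 / muU * l^-1 ^+ 9.
Proof.
have l0 : 0 < l by apply: lt_le_trans l16.
have l1 : 1 <= l by apply: le_trans l16; rewrite ler1n.
have lN0 : l != 0 by rewrite gt_eqF.
have r2 := unread_ge.
have r0 : 0 < r by apply: lt_le_trans r2; rewrite mulr_gt0.
have ri0 : 0 < r - i by have := il; lra.
have n0 : 0 < n by apply: lt_le_trans nl; rewrite exprn_gt0.
have m0 : 0 < m by apply: lt_le_trans m_ge; rewrite divr_gt0 ?mulr_gt0.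
have ile : 0 <= l^-1 by rewrite invr_ge0 ltW.
have y0 : 0 < y by apply: lt_le_trans y_ge; rewrite exprn_gt0 ?invr_gt0.
have nm : n / m <= 2 / muU.
  have -> : 2 / muU = n / (muU * n / 2) by field; rewrite !gt_eqF.
  by rewrite ler_pM2l// lef_pV2// posrE ?divr_gt0 ?mulr_gt0.
have nm0 : 0 <= n / m by rewrite divr_ge0 ?ltW.
have a1 : `|u / (r - i) - u / r| <= 4 / muU * l^-1 ^+ 9.
  have -> : u / (r - i) - u / r = (u / r) * (i / (r - i)) by field; rewrite !gt_eqF.
  have ur1 : u / r <= 1 by rewrite ler_pdivrMr// mul1r.
  have ur0 : 0 <= u / r by rewrite divr_ge0 ?(ltW r0).
  have ii0 : 0 <= i / (r - i) by rewrite divr_ge0 // ltW.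
  rewrite (ger0_norm (mulr_ge0 ur0 ii0)); apply: le_trans (ler_piMl ii0 ur1) _.
  apply: (@le_trans _ _ (2 * l / r)).
    rewrite ler_pdivrMr// mulrAC ler_pdivlMr//.
    have h1 : i * r <= l * r by rewrite ler_wpM2r ?(ltW r0).
    have h2 : l * r <= 2 * l * (r - i).
      rewrite (_ : 2 * l * (r - i) = l * (2 * (r - i))); last by ring.
      by rewrite ler_wpM2l ?(ltW l0)//; have := il; lra.
    exact: le_trans h1 h2.
  apply: (@le_trans _ _ (2 * l / (m * l^-1 ^+ 3))).
    rewrite ler_wpM2l ?mulr_ge0 ?(ltW l0)// lef_pV2 ?posrE// ?mulr_gt0 ?exprn_gt0 ?invr_gt0//.
    by rewrite rE ler_wpM2l ?(ltW m0).
  have -> : 2 * l / (m * l^-1 ^+ 3) = (n / m) * (2 * l ^+ 4 / n) by field; rewrite !gt_eqF.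
  have -> : 4 / muU * l^-1 ^+ 9 = (2 / muU) * (2 * l^-1 ^+ 9) by field; rewrite lN0 gt_eqF.
  apply: ler_pM => //; first by rewrite !mulr_ge0 ?exprn_ge0 ?(ltW l0) ?invr_ge0 ?(ltW n0).
  rewrite -mulrA ler_pM2l// ler_pdivrMr//.
  have -> : l ^+ 4 = l^-1 ^+ 9 * l ^+ 13 by field.
  by rewrite ler_pM2l ?exprn_gt0 ?invr_gt0//; apply: le_trans nl; rewrite ler_weXn2l.
have a2 : `|u / r - d / muU| <= 4 / muU * l^-1 ^+ 9.
  have -> : u / r - d / muU = (u - n * (y * d)) / r + (d / muU) * ((muU * n - m) / m).
    by rewrite rE; field; rewrite !gt_eqF.
  have h1 : `|(u - n * (y * d)) / r| <= 2 / muU * l^-1 ^+ 9.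
    rewrite normrM normfV (gtr0_norm r0) ler_pdivrMr//; apply: le_trans u_near _.
    apply: (@le_trans _ _ (2 / muU * l^-1 ^+ 9 * (m * l^-1 ^+ 3))); last first.
      by rewrite rE ler_wpM2l ?mulr_ge0 ?exprn_ge0 ?(ltW m0)// ?ler_wpM2l ?(ltW m0)// invr_ge0 ltW.
    have -> : 2 / muU * l^-1 ^+ 9 * (m * l^-1 ^+ 3) = l^-1 ^+ 12 * (2 / muU * m).
      by field; rewrite lN0 gt_eqF.
    by rewrite ler_wpM2l ?exprn_ge0// -ler_pdivrMr.
  have h2 : `|d / muU * ((muU * n - m) / m)| <= 2 / muU * l^-1 ^+ 9.
    have d1 : d / muU <= 1 by rewrite ler_pdivrMr// mul1r.
    rewrite normrM ger0_norm ?divr_ge0 ?(ltW muU0)//.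
    apply: le_trans (ler_piMl (normr_ge0 _) d1) _.
    rewrite normrM normfV (gtr0_norm m0) distrC.
    apply: (@le_trans _ _ (l^-1 ^+ 12 * n / m)); first by rewrite ler_wpM2r// invr_ge0 ltW.
    rewrite -mulrA mulrC; apply: ler_pM => //; first by rewrite exprn_ge0.
    by rewrite ler_wiXn2l// invf_le1.
  apply: le_trans (ler_normD _ _) _; have -> : 4 / muU = 2 / muU + 2 / muU :> R by field; rewrite gt_eqF.
  by rewrite [leRHS]mulrDl; apply: lerD.
rewrite -[u / (r - i)](subrK (u / r)) -addrA; apply: le_trans (ler_normD _ _) _.
have -> : 8 / muU = 4 / muU + 4 / muU :> R by field; rewrite gt_eqF.
by rewrite [leRHS]mulrDl; apply: lerD.
Qed.

End fresh_ratio.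

(** * Truncated degrees *)

Section truncated_law.
Context {R : realType} {law : probability nat R} {K mu : R}.
Hypotheses (K0 : 0 < K) (sg : sub_gaussian_with law K) (mE : has_mean law mu).
Hypothesis mu0 : 0 < mu.
Local Notation p := (prob_at law).
Local Notation M := (mom K).
Variable L : nat.
Local Notation l := (L%:R : R).

Lemma sum_prob_at_le1 : \sum_(k < L.+1) p k <= 1.
Proof.
have t1 := tame_const (1 : R).
have tf : tame 1 (fun k => if (k < L.+1)%N then 1 else 0 : R).
  move=> k; case: ifP => _; first by have := t1 k; rewrite !normr1.
  by rewrite normr0 mul1r exprn_ge0.
rewrite -(mean_of1 law); under eq_bigr do rewrite -[p _]mulr1.
rewrite -(mean_of_fin L.+1 (fun=> 1)).
by apply: (le_mean_of K0 sg tf t1) => k; case: ifP.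
Qed.

Lemma sum_prob_at_ge : 1 - 2 * expR (- (L.+1%:R / K) ^+ 2) <= \sum_(k < L.+1) p k.
Proof.
have h := sg (ler0n R L.+1).
pose A := [set k : nat | (L.+1%:R <= k%:R :> R)%R].
have AE : ~` A = \bigcup_(k in `I_L.+1) [set k].
  apply/seteqP; split=> [k|k [j /= jL ->]] /=; last by apply/negP; rewrite -ltNge ltr_nat.
  by move/negP; rewrite -ltNge ltr_nat => kL; exists k.
have s1 : (law (~` A) = (\sum_(k < L.+1) p k)%:E)%E.
  rewrite AE bigcup_mkord measure_bigsetU//=; last by move=> i j _ _ [x [-> ->]].
  rewrite -sumEFin; apply: eq_bigr => k _.
  by rewrite /prob_at fineK// fin_num_measure.
have := probability_setC law (measurableC (I : measurable A)).
rewrite setCK s1 => e; move: h; rewrite -/A e -EFinB lee_fin; lra.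
Qed.

Lemma truncated_mean (A : R) (f : nat -> R) : (0 < L)%N -> 0 <= A ->
  (forall k, `|f k| <= A * k.+1%:R ^+ 2) ->
  `|\sum_(k < L.+1) p k * f k - mean_of law f| <= A * M * l^-1 ^+ 14.
Proof.
move=> L0 A0 fA; rewrite distrC; apply: le_trans (mean_of_tail K0 sg L.+1 fA) _.
rewrite ler_wpM2l ?(mulr_ge0 A0 (mom_ge0 K))// exprVn lef_pV2 ?posrE ?exprn_gt0 ?ltr0n//.
by rewrite lerXn2r ?nnegrE// ler_nat ltnW.
Qed.

(** Here [mu] only bounds the modulus of the mean of [a]; it will be the mean degree plus 1, because
    the statistics are at most 1 + k. The Chernoff parameter is l^-15, and deviations are at most mu
    + l + mu <= 3l. *)
Lemma iid_typical (I : finType) (a : nat -> R) (n : R) : (64 <= L)%N -> mu <= l ->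
  (forall k, `|a k| <= mu + k%:R) -> 0 <= n ->
  `|mean_of law a| <= mu ->
  \sum_(b : {ffun I -> 'I_L.+1}) (\prod_i p (b i)) *
     (l^-1 ^+ 12 * n / 2 < `|\sum_i a (b i) - #|I|%:R * mean_of law a|)%R%:R
  <= 2 * expR (#|I|%:R * (l^-1 ^+ 15 * ((1 + 2 * mu) * M * l^-1 ^+ 14)
                 + 2 * (l^-1 ^+ 15 * (3 * l)) ^+ 2) - l^-1 ^+ 15 * (l^-1 ^+ 12 * n / 2)).
Proof.
move=> L64 muL aB n0 am.
have L0 : (0 < L)%N by exact: leq_trans L64.
have l64 : 64 <= l by rewrite ler_nat.
have l0 : 0 < l by rewrite ltr0n.
have il1 : l^-1 <= 1 by rewrite invf_le1// (le_trans _ l64)// ler1n.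
set al := mean_of law a in am *.
have tB k : `|a k - al| <= (1 + 2 * mu) * k.+1%:R ^+ 2.
  apply: le_trans (ler_normB _ _) _; apply: le_trans (lerD (aB k) am) _.
  have k1 : 1 <= k.+1%:R :> R by rewrite ler1n.
  have k2 : k.+1%:R <= k.+1%:R ^+ 2 :> R by rewrite expr2 ler_peMl.
  have := ler_wpM2l (ltW mu0) (le_trans k1 k2).
  by move: k2; rewrite -natr1; lra.
have ta : tame (1 + 2 * mu) (fun k => a k - al).
  move=> k; apply: le_trans (tB k) _; rewrite ler_wpM2l//; first by have := mu0; lra.
  by rewrite ler_weXn2l// ler1n.
have ta0 : tame (1 + mu) a.
  move=> k; apply: le_trans (aB k) _.
  apply: (@le_trans _ _ ((1 + mu) * k.+1%:R)).
    by have := ler0n R k; have := ltW mu0; rewrite -natr1 => ? ?; nra.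
  rewrite ler_wpM2l//; first by have := mu0; lra.
  by rewrite -[X in X <= _]expr1 ler_weXn2l// ler1n.
apply: (@iid_tail R I p L (prob_at_ge0 law) sum_prob_at_le1 a al (3 * l)) => //.
- move=> k kL; apply: le_trans (ler_normB _ _) _; apply: le_trans (lerD (aB k) am) _.
  have : k%:R <= l by rewrite ler_nat.
  by have := muL; lra.
- have A1 : 0 <= 1 + 2 * mu by have := mu0; lra.
  have := truncated_mean L0 A1 tB.
  rewrite (mean_ofB K0 sg ta0 (tame_const al)) -/al.
  have -> : mean_of law (fun=> al) = al.
    have -> : (fun=> al) = fun k : nat => al * 1 by apply/funext => k; rewrite mulr1.
    by rewrite (mean_ofZ K0 sg _ (tame_const 1)) mean_of1 mulr1.
  by rewrite subrr subr0.
- have -> : l^-1 ^+ 15 * (3 * l) = 3 * l^-1 * l^-1 ^+ 13 by field; rewrite gt_eqF.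
  have h3 : 3 * l^-1 <= 2^-1.
    by rewrite ler_pdivrMr//; lra.
  apply: le_trans h3; rewrite ler_piMr ?mulr_ge0// exprn_ile1//.
Qed.

End truncated_law.

(** * The chain for typical degrees of U *)

Section chain_estimate.
Context {R : realType}.
Variables (piU piV : probability nat R) (KU KV muU muV : R).
Hypotheses (KU0 : 0 < KU) (KV0 : 0 < KV) (muU0 : 0 < muU) (muV0 : 0 < muV).
Hypotheses (sgU : sub_gaussian_with piU KU) (sgV : sub_gaussian_with piV KV).
Hypotheses (mU : has_mean piU muU) (mV : has_mean piV muV).
Local Notation MV := (mom KV).
Local Notation phi := (gen_fun piU).
Local Notation dphi := (@dgen_fun R piU).
Local Notation rho := (slowness piU piV muU muV).
Local Notation C := (slowness_max KV muV).
Local Notation Lp := (slowness_lip KU KV muU muV).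

Variables (F G : R -> R).
Hypothesis F0 : F 0 = 0.
Hypothesis dF : forall x : R, -2 < x -> is_derive x 1 F (rho x).
Hypothesis G01 : forall s : R, 0 <= s <= 1 -> 0 <= G s <= s.
Hypothesis FG : forall s : R, 0 <= s <= 1 -> F (G s) = s.

Definition greedy_limit (s : R) : R := 1 - phi (1 - G s).

Variables (N T L : nat).
Local Notation n := (N%:R : R).
Local Notation l := (L%:R : R).
Hypothesis TE : T%:R = muU / muV * n.
Hypotheses (l16 : 16 <= l) (lu : 2 / muU <= l) (lA : step_size muU muV C <= l).
Hypothesis nl : l ^+ 40 <= n.

(* Up to the horizon a proportion at least l^-3 of the half-edges is unread;
   afterwards the matching grows by at most the number of remaining arrivals. *)
Definition horizon : nat := Num.truncn (T%:R * (1 - 2 * l^-1 ^+ 3)).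

(** The 1 covers the fluctuation l^-12 of the number of unmatched vertices; muU is the Lipschitz
    constant of phi, applied to an error l^-3 on the fraction read. *)
Definition accuracy : R := (1 + muU) * l^-1 ^+ 3.

Definition deviates (t M : nat) : bool :=
  (t <= horizon)%N && (accuracy * n < `|M%:R - n * greedy_limit (t%:R / T%:R)|).

Variables (b : 'I_N -> nat) (e : nat).
Local Notation H := (half_edges (ext_degree b e)).
Local Notation tg := (fun h : H => tag h).
Local Notation m := #|H|.
Local Notation yf X := (@left_frac R H X).
Local Notation rf X := (@read_frac R H X).
Hypothesis bL : forall i, (b i <= L)%N.
Hypothesis m_near : `|m%:R - muU * n| <= l^-1 ^+ 12 * n.

(** All that the chain needs to know about the degrees of U besides their maximum and the number of
    half-edges. Half of the allowed deviation is kept for the random set. *)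
Definition typical_degrees : Prop :=
  forall j, (j <= m)%N -> let y : R := j%:R / m%:R in
    `|\sum_i y ^+ b i - n * phi y| <= l^-1 ^+ 12 * n / 2 /\
    `|\sum_i (b i)%:R * y ^+ b i - n * (y * dphi y)| <= l^-1 ^+ 12 * n / 2.

Hypothesis typ : typical_degrees.

Let C0 : 0 <= C.
Proof. by apply: divr_ge0; [exact: mom_ge0|exact: ltW]. Qed.
Let Lp0 : 0 <= Lp := slowness_lip_ge0 KU KV muU0 muV0.
Let l0 : 0 < l. Proof. by apply: lt_le_trans l16. Qed.
Let l1 : 1 <= l. Proof. by apply: le_trans l16; rewrite ler1n. Qed.
Let n0 : 0 < n. Proof. by apply: lt_le_trans nl; rewrite exprn_gt0. Qed.
Let il0 : 0 < l^-1. Proof. by rewrite invr_gt0. Qed.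
Let il1 : l^-1 <= 1. Proof. by rewrite invf_le1. Qed.
Let T0 : 0 < T%:R :> R. Proof. by rewrite TE mulr_gt0// divr_gt0. Qed.
Let rhoB x : 1 <= rho x <= C.
Proof. exact: slowness_bounds KU0 KV0 muU0 muV0 sgU sgV mU mV x. Qed.
Let rhoL x y : `|rho x - rho y| <= Lp * `|x - y|.
Proof. exact: slowness_lipschitz KU0 KV0 muU0 muV0 sgU sgV mU mV x y. Qed.

Let m_ge : muU * n / 2 <= m%:R.
Proof.
have iu : l^-1 ^+ 12 <= muU / 2.
  apply: le_trans (_ : l^-1 ^+ 1 <= _); first by rewrite ler_wiXn2l// ltW.
  by rewrite expr1 -invf_div lef_pV2// posrE divr_gt0.
have h1 : l^-1 ^+ 12 * n <= muU * n / 2 by rewrite [leRHS]mulrAC ler_wpM2r// ltW.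
by move: m_near; rewrite ler_norml => /andP[h2 _]; lra.
Qed.
Let mR0 : 0 < m%:R :> R.
Proof. by apply: lt_le_trans m_ge; rewrite divr_gt0// mulr_gt0. Qed.
Let m0 : (0 < m)%N. Proof. by move: mR0; rewrite ltr0n. Qed.

Let y01 (X : {set H}) : 0 <= yf X <= 1.
Proof.
apply/andP; split; first by rewrite divr_ge0// ltW.
by rewrite ler_pdivrMr// mul1r ler_nat max_card.
Qed.

Let read_fracE (X : {set H}) : rf X = 1 - yf X. Proof. by []. Qed.
Let g01 (X : {set H}) : 0 <= rf X <= 1.
Proof. by have := y01 X; rewrite read_fracE; lra. Qed.

Let time_le t : (t <= horizon)%N -> t%:R / T%:R <= 1 - 2 * l^-1 ^+ 3.
Proof.
have eps2 : 2 * l^-1 ^+ 3 <= 1.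
  have h : l^-1 ^+ 3 <= l^-1 ^+ 1 by rewrite ler_wiXn2l// ltW.
  have h2 : l^-1 <= 2^-1 by rewrite lef_pV2 ?posrE//; have := l16; lra.
  by move: h; rewrite expr1; lra.
have TT0 : 0 <= T%:R * (1 - 2 * l^-1 ^+ 3) by rewrite mulr_ge0 ?(ltW T0)// subr_ge0.
move=> th; rewrite ler_pdivrMr// mulrC.
by apply: le_trans (_ : horizon%:R <= _); [rewrite ler_nat|by rewrite truncn_le].
Qed.

(** g <= F(g) < t/T + l^-3 <= 1 - l^-3: of the margin 2 l^-3 in [horizon], one half is used by the
    lag and the other remains unread. *)
Let left_ge t (X : {set H}) : (t <= horizon)%N -> `|lag T F t X| < l^-1 ^+ 3 ->
  l^-1 ^+ 3 <= yf X.
Proof.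
move=> th; rewrite /lag ltr_norml => /andP[_ h].
have := time_le th => tl; have /andP[g0 g1] := g01 X.
have m20 : -2 < 0 :> R by lra.
have /andP[h1 _] := potential_incr dF rhoB m20 g0.
by move: h1; rewrite F0 !subr0 read_fracE => h1; move: h; rewrite read_fracE; lra.
Qed.

Let typical_limit t (X : {set H}) : (t <= horizon)%N ->
  ~~ atypical tg (is_real (N := N)) (fun y => n * phi y) (fun y => n * (y * dphi y))
     (l^-1 ^+ 12 * n) X ->
  `|lag T F t X| < l^-1 ^+ 3 -> ~~ deviates t #|seen_of tg (is_real (N := N)) X|.
Proof.
move=> th; rewrite negb_or => /andP[hX _] hl; rewrite negb_and; apply/orP; right.
rewrite -!leNgt in hX *.
have cE := card_seen_of tg (is_real (N := N)) X; rewrite card_is_real in cE.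
have -> : #|seen_of tg (is_real (N := N)) X|%:R = n - (nintact tg (is_real (N := N)) X)%:R :> R.
  by rewrite -[in n]cE natrD addrK.
have s01 : 0 <= (t%:R / T%:R : R) <= 1.
  have h1 := time_le th; have h2 : 0 <= l^-1 ^+ 3 by rewrite exprn_ge0// ltW.
  have h3 : 0 <= t%:R / T%:R :> R by rewrite divr_ge0// ltW.
  lra.
have Gs := G01 s01; have FGs := FG s01; set s := t%:R / T%:R in s01 Gs FGs hl *.
have z01 : 0 <= 1 - G s <= 1 by lra.
have lip := gen_fun_lipschitz KU0 sgU mU (y01 X) z01.
have gG : `|yf X - (1 - G s)| <= l^-1 ^+ 3.
  have -> : yf X - (1 - G s) = - (rf X - G s) by rewrite read_fracE; ring.
  have g2 : -2 < rf X by have := g01 X; lra.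
  have G2 : -2 < G s by lra.
  rewrite normrN; apply: le_trans (potential_dist dF rhoB g2 G2) _.
  by rewrite FGs ltW.
have -> : n - (nintact tg (is_real (N := N)) X)%:R - n * greedy_limit s =
  - ((nintact tg (is_real (N := N)) X)%:R - n * phi (yf X))
  - n * (phi (yf X) - phi (1 - G s)) by rewrite /greedy_limit; ring.
apply: le_trans (ler_normB _ _) _; rewrite normrN normrM (gtr0_norm n0).
rewrite /accuracy mulrDl mul1r mulrDl; apply: lerD.
  by apply: le_trans hX _; rewrite ler_wpM2r ?(ltW n0)// ler_wiXn2l// ltW.
rewrite mulrC ler_wpM2r ?(ltW n0)//; apply: le_trans lip _.
by rewrite ler_wpM2l// ltW.
Qed.

Let P_le1 : \sum_(k < L.+1) prob_at piV k <= 1.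
Proof. exact: sum_prob_at_le1 KV0 sgV L. Qed.

Let tail_small A (f : nat -> R) : 0 <= A -> (forall k, `|f k| <= A * k.+1%:R ^+ 2) ->
  `|\sum_(k < L.+1) prob_at piV k * f k - mean_of piV f| <= A * MV * l^-1 ^+ 6.
Proof.
move=> A0 fA; have L0 : (0 < L)%N by rewrite -(ltr_nat R).
apply: le_trans (truncated_mean KV0 sgV L0 A0 fA) _.
by rewrite ler_wpM2l ?(mulr_ge0 A0 (mom_ge0 KV))// ler_wiXn2l// ltW.
Qed.

(** The barrier has lambda = l^5 and eps = l^-3, whose product is l^2; the Chernoff parameter for
    the atypical sets is l^-15. *)
Lemma chain_estimate :
  wsum (prob_at piV) L T (fun ds => lazy_hit tg (is_real (N := N)) deviates ds 0 finset.setT)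
  <= m.+1%:R ^+ 2 * (4 * expR (N.+1%:R * (2 * (l^-1 ^+ 15 * l) ^+ 2)
                              - l^-1 ^+ 15 * (l^-1 ^+ 12 * n - l^-1 ^+ 12 * n / 2)))
     + 2 * expR (drift_const muU muV C Lp MV / n * horizon%:R - l ^+ 5 * l^-1 ^+ 3).
Proof.
pose Bad := @atypical R H _ tg (is_real (N := N)) (fun y => n * phi y) (fun y => n * (y * dphi y))
  (l^-1 ^+ 12 * n).
have A0 : 0 <= drift_const muU muV C Lp MV.
  by apply: drift_const_ge0 => //; exact: mom_ge0.
apply: le_trans (@chain_bound R H _ tg (is_real (N := N)) (prob_at piV) L T F
  (@prob_at_ge0 R piV) P_le1 deviates Bad horizon (l ^+ 5) (l^-1 ^+ 3)
  (drift_const muU muV C Lp MV / n) m0 _ _ F0 _ typical_limit _) _.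
- by rewrite divr_ge0 ?(ltW n0).
- by rewrite exprn_ge0 ?(ltW l0).
- by move=> t M /andP[].
- move=> t X s /ltnW th nB hl sl.
  have yX := y01 X; have gX := g01 X; have yge := left_ge th hl.
  have rE : #|X|%:R = m%:R * yf X by rewrite /left_frac mulrCA divff ?mulr1// gt_eqF.
  have r2 := unread_ge muU0 l16 lu nl m_ge yge rE.
  have LX : (L < #|X|)%N by rewrite -(ltr_nat R); apply: lt_le_trans r2; have := l0; lra.
  have g2 : -2 < rf X by lra.
  have zE : 1 - rf X = yf X by rewrite read_fracE; ring.
  have x01 := hit_prob01 KU0 muU0 sgU mU yX.
  have rhoX := rhoB (rf X).
  apply: (@one_step R H _ tg (is_real (N := N)) (prob_at piV) L T F (@prob_at_ge0 R piV) P_le1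
    C Lp (rho (rf X)) (hit_prob piU muU (yf X))
    (@mean_reads R piV (hit_prob piU muU (yf X))) muV (8 / muU * l^-1 ^+ 9)
    (MV * l^-1 ^+ 6) (MV * l^-1 ^+ 6) (l ^+ 5)) => //.
  + by move=> h gh; exact: (potential_incr dF rhoB g2 gh).
  + by move=> h gh; exact: (potential_taylor dF rhoL g2 gh).
  + by lra.
  + by rewrite -zE; apply: (slownessE KU0 KV0 muU0 muV0 sgU sgV mU mV).
  + move=> i iL; rewrite natrB; last by rewrite ltnW// (ltn_trans iL).
    apply: (@fresh_ratio R muU l n m%:R (yf X) (dphi (yf X))) => //.
    * exact: (dgen_fun_ge0 KU0 sgU).
    * exact: (dgen_fun_le KU0 sgU mU).
    * rewrite ler_nat; apply: subset_leq_card; apply/fintype.subsetP => h.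
      by rewrite inE => /andP[].
    * by rewrite ler_nat ltnW.
    * by move: nB; rewrite /Bad negb_or -!leNgt => /andP[].
  + by rewrite mulr_ge0 ?exprn_ge0 ?divr_ge0 ?(ltW muU0) ?(ltW il0).
  + rewrite -[MV]mul1r; apply: tail_small => // k.
    rewrite ger0_norm ?mean_read_ge0// mul1r; apply: le_trans (mean_read_le k x01) _.
    by rewrite -natrX ler_nat -mulnn (leq_trans (leqnSn k))// leq_pmull.
  + have := @tail_small 1 (fun=> 1) ler01 => h.
    have {}h : `|\sum_(k < L.+1) prob_at piV k - 1| <= MV * l^-1 ^+ 6.
      rewrite -[MV]mul1r; apply: le_trans (h _) => [|k]; last first.
        by rewrite normr1 mul1r exprn_ege1// ler1n.
      by rewrite mean_of1; under [in leRHS]eq_bigr do rewrite mulr1.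
    by move: h; rewrite ler_norml => /andP[h _]; lra.
  + exact: (lag_step_small muU0 muV0 C0 l16 nl m_ge TE lA).
  + apply: drift_bound => //; first exact: mom_ge0.
    * by lra.
    * by case/andP: rhoX.
apply: lerD => //.
have := @sum_avg_atypical R H _ tg (is_real (N := N)) (fun y => n * phi y) (fun y => n * (y * dphi y))
  (l^-1 ^+ 12 * n) L (l^-1 ^+ 12 * n / 2) (l^-1 ^+ 15) m0.
rewrite card_ord; apply.
- by rewrite -(ltr_nat R).
- move=> u ru; rewrite multiplicity_half_edges /ext_degree.
  by case: unliftP ru => [j _ _|->]; [exact: bL|rewrite /is_real eqxx].
- move=> j jm; rewrite sum_is_real; under eq_bigr do rewrite multiplicity_half_edges /ext_degree liftK.
  by have [] := typ jm.
- move=> j jm; rewrite sum_is_real; under eq_bigr do rewrite multiplicity_half_edges /ext_degree liftK.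
  by have [] := typ jm.
- by rewrite exprn_ge0// ltW.
- rewrite -[X in _ * X]invrK exprSr mulfK ?gt_eqF//.
  apply: le_trans (_ : l^-1 ^+ 1 <= _); first by rewrite ler_wiXn2l// ltW.
  by rewrite expr1 lef_pV2 ?posrE//; have := l16; lra.
Qed.

End chain_estimate.

(** * Union bounds over truncated degrees *)

Section wsum_ffun.
Context {R : realFieldType}.
Variables (p : nat -> R) (L : nat).

Lemma wsum_tuple n (F : seq nat -> R) :
  \sum_(t : n.-tuple 'I_L.+1) (\prod_(i < n) p (tnth t i)) * F (map val t) = wsum p L n F.
Proof.
elim: n F => [|n IH] F.
  rewrite (big_pred1 [tuple]); last by move=> t; apply/esym/eqP; exact: tuple0.
  by rewrite big_ord0 mul1r.
rewrite sum_tupleS /=; apply: eq_bigr => k _; rewrite -IH mulr_sumr.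
apply: eq_bigr => t _; rewrite big_ord_recl -mulrA; congr (_ * (_ * _)).
by apply: eq_bigr => i _; rewrite tnthS.
Qed.

Lemma wsum_ffun n (F : seq nat -> R) :
  \sum_(b : {ffun 'I_n -> 'I_L.+1}) (\prod_i p (b i)) * F [seq (b j : nat) | j <- enum 'I_n]
  = wsum p L n F.
Proof.
rewrite -wsum_tuple (reindex (fun t : n.-tuple 'I_L.+1 => [ffun i => tnth t i])) /=; last first.
  exists (fun b : {ffun 'I_n -> 'I_L.+1} => [tuple b i | i < n]) => [t|b] _.
    by apply: eq_from_tnth => i; rewrite tnth_mktuple ffunE.
  by apply/ffunP => i; rewrite ffunE tnth_mktuple.
apply: eq_bigr => t _; congr (_ * _); first by apply: eq_bigr => i _; rewrite ffunE.
congr F; rewrite -[in RHS](map_tnth_enum t) -map_comp; apply: eq_map => i /=.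
by rewrite ffunE.
Qed.

End wsum_ffun.

Section truncated_degrees.
Context {R : realType} (N T L : nat).
Variables (piU piV : probability nat R).
Local Notation trU := {ffun 'I_N -> 'I_L.+1}.
Local Notation trV := {ffun 'I_T -> 'I_L.+1}.

Definition trunc_degrees (b : trU * trV) : degrees N T :=
  ([ffun i => b.1 i : nat], [ffun j => b.2 j : nat]).

Definition trunc_weight (b : trU * trV) : R :=
  (\prod_i prob_at piU (b.1 i)) * (\prod_j prob_at piV (b.2 j)).

Lemma trunc_weightE b : degrees_weight piU piV (trunc_degrees b) = trunc_weight b.
Proof.
by rewrite /degrees_weight; congr (_ * _); apply: eq_bigr => i _; rewrite ffunE.
Qed.

Lemma trunc_weight_ge0 b : 0 <= trunc_weight b.
Proof. by rewrite -trunc_weightE degrees_weight_ge0. Qed.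

Lemma sum_trunc_weight (fU : trU -> R) (fV : trV -> R) :
  \sum_b trunc_weight b * (fU b.1 * fV b.2) =
  (\sum_(b : trU) (\prod_i prob_at piU (b i)) * fU b) *
  (\sum_(b : trV) (\prod_j prob_at piV (b j)) * fV b).
Proof.
rewrite big_distrlr pair_bigA /=; apply: eq_bigr => b _.
by rewrite /trunc_weight mulrACA.
Qed.

Lemma sum_ffun_weight (p : nat -> R) n :
  \sum_(b : {ffun 'I_n -> 'I_L.+1}) \prod_i p (b i) = (\sum_(k < L.+1) p k) ^+ n.
Proof.
rewrite -(bigA_distr_bigA (fun (i : 'I_n) (k : 'I_L.+1) => p k)) prodr_const.
by rewrite card_ord.
Qed.

(** Outside the events [evU] and [evV], the failure is [Q e] for the one value of [e] given by both
    degree sequences. It is bounded by the sum over all [e], because for [e] fixed the degrees of V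
    are still independent of the event [good e] on U. *)
Lemma trunc_union (I E : finType) (h : trU * trV -> R) (evU : I -> pred trU) (evV : pred trV)
    (good : E -> pred trU) (Q : E -> trU -> trV -> R) (tU tV q : R) :
  \sum_(k < L.+1) prob_at piU k <= 1 -> \sum_(k < L.+1) prob_at piV k <= 1 ->
  (forall b, h b <= \sum_i (evU i b.1)%:R + (evV b.2)%:R + \sum_e (good e b.1)%:R * Q e b.1 b.2) ->
  (forall i, \sum_(b : trU) (\prod_i prob_at piU (b i)) * (evU i b)%:R <= tU) ->
  \sum_(b : trV) (\prod_j prob_at piV (b j)) * (evV b)%:R <= tV ->
  (forall e a, good e a -> \sum_(b : trV) (\prod_j prob_at piV (b j)) * Q e a b <= q) -> 0 <= q ->
  \sum_b trunc_weight b * h b <= #|I|%:R * tU + tV + #|E|%:R * q.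
Proof.
move=> pU pV hb hU hV hq q0.
have P0 (law : probability nat R) n (b : {ffun 'I_n -> 'I_L.+1}) : 0 <= \prod_i prob_at law (b i).
  by apply: prodr_ge0 => i _; exact: prob_at_ge0.
have S1 (law : probability nat R) n : \sum_(k < L.+1) prob_at law k <= 1 ->
    \sum_(b : {ffun 'I_n -> 'I_L.+1}) \prod_i prob_at law (b i) <= 1.
  move=> h1; rewrite sum_ffun_weight exprn_ile1// sumr_ge0// => k _; exact: prob_at_ge0.
have S0 (law : probability nat R) n (f : {ffun 'I_n -> 'I_L.+1} -> bool) :
    0 <= \sum_(b : {ffun 'I_n -> 'I_L.+1}) (\prod_i prob_at law (b i)) * (f b)%:R.
  by apply: sumr_ge0 => b _; rewrite mulr_ge0.
apply: le_trans (ler_sum _ (fun b _ => ler_wpM2l (trunc_weight_ge0 b) (hb b))) _.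
under eq_bigr do rewrite !mulrDr !mulr_sumr.
rewrite !big_split /= exchange_big /=; apply: lerD; [apply: lerD|].
- rewrite mulr_natl -sumr_const; apply: ler_sum => i _.
  under eq_bigr do rewrite -[(evU i _)%:R]mulr1.
  rewrite (sum_trunc_weight (fun b => (evU i b)%:R) (fun=> 1)).
  under [X in _ * X]eq_bigr do rewrite mulr1.
  by apply: le_trans (hU i); rewrite ler_piMr ?S1.
- under eq_bigr do rewrite -[(evV _)%:R]mul1r.
  rewrite (sum_trunc_weight (fun=> 1) (fun b => (evV b)%:R)).
  under [X in X * _]eq_bigr do rewrite mulr1.
  by apply: le_trans hV; rewrite ler_piMl ?S1.
- rewrite exchange_big /= mulr_natl -sumr_const; apply: ler_sum => e _.
  rewrite -(pair_bigA _ (fun a b => trunc_weight (a, b) * ((good e a)%:R * Q e a b))) /=.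
  apply: le_trans (_ : \sum_(a : trU) (\prod_i prob_at piU (a i)) * q <= _); last first.
    by rewrite -mulr_suml ler_piMl ?S1.
  apply: ler_sum => a _; rewrite /trunc_weight /=.
  under eq_bigr do rewrite -mulrA.
  rewrite -mulr_sumr; apply: ler_wpM2l; first exact: P0.
  case: (boolP (good e a)) => ga.
    by under eq_bigr do rewrite mul1r; exact: hq.
  by rewrite big1// => b _; rewrite mul0r mulr0.
Qed.

End truncated_degrees.

Lemma lazy_hit_ge0 {R : realFieldType} {H U : finType} (tg : H -> U) (real : pred U) bad ds t X :
  0 <= @lazy_hit R H U tg real bad ds t X.
Proof.
elim: ds t X => [|d ds IH] t X /=; case: ifP => // _.
by rewrite -[leLHS](@arrival0 R H U tg real d X); apply: le_arrival.
Qed.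

Lemma mean_of_affine_bound {R : realType} {law : probability nat R} {K mu : R} (a : nat -> R) :
  0 < K -> sub_gaussian_with law K -> has_mean law mu ->
  (forall k, 0 <= a k <= 1 + k%:R) -> `|mean_of law a| <= mu + 1.
Proof.
move=> K0 sg mE ha.
have t1 := tame_const (1 : R); have t0 := tame_const (0 : R); have ti := @tame_id R.
have t2 : tame 2 (fun k => 1 + k%:R : R).
  move=> k; rewrite ger0_norm ?addr_ge0//.
  have k1 : 1 <= k.+1%:R :> R by rewrite ler1n.
  have := @ler_weXn2l _ _ k1 1 16 isT; rewrite expr1 -natr1 => k2.
  by have := ler0n R k; lra.
have ta : tame 2 a.
  by move=> k; apply: le_trans (t2 k); rewrite !ger0_norm ?addr_ge0//; case/andP: (ha k).
have m0 : mean_of law (fun=> 0) = 0.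
  rewrite -[RHS](mul0r (mean_of law (fun=> 1))) -(mean_ofZ K0 sg 0 t1); congr mean_of.
  by apply/funext => k; rewrite mul0r.
rewrite ger0_norm; last first.
  by rewrite -m0; apply: (le_mean_of K0 sg t0 ta) => k; case/andP: (ha k).
apply: le_trans (le_mean_of K0 sg ta t2 _) _ => [k|]; first by case/andP: (ha k).
by rewrite (mean_ofD K0 sg t1 ti) mean_of1 (mean_of_id mE) addrC.
Qed.

Section failure_estimate.
Context {R : realType}.
Variables (piU piV : probability nat R) (KU KV muU muV : R).
Hypotheses (KU0 : 0 < KU) (KV0 : 0 < KV) (muU0 : 0 < muU) (muV0 : 0 < muV).
Hypotheses (sgU : sub_gaussian_with piU KU) (sgV : sub_gaussian_with piV KV).
Hypotheses (mU : has_mean piU muU) (mV : has_mean piV muV).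
Local Notation C := (slowness_max KV muV).
Local Notation Lp := (slowness_lip KU KV muU muV).
Variables (F G : R -> R).
Hypothesis F0 : F 0 = 0.
Hypothesis dF : forall x : R, -2 < x -> is_derive x 1 F (slowness piU piV muU muV x).
Hypothesis G01 : forall s : R, 0 <= s <= 1 -> 0 <= G s <= s.
Hypothesis FG : forall s : R, 0 <= s <= 1 -> F (G s) = s.
Variables (N T L : nat).
Local Notation n := (N%:R : R).
Local Notation l := (L%:R : R).
Hypothesis TE : T%:R = muU / muV * n.
Hypotheses (L64 : (64 <= L)%N) (lu : 2 / muU <= l) (lA : step_size muU muV C <= l).
Hypotheses (uL : muU + 1 <= l) (vL : muV + 1 <= l).
Hypothesis nl : l ^+ 40 <= n.

Local Notation trU := {ffun 'I_N -> 'I_L.+1}.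
Local Notation trV := {ffun 'I_T -> 'I_L.+1}.
Local Notation dev := (deviates piU muU G N T L).

Definition degree_tail (I : nat) (mu M : R) : R :=
  2 * expR (I%:R * (l^-1 ^+ 15 * ((1 + 2 * (mu + 1)) * M * l^-1 ^+ 14)
                 + 2 * (l^-1 ^+ 15 * (3 * l)) ^+ 2) - l^-1 ^+ 15 * (l^-1 ^+ 12 * n / 2)).

Definition chain_tail : R :=
  (L * (N + T)).+1%:R ^+ 2 * (4 * expR (N.+1%:R * (2 * (l^-1 ^+ 15 * l) ^+ 2)
                              - l^-1 ^+ 15 * (l^-1 ^+ 12 * n - l^-1 ^+ 12 * n / 2)))
     + 2 * expR (drift_const muU muV C Lp (mom KV) / n * (@horizon R T L)%:R - l ^+ 5 * l^-1 ^+ 3).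

Definition failure_bound : R :=
  (2 * (L * (N + T)).+1 ^ 2).+1%:R * degree_tail N muU (mom KU) + degree_tail T muV (mom KV)
  + (L * T).+1%:R * chain_tail.

Let Mx := (L * (N + T))%N.

Let untrunc (b : trU) : {ffun 'I_N -> nat} := [ffun i => b i : nat].

(** The pair (m, j) stands for the fraction j/m, and 0 replaces it when j > m. Since m is not
    determined by U alone, all pairs up to [Mx], a bound for m, are taken. *)
Let frac (i : 'I_Mx.+1 * 'I_Mx.+1) : R := if (i.2 <= i.1)%N then i.2%:R / i.1%:R else 0.

Let stat (i : option ('I_Mx.+1 * 'I_Mx.+1 * bool)) (k : nat) : R :=
  match i with
  | None => k%:R
  | Some (c, false) => frac c ^+ k
  | Some (c, true) => k%:R * frac c ^+ k
  end.

Let frac01 i : 0 <= frac i <= 1.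
Proof.
rewrite /frac; case: ifP => [h|_]; last by rewrite lexx ler01.
rewrite divr_ge0//=; have [->|i0] := posnP i.1; first by rewrite invr0 mulr0 ler01.
by rewrite ler_pdivrMr ?ltr0n// mul1r ler_nat.
Qed.

Let stat_bound i k : 0 <= stat i k <= 1 + k%:R.
Proof.
have k0 := ler0n R k; case: i => [[c []]|] /=; last by rewrite k0 lerDr ler01.
  have /andP[f0 f1] := frac01 c.
  rewrite mulr_ge0 ?exprn_ge0//=; apply: (@le_trans _ _ k%:R); last by rewrite lerDr.
  by rewrite ler_piMr// exprn_ile1.
have /andP[f0 f1] := frac01 c.
by rewrite exprn_ge0//=; apply: (@le_trans _ _ 1); rewrite ?exprn_ile1// lerDl.
Qed.

Let evU i (b : trU) : bool :=
  l^-1 ^+ 12 * n / 2 < `|\sum_j stat i (b j) - #|'I_N|%:R * mean_of piU (stat i)|.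
Let evV (b : trV) : bool :=
  l^-1 ^+ 12 * n / 2 < `|\sum_j (b j)%:R - #|'I_T|%:R * mean_of piV (fun k => k%:R)|.

Let good (e : 'I_(L * T).+1) (b : trU) : bool :=
  `[< `|#|half_edges (ext_degree (untrunc b) e)|%:R - muU * n| <= l^-1 ^+ 12 * n /\
      typical_degrees piU L (untrunc b) e >].

Let Q (e : 'I_(L * T).+1) (b : trU) (b' : trV) : R :=
  lazy_hit (fun h : half_edges (ext_degree (untrunc b) e) => tag h) (is_real (N := N)) dev
    [seq b' j : nat | j <- enum 'I_T] 0 finset.setT.

Let fail (b : trU * trV) : R :=
  \sum_(r : run_type (trunc_degrees b)) cond_weight R r *
      [exists t : 'I_T.+1, dev t #|matching_of (take t r.2)|]%:R.

Let failE (b : trU * trV) (e : 'I_(L * T).+1) : (e = \sum_j b.2 j - \sum_i b.1 i :> nat)%N ->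
  fail b = Q e b.1 b.2.
Proof.
move=> eE; rewrite /fail sum_cond_weight_hit /Q.
have -> : nat_of_ord e = (\sum_j (trunc_degrees b).2 j - \sum_j (trunc_degrees b).1 j)%N.
  by rewrite eE; congr (_ - _)%N; apply: eq_bigr => i _; rewrite ffunE.
have -> : [seq (b.2 j : nat) | j <- enum 'I_T] = [seq (trunc_degrees b).2 j | j <- enum 'I_T].
  by apply: eq_map => j; rewrite ffunE.
by [].
Qed.

Let n0 : 0 <= n. Proof. exact: ler0n. Qed.
Let il0 : 0 <= l^-1 ^+ 12 * n. Proof. by rewrite mulr_ge0 ?exprn_ge0 ?invr_ge0 ?ler0n. Qed.

Let sum_le (k : nat) (b : {ffun 'I_k -> 'I_L.+1}) : (\sum_j b j <= L * k)%N.
Proof.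
apply: leq_trans (_ : \sum_(j < k) L <= _)%N; last by rewrite sum_nat_const card_ord mulnC.
by apply: leq_sum => j _; rewrite -ltnS.
Qed.

Let fail_le1 b : fail b <= 1.
Proof.
rewrite -[leRHS](sum_cond_weight R (trunc_degrees b)); apply: ler_sum => r _.
by rewrite ler_piMr ?cond_weight_ge0// lern1 leq_b1.
Qed.

(** The number m of half-edges is the larger of the two degree sums, both close to muU n as T muV =
    muU n; the conditions at y = j/m are those of [evU] at the pair (m, j). *)
Let not_good (b : trU * trV) (e : 'I_(L * T).+1) : (e = \sum_j b.2 j - \sum_i b.1 i :> nat)%N ->
  ~~ evV b.2 -> (forall i, ~~ evU i b.1) -> good e b.1.
Proof.
move=> eE nV nU.
have sE : (\sum_i (untrunc b.1) i = \sum_i b.1 i)%N by apply: eq_bigr => i _; rewrite ffunE.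
have HE : #|half_edges (ext_degree (untrunc b.1) e)| = maxn (\sum_i b.1 i) (\sum_j b.2 j).
  by rewrite card_half_edges sE eE maxnE.
apply/asboolP; split.
  have hV := nV; rewrite /evV (mean_of_id mV) card_ord TE -natr_sum -leNgt in hV.
  have hU := nU None; rewrite /evU /= (mean_of_id mU) card_ord -natr_sum -leNgt in hU.
  have TV : muU / muV * n * muV = muU * n by field; rewrite gt_eqF.
  rewrite TV in hV; rewrite HE [muU * n]mulrC; rewrite [muU * n]mulrC in hV.
  have h0 := il0; rewrite /maxn; case: ifP => _; [apply: le_trans hV _|apply: le_trans hU _]; lra.
move=> j; rewrite HE => jm y.
have mM : (maxn (\sum_i b.1 i) (\sum_j b.2 j) < Mx.+1)%N.
  by rewrite ltnS geq_max /Mx mulnDr !(leq_trans (sum_le _))// ?leq_addr ?leq_addl.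
have jM : (j < Mx.+1)%N by exact: leq_ltn_trans mM.
pose c : 'I_Mx.+1 * 'I_Mx.+1 := (Ordinal mM, Ordinal jM).
have fE : frac c = y by rewrite /frac /= jm.
have y01 : 0 <= y <= 1 by rewrite -fE frac01.
have h1 := nU (Some (c, false)); have h2 := nU (Some (c, true)).
rewrite /evU /= fE card_ord -leNgt in h1; rewrite /evU /= fE card_ord -leNgt in h2.
have m2 : mean_of piU (fun k => k%:R * y ^+ k) = y * @dgen_fun R piU y.
  rewrite /dgen_fun -(mean_ofZ KU0 sgU y (tame_dpow y01)); congr mean_of; apply/funext => k.
  by case: k => [|k] /=; rewrite ?mul0r ?mulr0// exprS mulrCA.
have e1 : \sum_i y ^+ (untrunc b.1) i = \sum_i y ^+ b.1 i by apply: eq_bigr => i _; rewrite ffunE.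
have e2 : \sum_i ((untrunc b.1) i)%:R * y ^+ (untrunc b.1) i = \sum_i (b.1 i)%:R * y ^+ b.1 i.
  by apply: eq_bigr => i _; rewrite ffunE.
have s1 : stat (Some (c, false)) = fun k => y ^+ k by rewrite -fE.
have s2 : stat (Some (c, true)) = fun k => k%:R * y ^+ k by rewrite -fE.
rewrite s1 in h1; rewrite s2 in h2.
by rewrite -m2 e1 e2; split; [exact: h1|exact: h2].
Qed.

Let chain_tail_ge0 : 0 <= chain_tail.
Proof. by rewrite addr_ge0// !mulr_ge0 ?exprn_ge0 ?expR_ge0. Qed.

Lemma failure_estimate : \sum_b trunc_weight piU piV b * fail b <= failure_bound.
Proof.
have LE : (2 * (L * (N + T)).+1 ^ 2).+1 = #|{: option ('I_Mx.+1 * 'I_Mx.+1 * bool)}|.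
  by rewrite card_option !card_prod !card_ord card_bool mulnC mulnn.
rewrite /failure_bound LE -(card_ord (L * T).+1).
apply: (@trunc_union R N T L piU piV _ _ fail evU evV good Q).
- exact: sum_prob_at_le1 sgU L.
- exact: sum_prob_at_le1 sgV L.
- move=> b.
  have sT : (\sum_j b.2 j - \sum_i b.1 i < (L * T).+1)%N.
    by rewrite ltnS (leq_trans (leq_subr _ _))// sum_le.
  have Q0 e : 0 <= (good e b.1)%:R * Q e b.1 b.2.
    rewrite mulr_ge0//; exact: lazy_hit_ge0.
  have i0 : 0 <= \sum_i (evU i b.1)%:R + (evV b.2)%:R :> R.
    by rewrite addr_ge0// sumr_ge0.
  case: (boolP (evV b.2)) => [hV|nV].
    apply: le_trans (fail_le1 b) _; rewrite -addrA addrC -addrA lerDl addr_ge0// sumr_ge0//.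
  case: (boolP [exists i, evU i b.1]) => [/existsP[i hi]|].
    apply: le_trans (fail_le1 b) _; rewrite (bigD1 i)//= hi -!addrA lerDl !addr_ge0// sumr_ge0//.
  (* All degrees are typical, so the failure is the summand of the actual excess. *)
  rewrite negb_exists => /forallP nU.
  have g := @not_good b (Ordinal sT) erefl nV nU.
  rewrite (@failE b (Ordinal sT))// (bigD1 (Ordinal sT) isT) /= g mul1r addrCA lerDl.
  by rewrite addr_ge0// ?sumr_ge0// addr_ge0// sumr_ge0.
- move=> i; have u1 : 0 < muU + 1 by have := muU0; lra.
  apply: le_trans (iid_typical KU0 sgU u1 'I_N L64 uL _ n0 _) _.
  + by move=> k; have /andP[h1 h2] := stat_bound i k; rewrite ger0_norm//; have := muU0; lra.
  + exact: mean_of_affine_bound KU0 sgU mU (stat_bound i).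
  + by rewrite card_ord.
- have v1 : 0 < muV + 1 by have := muV0; lra.
  apply: le_trans (iid_typical KV0 sgV v1 'I_T L64 vL _ n0 _) _.
  + by move=> k; rewrite ger0_norm//; have := muV0; lra.
  + by apply: mean_of_affine_bound KV0 sgV mV _ => k; rewrite ler0n lerDr ler01.
  + by rewrite card_ord.
- move=> e a /asboolP[mn typ].
  rewrite (@wsum_ffun R (prob_at piV) L T (fun ds => lazy_hit
    (fun h : half_edges (ext_degree (untrunc a) e) => tag h) (is_real (N := N)) dev ds 0 finset.setT)).
  apply: le_trans (chain_estimate KU0 KV0 muU0 muV0 sgU sgV mU mV F0 dF G01 FG TE _ lu lA nl _ mn typ) _.
  + by rewrite ler_nat (leq_trans _ L64).
  + by move=> i; rewrite ffunE -ltnS.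
  rewrite /chain_tail lerD2r ler_wpM2r ?mulr_ge0 ?expR_ge0// lerXn2r ?nnegrE// ler_nat ltnS.
  rewrite card_half_edges mulnDr leq_add//; last by rewrite -ltnS.
  by under eq_bigr do rewrite ffunE; exact: sum_le.
- exact: chain_tail_ge0.
Qed.

End failure_estimate.

(** * Size of the failure probability *)

Section failure_bound_small.
Context {R : realType}.
Variables (KU KV muU muV : R).
Hypotheses (KU0 : 0 < KU) (KV0 : 0 < KV) (muU0 : 0 < muU) (muV0 : 0 < muV).
Variables (N T L : nat).
Local Notation n := (N%:R : R).
Local Notation l := (L%:R : R).
Local Notation r := (muU / muV).
Local Notation D := (drift_const muU muV (slowness_max KV muV) (slowness_lip KU KV muU muV) (mom KV)).
Hypothesis TE : T%:R = r * n.
Hypotheses (l300 : 300 <= l) (nl : l ^+ 40 <= n) (nu : n <= (2 * l) ^+ 40).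
Hypotheses (rl : 1 + r <= l) (Dl : r * D <= l).

Let l0 : 0 < l. Proof. by apply: lt_le_trans l300; rewrite ltr0n. Qed.
Let l1 : 1 <= l. Proof. by apply: le_trans l300; rewrite ler1n. Qed.
Let n1 : 1 <= n. Proof. by apply: le_trans nl; rewrite exprn_ege1. Qed.
Let n0 : 0 < n. Proof. by apply: lt_le_trans n1. Qed.
Let r0 : 0 < r. Proof. by rewrite divr_gt0. Qed.

Let main_exponent : l ^+ 2 <= l^-1 ^+ 27 * n / 4.
Proof.
rewrite ler_pdivlMr//; apply: (@le_trans _ _ (l^-1 ^+ 27 * l ^+ 40)); last first.
  by rewrite ler_wpM2l// exprn_ge0// invr_ge0 ltW.
have -> : l^-1 ^+ 27 * l ^+ 40 = l ^+ 2 * l ^+ 11 by field; rewrite gt_eqF.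
rewrite ler_wpM2l ?exprn_ge0 ?(ltW l0)//.
by have := @ler_weXn2l _ _ l1 1 11 isT; rewrite expr1; have := l300; lra.
Qed.

(** The Chernoff cost is O(l^-28 n), one power of l below the gain l^-27 n/2; the last hypothesis
    makes it at most a quarter of the gain. *)
Lemma degree_tail_le (I : nat) (q mu M : R) : 0 <= q -> I%:R <= q * n -> 0 <= M -> 0 <= mu ->
  8 * q * ((1 + 2 * (mu + 1)) * M + 18) <= l ->
  degree_tail N L I mu M <= 2 * expR (- l ^+ 2).
Proof.
move=> q0 Iq M0 mu0 ql; rewrite /degree_tail ler_wpM2l// ler_expR.
set c := (1 + 2 * (mu + 1)) * M in ql *.
have c0 : 0 <= c by rewrite mulr_ge0//; lra.
clearbody c.
have i1 : l^-1 <= 1 by rewrite invf_le1.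
have e1 : l^-1 ^+ 15 * (c * l^-1 ^+ 14) + 2 * (l^-1 ^+ 15 * (3 * l)) ^+ 2 <= (c + 18) * l^-1 ^+ 28.
  have -> : 2 * (l^-1 ^+ 15 * (3 * l)) ^+ 2 = 18 * l^-1 ^+ 28 by field; rewrite gt_eqF.
  rewrite [leRHS]mulrDl lerD2r mulrCA -exprD ler_wpM2l// ler_wiXn2l//.
have e2 : I%:R * (l^-1 ^+ 15 * (c * l^-1 ^+ 14) + 2 * (l^-1 ^+ 15 * (3 * l)) ^+ 2)
   <= l^-1 ^+ 27 * n / 8.
  apply: le_trans (_ : q * n * ((c + 18) * l^-1 ^+ 28) <= _).
    apply: ler_pM; [exact: ler0n| |exact: Iq|exact: e1].
    apply: addr_ge0; first by rewrite mulr_ge0 ?mulr_ge0 ?exprn_ge0.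
    by rewrite mulr_ge0// sqr_ge0.
  have -> : q * n * ((c + 18) * l^-1 ^+ 28) = (8 * q * (c + 18)) * (l^-1 ^+ 28 * n / 8).
    by field; rewrite gt_eqF.
  apply: le_trans (_ : l * (l^-1 ^+ 28 * n / 8) <= _).
    by rewrite ler_wpM2r// !mulr_ge0 ?exprn_ge0.
  by rewrite le_eqVlt; apply/orP; left; apply/eqP; field; rewrite gt_eqF.
have e3 : l^-1 ^+ 15 * (l^-1 ^+ 12 * n / 2) = l^-1 ^+ 27 * n / 2 by field; rewrite gt_eqF.
have := main_exponent; rewrite e3; set w := l^-1 ^+ 27 * n in e2 *.
have w0 : 0 <= w by rewrite mulr_ge0 ?exprn_ge0 ?(ltW n0).
by move: e2; set z := I%:R * _; clearbody z w; lra.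
Qed.

(** The bound is l^3 n with n <= (2l)^40 <= l^80. *)
Let size_le : (L * (N + T)).+1%:R <= l ^+ 83.
Proof.
rewrite -natr1 natrM natrD TE.
have h1 : n + r * n <= l * n by rewrite -[X in X + _]mul1r -mulrDl ler_wpM2r// ltW.
have h2 : l * (n + r * n) + 1 <= l ^+ 3 * n.
  have h3 : l * (n + r * n) <= l * (l * n) by rewrite ler_wpM2l// ltW.
  have h5 : 2 * (l ^+ 2 * n) <= l ^+ 3 * n.
    have -> : l ^+ 3 * n = l * (l ^+ 2 * n) by rewrite mulrA -exprS.
    by rewrite ler_wpM2r ?mulr_ge0 ?exprn_ge0 ?(ltW l0) ?(ltW n0)//; have := l300; lra.
  have h6 : 1 <= l ^+ 2 * n by rewrite mulr_ege1 ?exprn_ege1.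
  lra.
apply: le_trans h2 _; rewrite (exprD l 3 80) ler_wpM2l ?exprn_ge0 ?(ltW l0)//.
apply: le_trans nu _; rewrite (exprM l 2 40) lerXn2r ?nnegrE ?mulr_ge0 ?exprn_ge0 ?(ltW l0)//.
by rewrite expr2 ler_wpM2r ?(ltW l0)//; have := l300; lra.
Qed.

Lemma chain_tail_le :
  chain_tail KU KV muU muV N T L <= 4 * l ^+ 166 * expR (- l ^+ 2) + 2 * expR (l - l ^+ 2).
Proof.
have i0 : 0 <= l^-1 by rewrite invr_ge0 ltW.
rewrite /chain_tail; apply: lerD.
  rewrite mulrCA [leRHS]mulrAC -[leRHS]mulrA ler_wpM2l//.
  rewrite [leRHS]mulrC; apply: ler_pM; rewrite ?exprn_ge0 ?expR_ge0//.
    rewrite (exprM l 83 2) lerXn2r ?nnegrE ?exprn_ge0 ?(ltW l0)//.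
  rewrite ler_expR.
  have e1 : 2 * (l^-1 ^+ 15 * l) ^+ 2 = 2 * l^-1 ^+ 28 by field; rewrite gt_eqF.
  have e2 : l^-1 ^+ 28 = l^-1 ^+ 27 / l by rewrite exprSr.
  have e4 : l^-1 ^+ 15 * (l^-1 ^+ 12 * n - l^-1 ^+ 12 * n / 2) = l^-1 ^+ 27 * n / 2 by field; rewrite gt_eqF.
  have e3 : N.+1%:R * (2 * l^-1 ^+ 28) <= l^-1 ^+ 27 * n / 4.
    apply: (@le_trans _ _ (2 * n * (2 * l^-1 ^+ 28))).
      by rewrite ler_wpM2r ?mulr_ge0 ?exprn_ge0// -natr1; have := n1; lra.
    rewrite e2; have -> : 2 * n * (2 * (l^-1 ^+ 27 / l)) = (l^-1 ^+ 27 * n) * (4 / l) by ring.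
    rewrite ler_wpM2l ?mulr_ge0 ?exprn_ge0 ?(ltW n0)// ler_pdivrMr//; have := l300; lra.
  have := main_exponent; rewrite e1 e4; set w := l^-1 ^+ 27 * n in e3 *.
  by move: e3; set z := N.+1%:R * _; clearbody z w; lra.
rewrite ler_wpM2l// ler_expR.
have -> : l ^+ 5 * l^-1 ^+ 3 = l ^+ 2 by field; rewrite gt_eqF.
rewrite lerD2r.
have D0 : 0 <= D.
  apply: drift_const_ge0 => //; [|exact: slowness_lip_ge0|exact: mom_ge0].
  by apply: divr_ge0; [exact: mom_ge0|exact: ltW].
apply: le_trans Dl; have -> : r * D = D / n * (r * n) by field; rewrite !gt_eqF.
rewrite ler_wpM2l ?(divr_ge0 D0 (ltW n0))// -TE /horizon.
have i31 : l^-1 ^+ 3 <= 2^-1.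
  apply: (@le_trans _ _ (l^-1 ^+ 1)); first by rewrite ler_wiXn2l// invf_le1.
  by rewrite expr1 lef_pV2 ?posrE//; have := l300; lra.
apply: le_trans (_ : T%:R * (1 - 2 * l^-1 ^+ 3) <= _).
  by rewrite truncn_le// mulr_ge0//; lra.
by rewrite ler_piMr//; lra.
Qed.

Hypothesis UL : 8 * ((1 + 2 * (muU + 1)) * mom KU + 18) <= l.
Hypothesis VL : 8 * r * ((1 + 2 * (muV + 1)) * mom KV + 18) <= l.

(** The squared sizes give l^166, the values of [e] another l^83, and one more l absorbs the
    constants, whence l^250 <= exp(250 l). Finally 251 l - l^2 <= -(l + 1) because l >= 300. *)
Lemma failure_bound_small : failure_bound KU KV muU muV N T L <= expR (- L.+1%:R).
Proof.
have tU : degree_tail N L N muU (mom KU) <= 2 * expR (- l ^+ 2).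
  apply: (@degree_tail_le N 1); rewrite ?mul1r ?mulr1 ?(ltW muU0)//; exact: mom_ge0.
have tV : degree_tail N L T muV (mom KV) <= 2 * expR (- l ^+ 2).
  apply: (@degree_tail_le T r); rewrite ?TE ?(ltW muV0) ?(ltW r0)//; exact: mom_ge0.
have cT := chain_tail_le.
have E1 : expR (- l ^+ 2) <= expR (l - l ^+ 2) by rewrite ler_expR lerDr ltW.
have E0 := expR_ge0 (l - l ^+ 2).
have l1k (k : nat) : 1 <= l ^+ k by rewrite exprn_ege1.
set E := expR (l - l ^+ 2) in cT E1 E0.
have sz : (2 * (L * (N + T)).+1 ^ 2).+1%:R <= 3 * l ^+ 166.
  rewrite -natr1 natrM natrX.
  have : (L * (N + T)).+1%:R ^+ 2 <= l ^+ 166 by rewrite (exprM l 83 2) lerXn2r ?nnegrE.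
  by have := l1k 166%N; lra.
have sT : (L * T).+1%:R <= l ^+ 83.
  by apply: le_trans size_le; rewrite ler_nat ltnS leq_mul// leq_addl.
have c1 : (2 * (L * (N + T)).+1 ^ 2).+1%:R * degree_tail N L N muU (mom KU) <= 3 * l ^+ 166 * (2 * E).
  by apply: ler_pM => //; [rewrite mulr_ge0 ?expR_ge0|lra].
have c2 : (L * T).+1%:R * chain_tail KU KV muU muV N T L <= l ^+ 83 * (6 * l ^+ 166 * E).
  apply: ler_pM => //.
    by rewrite addr_ge0// !mulr_ge0 ?exprn_ge0 ?expR_ge0.
  apply: le_trans cT _.
  have h1 : 4 * l ^+ 166 * expR (- l ^+ 2) <= 4 * l ^+ 166 * E by rewrite ler_wpM2l ?mulr_ge0.
  have h2 : 2 * E <= 2 * l ^+ 166 * E.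
    by rewrite -mulrA ler_wpM2l// ler_peMl.
  have -> : 6 * l ^+ 166 * E = 4 * l ^+ 166 * E + 2 * l ^+ 166 * E by ring.
  exact: lerD.
have tot : failure_bound KU KV muU muV N T L <= l ^+ 250 * E.
  rewrite /failure_bound; apply: le_trans (lerD (lerD c1 tV) c2) _.
  have h1 : 3 * l ^+ 166 * (2 * E) <= 6 * l ^+ 249 * E.
    have -> : 3 * l ^+ 166 * (2 * E) = 6 * l ^+ 166 * E by ring.
    by rewrite ler_wpM2r// ler_wpM2l// ler_weXn2l.
  have h2 : 2 * expR (- l ^+ 2) <= 2 * l ^+ 249 * E.
    apply: (@le_trans _ _ (2 * E)); first by rewrite ler_wpM2l.
    by rewrite -mulrA ler_wpM2l// ler_peMl.
  have -> : l ^+ 83 * (6 * l ^+ 166 * E) = 6 * l ^+ 249 * E by rewrite (exprD l 83 166); ring.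
  have -> : l ^+ 250 * E = l * (l ^+ 249 * E) by rewrite exprS mulrA.
  have h3 : 14 * (l ^+ 249 * E) <= l * (l ^+ 249 * E).
    by rewrite ler_wpM2r ?mulr_ge0//; have := l300; lra.
  rewrite -[_ * _ * E]mulrA in h1; rewrite -[_ * _ * E]mulrA in h2; rewrite -[6 * _ * E]mulrA.
  apply: le_trans h3; move: h1 h2.
  set w := l ^+ 249 * E; set u := 3 * _ * _; set v := 2 * expR _.
  by clearbody w u v; lra.
apply: le_trans tot _.
have le1 : l <= expR l by apply: le_trans (expR_ge1Dx l); rewrite lerDr.
apply: (@le_trans _ _ (expR (l * 250%:R) * E)).
  rewrite ler_wpM2r// expRM_natr.
  by rewrite lerXn2r ?nnegrE ?expR_ge0 ?(ltW l0).
rewrite /E -expRD ler_expR -natr1.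
have : 300 * l <= l ^+ 2 by rewrite expr2 ler_wpM2r// ltW.
by have := l300; lra.
Qed.

End failure_bound_small.

(** * From truncated degrees to all outcomes and all times *)

Lemma card_matching_of_cat (E : finType) (s s' : seq (option E)) :
  (#|matching_of s| <= #|matching_of (s ++ s')| <= #|matching_of s| + size s')%N.
Proof.
elim/last_ind: s' => [|s' x /andP[IH1 IH2]]; first by rewrite cats0 addn0 leqnn.
rewrite -rcons_cat size_rcons; case: x => [e|]; last first.
  by rewrite matching_of_rcons_None IH1 addnS leqW.
rewrite matching_of_rcons_Some; apply/andP; split.
  by apply: leq_trans IH1 _; rewrite subset_leq_card// finset.subsetUr.
by rewrite cardsU1 addnS -addn1 addnC leq_add// leq_b1.
Qed.

Lemma bernoulli_pow {R : realDomainType} (p : R) k : 0 <= p <= 1 -> 1 - k%:R * (1 - p) <= p ^+ k.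
Proof.
move=> /andP[p0 p1]; elim: k => [|k IH]; first by rewrite mul0r subr0.
rewrite exprS -natr1; apply: le_trans (ler_wpM2l p0 IH).
have := ler0n R k; have : 0 <= (1 - p) * (1 - p) by rewrite mulr_ge0// subr_ge0.
nra.
Qed.

Section outcomes.
Context {R : realType} (piU piV : probability nat R) (N T L : nat).
Variable bad : nat -> nat -> bool.
Local Notation trU := {ffun 'I_N -> 'I_L.+1}.
Local Notation trV := {ffun 'I_T -> 'I_L.+1}.

Let hits (d : degrees N T) (r : run_type d) := [exists t : 'I_T.+1, bad t #|matching_of (take t r.2)|].

(** An infinite sum of nonnegative weights is at least its part over the finitely many outcomes with
    truncated degrees and no hit; all outcomes with a larger degree are given up. *)
Lemma cm_greedy_ge (A : set (outcome N T)) :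
  (forall (d : degrees N T) (r : run_type d), ~~ hits r -> A (Tagged (@run_type N T) r)) ->
  ((\sum_(b : trU * trV) trunc_weight piU piV b -
    \sum_(b : trU * trV) trunc_weight piU piV b *
     \sum_(r : run_type (trunc_degrees b)) cond_weight R r * (hits r)%:R)%:E
   <= cm_greedy N T piU piV A)%E.
Proof.
move=> hA; apply: esum_ge.
pose s := [seq Tagged (@run_type N T) r : outcome N T | b <- enum {: trU * trV},
             r <- enum [pred r : run_type (trunc_degrees b) | ~~ hits r]].
have inj : injective (@trunc_degrees N T L).
  move=> [a a'] [b b'] /= [] /ffunP h /ffunP h'; congr pair; apply/ffunP => i; apply: val_inj.
    by have := h i; rewrite !ffunE.
  by have := h' i; rewrite !ffunE.
have us : uniq s.
  apply: allpairs_uniq_dep => [|b _|]; rewrite ?enum_uniq//.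
  move=> [b r] [b' r'] _ _ /= h.
  have eb : b = b' by apply: inj; exact: (congr1 tag h).
  subst b'; congr existT; move/eqP: h; rewrite eq_Tagged => /eqP.
  by [].
exists [set` s].
  split; first exact: finite_seq.
  by move=> w /allpairsPdep[b [r [_ + ->]]]; rewrite mem_enum => hr; exact: hA.
rewrite -fsbig_seq// sumEFin lee_fin big_allpairs_dep big_enum -sumrB /=.
apply: ler_sum => b _.
rewrite big_enum /=.
under [leRHS]eq_bigr do rewrite /outcome_weight /= trunc_weightE.
rewrite -mulr_sumr -[X in X - _]mulr1 -mulrBr ler_wpM2l ?trunc_weight_ge0//.
rewrite -[X in X - _ <= _](sum_cond_weight R (trunc_degrees b)) -sumrB [leRHS]big_mkcond /=.
apply: ler_sum => r _; rewrite inE; case: (hits r); first by rewrite mulr1 subrr.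
by rewrite mulr0 subr0.
Qed.

(** Bernoulli's inequality for each side, then xy >= x + y - 1 on [0, 1]. *)
Lemma sum_trunc_weight_ge (KU KV : R) : 0 < KU -> 0 < KV ->
  sub_gaussian_with piU KU -> sub_gaussian_with piV KV ->
  1 - N%:R * (2 * expR (- (L.+1%:R / KU) ^+ 2)) - T%:R * (2 * expR (- (L.+1%:R / KV) ^+ 2))
  <= \sum_(b : trU * trV) trunc_weight piU piV b.
Proof.
move=> KU0 KV0 sgU sgV.
have P01 (law : probability nat R) K : 0 < K -> sub_gaussian_with law K ->
    0 <= \sum_(k < L.+1) prob_at law k <= 1.
  move=> K0 sg; rewrite (sum_prob_at_le1 K0 sg) andbT sumr_ge0// => k _; exact: prob_at_ge0.
have B (law : probability nat R) K n : 0 < K -> sub_gaussian_with law K ->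
    1 - n%:R * (2 * expR (- (L.+1%:R / K) ^+ 2)) <= (\sum_(k < L.+1) prob_at law k) ^+ n <= 1.
  move=> K0 sg; have h := P01 _ _ K0 sg; have /andP[h0 h1] := h; rewrite exprn_ile1// andbT.
  apply: le_trans (bernoulli_pow n h); rewrite lerD2l lerN2 ler_wpM2l//.
  by have := sum_prob_at_ge sg L; lra.
have -> : \sum_(b : trU * trV) trunc_weight piU piV b =
  (\sum_(k < L.+1) prob_at piU k) ^+ N * (\sum_(k < L.+1) prob_at piV k) ^+ T.
  have := @sum_trunc_weight R N T L piU piV (fun=> 1) (fun=> 1).
  by rewrite -!big_distrl /= !mulr1 !sum_ffun_weight.
have /andP[a1 a2] := B _ _ N KU0 sgU; have /andP[b1 b2] := B _ _ T KV0 sgV.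
have a0 : 0 <= (\sum_(k < L.+1) prob_at piU k) ^+ N.
  by rewrite exprn_ge0//; case/andP: (P01 _ _ KU0 sgU).
set x := _ ^+ N in a1 a2 a0 *; set y := _ ^+ T in b1 b2 *.
have : 0 <= (1 - x) * (1 - y) by rewrite mulr_ge0// subr_ge0.
by set u := N%:R * _ in a1 *; set v := T%:R * _ in b1 *; clearbody x y u v; lra.
Qed.

End outcomes.

Section uniform_error.
Context {R : realType}.
Variables (piU : probability nat R) (KU muU muV : R).
Hypotheses (KU0 : 0 < KU) (muU0 : 0 < muU) (muV0 : 0 < muV).
Hypotheses (sgU : sub_gaussian_with piU KU) (mU : has_mean piU muU).
Variable G : R -> R.
Hypothesis G01 : forall s : R, 0 <= s <= 1 -> 0 <= G s <= s.
Hypothesis Glip : forall s t : R, 0 <= s <= 1 -> 0 <= t <= 1 -> `|G s - G t| <= `|s - t|.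
Variables (N T L : nat).
Local Notation n := (N%:R : R).
Local Notation l := (L%:R : R).
Local Notation r := (muU / muV).
Hypothesis TE : T%:R = r * n.
Hypotheses (l16 : 16 <= l) (nl : l ^+ 40 <= n).

(** The first summand is [accuracy]. Past the horizon the time left is at most (2 + muV/muU) l^-3,
    with 2 from [horizon] and muV/muU from rounding; it costs a factor r in the matching and muU in
    the limit. *)
Definition error_const : R := (1 + muU) + (r + muU) * (2 + muV / muU).

Hypothesis lK : 4 * error_const <= l.

Lemma greedy_limit_lipschitz s t : 0 <= s <= 1 -> 0 <= t <= 1 ->
  `|greedy_limit piU G s - greedy_limit piU G t| <= muU * `|s - t|.
Proof.
move=> s01 t01; have a := G01 s01; have b := G01 t01.
have y1 : 0 <= 1 - G s <= 1 by lra.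
have y2 : 0 <= 1 - G t <= 1 by lra.
have -> : greedy_limit piU G s - greedy_limit piU G t = gen_fun piU (1 - G t) - gen_fun piU (1 - G s).
  by rewrite /greedy_limit; ring.
apply: le_trans (gen_fun_lipschitz KU0 sgU mU y2 y1) _; rewrite ler_wpM2l ?(ltW muU0)//.
have -> : 1 - G t - (1 - G s) = G s - G t by ring.
exact: Glip.
Qed.

(** Integer times up to the horizon suffice: the limit is Lipschitz in s, and past the horizon the
    matching is compared with its value there. *)
Lemma uniform_error (w : outcome N T) :
  ~~ [exists t : 'I_T.+1, deviates piU muU G N T L t #|matching_at w t|] ->
  forall s, 0 <= s <= 1 ->
  `|matching_fraction s w - greedy_limit piU G s| <= (L.+1%:R ^+ 2)^-1.
Proof.
rewrite negb_exists => /forallP nd s s01.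
have l0 : 0 < l by apply: lt_le_trans l16.
have l1 : 1 <= l by apply: le_trans l16; rewrite ler1n.
have n0 : 0 < n by apply: lt_le_trans nl; rewrite exprn_gt0.
have r0 : 0 < r by rewrite divr_gt0.
have T0 : 0 < T%:R :> R by rewrite TE mulr_gt0.
have i1 : l^-1 <= 1 by rewrite invf_le1.
have n_i : n^-1 <= l^-1 ^+ 3.
  rewrite exprVn lef_pV2 ?posrE ?exprn_gt0//; apply: le_trans nl; rewrite ler_weXn2l//.
set e3 := l^-1 ^+ 3 in n_i *.
have e30 : 0 <= e3 by rewrite exprn_ge0.
have e3h : e3 <= 2^-1.
  apply: (@le_trans _ _ (l^-1 ^+ 1)); first by rewrite ler_wiXn2l.
  by rewrite expr1 lef_pV2 ?posrE//; have := l16; lra.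
have T_i : T%:R^-1 = muV / muU * n^-1 by rewrite TE; field; rewrite !gt_eqF.
have T_i3 : T%:R^-1 <= muV / muU * e3 by rewrite T_i ler_wpM2l// divr_ge0 ?ltW.
set h := @horizon R T L; have hT : (h <= T)%N.
  rewrite /h /horizon -(ler_nat R); apply: le_trans (_ : T%:R * (1 - 2 * l^-1 ^+ 3) <= _).
    by rewrite truncn_le// mulr_ge0 ?(ltW T0)// -/e3; lra.
  by rewrite ler_piMr ?(ltW T0)// -/e3; lra.
have h_ge : T%:R * (1 - 2 * e3) < h.+1%:R by rewrite /h /horizon truncnS_gt.
have M k : (k <= h)%N -> `|#|matching_at w k|%:R / n - greedy_limit piU G (k%:R / T%:R)| <= (1 + muU) * e3.
  move=> kh; have kT : (k < T.+1)%N by rewrite ltnS (leq_trans kh).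
  have := nd (Ordinal kT); rewrite /deviates /= kh /= -leNgt /accuracy => hh.
  have -> : #|matching_at w k|%:R / n - greedy_limit piU G (k%:R / T%:R) =
     (#|matching_at w k|%:R - n * greedy_limit piU G (k%:R / T%:R)) / n by field; rewrite gt_eqF.
  by rewrite normrM normfV (gtr0_norm n0) ler_pdivrMr.
have q01 k : (k <= T)%N -> 0 <= (k%:R / T%:R : R) <= 1.
  by move=> kT; rewrite divr_ge0 ?(ltW T0)//= ler_pdivrMr// mul1r ler_nat.
have /andP[s0 s1] := s01.
have sT0 : 0 <= s * T%:R by rewrite mulr_ge0 ?(ltW T0).
rewrite /matching_fraction; set t := Num.truncn _.
have /andP[t1 t2] : t%:R <= s * T%:R < t.+1%:R by rewrite truncn_itv.
have tT : (t <= T)%N.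
  by rewrite -(ler_nat R); apply: le_trans t1 _; rewrite ler_piMl ?(ltW T0).
have ts : t%:R / T%:R <= s by rewrite ler_pdivrMr.
have ts2 : s < (t%:R + 1) / T%:R by rewrite ltr_pdivlMr// natr1.
have key : `|#|matching_at w t|%:R / n - greedy_limit piU G s| <= error_const * e3.
  have [th|ht] := leqP t h.
    have L1 := greedy_limit_lipschitz (q01 _ tT) s01.
    have L2 : `|t%:R / T%:R - s| <= muV / muU * e3.
      rewrite distrC ger0_norm ?subr_ge0//; apply: le_trans T_i3.
      by move: ts2; rewrite mulrDl mul1r; lra.
    have L3 := M _ th.
    apply: le_trans (ler_distD (greedy_limit piU G (t%:R / T%:R)) _ _) _.
    apply: le_trans (lerD L3 (le_trans L1 (ler_wpM2l (ltW muU0) L2))) _.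
    rewrite [muU * (_ * e3)]mulrA -mulrDl ler_wpM2r//.
    have a1 : 0 <= r * (2 + muV / muU) by rewrite mulr_ge0 ?addr_ge0 ?divr_ge0 ?ltW.
    rewrite /error_const [_ * (2 + _)]mulrDl [muU * (2 + _)]mulrDr; have := muU0; lra.
  have hs : 1 - h%:R / T%:R <= (2 + muV / muU) * e3.
    have h1 : (1 - 2 * e3) < h%:R / T%:R + T%:R^-1.
      have -> : h%:R / T%:R + T%:R^-1 = h.+1%:R / T%:R :> R by rewrite -natr1 mulrDl mul1r.
      by rewrite ltr_pdivlMr// mulrC.
    by rewrite mulrDl; lra.
  have th : (t = h + (t - h))%N by rewrite subnKC// ltnW.
  have /andP[m1 m2] : (#|matching_at w h| <= #|matching_at w t| <= #|matching_at w h| + (T - h))%N.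
    have := card_matching_of_cat (take h (tagged w).2) (take (t - h) (drop h (tagged w).2)).
    rewrite -takeD -th /matching_at => /andP[-> h2] /=; apply: leq_trans h2 _.
    by rewrite leq_add2l size_take_min (leq_trans (geq_minl _ _))// leq_sub2r.
  have D1 : `|#|matching_at w t|%:R / n - #|matching_at w h|%:R / n| <= r * ((2 + muV / muU) * e3).
    rewrite -mulrBl ger0_norm ?divr_ge0 ?subr_ge0 ?ler_nat// -natrB//.
    apply: le_trans (_ : (T - h)%:R / n <= _).
      by rewrite ler_wpM2r ?invr_ge0 ?(ltW n0)// ler_nat leq_subLR.
    have -> : (T - h)%:R / n = r * (1 - h%:R / T%:R).
      by rewrite natrB// TE; field; rewrite !gt_eqF.
    by rewrite ler_wpM2l ?(ltW r0).
  have D2 := M h (leqnn h).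
  have D3 := greedy_limit_lipschitz (q01 _ hT) s01.
  have D4 : `|h%:R / T%:R - s| <= (2 + muV / muU) * e3.
    rewrite distrC ger0_norm ?subr_ge0//; first by apply: le_trans hs; lra.
    by apply: le_trans ts; rewrite ler_wpM2r ?invr_ge0 ?(ltW T0)// ler_nat ltnW.
  apply: le_trans (ler_distD (#|matching_at w h|%:R / n) _ _) _.
  apply: le_trans (lerD D1 (ler_distD (greedy_limit piU G (h%:R / T%:R)) _ _)) _.
  have D5 := le_trans D3 (ler_wpM2l (ltW muU0) D4).
  apply: le_trans (lerD (lexx _) (lerD D2 D5)) _.
  by rewrite le_eqVlt; apply/orP; left; apply/eqP; rewrite /error_const; ring.
apply: le_trans key _.
(* One power of l absorbs the constant, and l^-2 / 4 = (2l)^-2 <= (L + 1)^-2. *)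
apply: (@le_trans _ _ (l * e3 / 4)).
  by rewrite mulrAC ler_wpM2r// ler_pdivlMr// mulrC.
have -> : l * e3 / 4 = ((2 * l) ^+ 2)^-1 by rewrite /e3; field; rewrite gt_eqF.
rewrite lef_pV2 ?posrE ?exprn_gt0 ?mulr_gt0//.
by rewrite lerXn2r ?nnegrE ?mulr_ge0 ?(ltW l0)// -natr1; lra.
Qed.

End uniform_error.

Lemma bounded_above_seq {R : realDomainType} (s : seq R) :
  exists2 x, 0 <= x & forall l, x <= l -> all (fun y => y <= l) s.
Proof.
elim: s => [|y s [x x0 xs]]; first by exists 0.
exists (Num.max y x) => [|l]; first by rewrite le_max x0 orbT.
by rewrite ge_max /= => /andP[-> /xs].
Qed.

(** * The solution G and the concentration of GREEDY around it *)

Section greedy_ode_theory.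
Context {R : realType}.
Variables (piU piV : probability nat R) (KU KV muU muV : R).
Hypotheses (KU0 : 0 < KU) (KV0 : 0 < KV) (muU0 : 0 < muU) (muV0 : 0 < muV).
Hypotheses (sgU : sub_gaussian_with piU KU) (sgV : sub_gaussian_with piV KV).
Hypotheses (mU : has_mean piU muU) (mV : has_mean piV muV).

Let rhsE g : 0 <= g < 1 -> greedy_rhs piU piV muU muV g = (slowness piU piV muU muV g)^-1.
Proof. exact: (greedy_rhsE KU0 KV0 muU0 muV0 sgU sgV mU). Qed.

Let rhs0 := greedy_rhs_gt0_near0 KU0 KV0 muU0 muV0 sgU sgV mU mV.
Let bounds := slowness_bounds KU0 KV0 muU0 muV0 sgU sgV mU mV.

Lemma greedy_ode_solution_exists : exists G, is_greedy_ode_solution piU piV muU muV G.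
Proof.
have [F F0 dF] := greedy_potential_exists KU0 KV0 muU0 muV0 sgU sgV mU mV.
exact: (solution_exists F0 dF bounds rhsE).
Qed.

Lemma greedy_ode_solution_unique G H : is_greedy_ode_solution piU piV muU muV G ->
  is_greedy_ode_solution piU piV muU muV H -> forall s, 0 <= s <= 1 -> H s = G s.
Proof.
move=> sG sH s s01.
have [F F0 dF] := greedy_potential_exists KU0 KV0 muU0 muV0 sgU sgV mU mV.
exact: (solution_unique F0 dF bounds rhsE rhs0 sH sG).
Qed.

Variable G : R -> R.
Hypothesis solG : is_greedy_ode_solution piU piV muU muV G.

Lemma greedy_ode_solution_bounds s : 0 <= s <= 1 -> 0 <= G s <= s.
Proof. by move=> s01; exact: (solution_bounds bounds rhsE rhs0 solG). Qed.

Lemma greedy_ode_solution_lipschitz s t : 0 <= s <= 1 -> 0 <= t <= 1 ->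
  `|G s - G t| <= `|s - t|.
Proof.
move=> s01 t01.
have [F F0 dF] := greedy_potential_exists KU0 KV0 muU0 muV0 sgU sgV mU mV.
have E u := solution_potential F0 dF bounds rhsE rhs0 solG (s := u).
have bs := greedy_ode_solution_bounds s01; have bt := greedy_ode_solution_bounds t01.
rewrite -[s in leRHS]E// -[t in leRHS]E//; apply: (potential_dist dF bounds); lra.
Qed.

End greedy_ode_theory.

Section concentration.
Context {R : realType}.
Variables (KU KV muU muV : R).
Hypotheses (KU0 : 0 < KU) (KV0 : 0 < KV) (muU0 : 0 < muU) (muV0 : 0 < muV).

(** Lower bounds required of [L]. They involve the laws only through [KU], [KV] and the means, so
    the threshold, and later [zeta], is uniform over the laws. *)
Definition scale_conditions : seq R :=
  [:: 300; 2 / muU; step_size muU muV (slowness_max KV muV); muU + 1; muV + 1; 1 + muU / muV;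
   muU / muV * drift_const muU muV (slowness_max KV muV) (slowness_lip KU KV muU muV) (mom KV);
   8 * ((1 + 2 * (muU + 1)) * mom KU + 18); 8 * (muU / muV) * ((1 + 2 * (muV + 1)) * mom KV + 18);
   KU ^+ 2; KV ^+ 2; 4 * error_const muU muV].

Variables (piU piV : probability nat R) (G : R -> R).
Hypotheses (sgU : sub_gaussian_with piU KU) (sgV : sub_gaussian_with piV KV).
Hypotheses (mU : has_mean piU muU) (mV : has_mean piV muV).
Hypothesis solG : is_greedy_ode_solution piU piV muU muV G.

Lemma sub_gaussian_tail (K l : R) : 0 < K -> 0 <= l -> K ^+ 2 <= l + 1 ->
  expR (- ((l + 1) / K) ^+ 2) <= expR (- (l + 1)).
Proof.
move=> K0 l0 Kl; rewrite ler_expR lerN2 expr_div_n ler_pdivlMr ?exprn_gt0// expr2.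
by rewrite ler_wpM2l// addr_ge0.
Qed.

(** In 3 + 2 muU/muV, 1 pays for the failures with truncated degrees, 2 for a degree above [L] among
    the N vertices of U, and 2 muU/muV for one among the T vertices of V. *)
Lemma cm_greedy_concentration (N T L : nat) (A : set (outcome N T)) :
  T%:R = muU / muV * N%:R :> R ->
  all (fun x => x <= L%:R) scale_conditions ->
  L%:R ^+ 40 <= N%:R :> R -> N%:R <= (2 * L%:R) ^+ 40 :> R ->
  (forall w : outcome N T, (forall s, 0 <= s <= 1 ->
     `|matching_fraction s w - (1 - gen_fun piU (1 - G s))| <= (L.+1%:R ^+ 2)^-1) -> A w) ->
  ((1 - (3 + 2 * (muU / muV)) * N%:R * expR (- L.+1%:R))%:E <= cm_greedy N T piU piV A)%E.
Proof.
move=> TE; rewrite /scale_conditions /=.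
move=> /and5P[l300 lu lA uL /and5P[vL rl Dl UL /and5P[VL KUl KVl lK _]]] nl nu hA.
have l16 : 16 <= L%:R :> R by lra.
have L64 : (64 <= L)%N by rewrite -(ler_nat R); lra.
have [F F0 dF] := greedy_potential_exists KU0 KV0 muU0 muV0 sgU sgV mU mV.
have G01 := greedy_ode_solution_bounds KU0 KV0 muU0 muV0 sgU sgV mU mV solG.
have Glip := greedy_ode_solution_lipschitz KU0 KV0 muU0 muV0 sgU sgV mU mV solG.
have bounds := slowness_bounds KU0 KV0 muU0 muV0 sgU sgV mU mV.
have FG u := solution_potential F0 dF bounds
  (greedy_rhsE KU0 KV0 muU0 muV0 sgU sgV mU)
  (greedy_rhs_gt0_near0 KU0 KV0 muU0 muV0 sgU sgV mU mV) solG (s := u).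
apply: le_trans (cm_greedy_ge piU piV L (bad := deviates piU muU G N T L) _); last first.
  move=> d r nd; apply: hA => s s01.
  exact: (@uniform_error R piU KU muU muV KU0 muU0 muV0 sgU mU G G01 Glip N T L TE l16 nl lK
    (Tagged (@run_type N T) r) nd s s01).
rewrite lee_fin.
have f1 := failure_estimate KU0 KV0 muU0 muV0 sgU sgV mU mV F0 dF G01 FG TE L64 lu lA uL vL nl.
have f2 := failure_bound_small muU0 muV0 TE l300 nl nu rl Dl UL VL.
have f3 := sum_trunc_weight_ge N T L KU0 KV0 sgU sgV.
have tU : expR (- (L.+1%:R / KU) ^+ 2) <= expR (- L.+1%:R) by rewrite -natr1 sub_gaussian_tail//; lra.
have tV : expR (- (L.+1%:R / KV) ^+ 2) <= expR (- L.+1%:R) by rewrite -natr1 sub_gaussian_tail//; lra.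
set E := expR (- L.+1%:R) in f2 tU tV *.
have E0 : 0 <= E by exact: expR_ge0.
have n1 : 1 <= N%:R :> R by apply: le_trans nl; rewrite exprn_ege1//; lra.
have t1 : N%:R * (2 * expR (- (L.+1%:R / KU) ^+ 2)) <= 2 * N%:R * E.
  by rewrite mulrA [N%:R * 2]mulrC ler_wpM2l ?mulr_ge0.
have t2 : T%:R * (2 * expR (- (L.+1%:R / KV) ^+ 2)) <= 2 * (muU / muV) * N%:R * E.
  have -> : 2 * (muU / muV) * N%:R = T%:R * 2 by rewrite TE; ring.
  by rewrite mulrA ler_wpM2l ?mulr_ge0.
have t3 : E <= N%:R * E by rewrite ler_peMl.
have -> : (3 + 2 * (muU / muV)) * N%:R * E = N%:R * E + 2 * N%:R * E + 2 * (muU / muV) * N%:R * E.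
  by ring.
move: f3 (le_trans f1 f2) t1 t2 t3.
set a := \sum_b _; set b := \sum_b _; set c := N%:R * (2 * _); set d := T%:R * _.
set u := 2 * N%:R * E; set v := 2 * _ * _ * E; set w := N%:R * E.
by clearbody a b c d u v w; lra.
Qed.

End concentration.

(** * The scale N^(1/40) and the final bounds *)

Section rate.
Context {R : realType}.
Implicit Type N : nat.

Definition scale N : R := N%:R `^ (40%:R^-1).

Lemma scale_ge0 N : 0 <= scale N. Proof. exact: powR_ge0. Qed.

Lemma scale_pow N : scale N ^+ 40 = N%:R.
Proof.
rewrite -powR_mulrn ?scale_ge0// /scale -powRrM mulVf ?pnatr_eq0//.
by rewrite powRr1.
Qed.

Lemma scale_le (x : R) N : 0 <= x -> x ^+ 40 <= N%:R -> x <= scale N.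
Proof.
by move=> x0; rewrite -scale_pow ler_pXn2r ?nnegrE ?scale_ge0.
Qed.

Lemma scale_lower N : (Num.truncn (scale N))%:R ^+ 40 <= N%:R :> R.
Proof.
by rewrite -[leRHS]scale_pow lerXn2r ?nnegrE ?scale_ge0// truncn_le scale_ge0.
Qed.

Lemma scale_upper N : 1 <= scale N -> N%:R <= (2 * (Num.truncn (scale N))%:R) ^+ 40 :> R.
Proof.
move=> s1; have /andP[h1 h2] := truncn_itv (scale_ge0 N).
rewrite -[leLHS]scale_pow lerXn2r ?nnegrE ?scale_ge0 ?mulr_ge0//.
have : 1 <= (Num.truncn (scale N))%:R :> R by rewrite ler1n truncn_gt_nat.
by move: h2; rewrite -natr1; lra.
Qed.

(* x^41 / 41! <= e^x *)
Lemma scale_decay N (eta C : R) : 0 < eta -> 0 <= C -> C * 41`!%:R / eta <= scale N -> 0 < scale N ->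
  C * N%:R * expR (- scale N) <= eta.
Proof.
move=> eta0 C0 hs s0; rewrite -[N%:R]scale_pow expRN ler_pdivrMr ?expR_gt0//.
have h := expR_ge1Dxn 40 (ltW s0).
have f0 : 0 < 41`!%:R :> R by rewrite ltr0n fact_gt0.
apply: le_trans (_ : eta * (scale N ^+ 41 / 41`!%:R) <= _); last first.
  by rewrite ler_wpM2l ?(ltW eta0)//; move: h; lra.
rewrite mulrA ler_pdivlMr// [scale N ^+ 41]exprS mulrA mulrAC ler_wpM2r ?exprn_ge0 ?(ltW s0)//.
by rewrite -ler_pdivrMl// mulrC.
Qed.

End rate.

(** If L is below the threshold x, then [scale N < x + 1], and the summand exp(x + 1) of [zeta]
    makes the claimed lower bound nonpositive. Otherwise L + 1 > [scale N] lets both bounds in L + 1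
    be read in terms of [scale N]. *)
Lemma greedy_sup_bound (R : realType) (KU KV muU muV : R) :
  0 < KU -> 0 < KV -> 0 < muU -> 0 < muV ->
  exists zeta : R, 0 < zeta /\
  forall piU piV : probability nat R,
    sub_gaussian_with piU KU -> sub_gaussian_with piV KV ->
    has_mean piU muU -> has_mean piV muV ->
  forall G : R -> R, is_greedy_ode_solution piU piV muU muV G ->
  forall N T : nat, (0 < N)%N -> T%:R = muU / muV * N%:R ->
  forall A : set (outcome N T),
    (forall w : outcome N T, (forall s, 0 <= s <= 1 ->
      `|matching_fraction s w - (1 - gen_fun piU (1 - G s))| <= (scale N ^+ 2)^-1) -> A w) ->
    ((1 - zeta * N%:R * expR (- scale N))%:E <= cm_greedy N T piU piV A)%E.
Proof.
move=> KU0 KV0 muU0 muV0.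
have [x x0 xs] := bounded_above_seq (scale_conditions KU KV muU muV).
have r0 : 0 <= muU / muV by rewrite divr_ge0 ?ltW.
pose Cz := 3 + 2 * (muU / muV).
have Cz0 : 0 < Cz by rewrite /Cz; lra.
exists (Cz + expR (x + 1)); split; first by rewrite addr_gt0// expR_gt0.
move=> piU piV sgU sgV mU mV G solG N T N0 TE A hA.
have n1 : 1 <= N%:R :> R by rewrite ler1n.
have s1 : 1 <= scale N :> R by apply: scale_le => //; rewrite expr1n.
have E0 : 0 <= expR (- scale N) :> R by exact: expR_ge0.
have s0 := scale_ge0 (R := R) N.
have /andP[t1 t2] := truncn_itv s0.
set L := Num.truncn (scale N) in t1 t2.
have [hL|hL] := leP x L%:R.
  have c := @cm_greedy_concentration R KU KV muU muV KU0 KV0 muU0 muV0 piU piV G sgU sgV mU mV solG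
    N T L A TE (xs _ hL) (scale_lower N) (scale_upper s1).
  apply: le_trans (c _); last first.
    move=> w hw; apply: hA => s s01; apply: le_trans (hw s s01) _.
    rewrite lef_pV2 ?posrE ?exprn_gt0//; last by apply: lt_le_trans s1.
    by rewrite lerXn2r ?nnegrE// ltW.
  rewrite lee_fin lerD2l lerN2; apply: ler_pM.
  - by rewrite mulr_ge0// ltW.
  - exact: expR_ge0.
  - by rewrite ler_wpM2r// lerDl expR_ge0.
  - by rewrite ler_expR lerN2 ltW.
apply: le_trans (_ : 0%:E <= _)%E; last by apply: esum_ge0 => w _; rewrite lee_fin outcome_weight_ge0.
rewrite lee_fin subr_le0; apply: (@le_trans _ _ (expR (x + 1) * expR (- scale N))).
  rewrite -expRD -[leLHS]expR0 ler_expR; move: t2; rewrite -natr1; lra.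
rewrite ler_wpM2r//; apply: le_trans (_ : expR (x + 1) * 1 <= _); first by rewrite mulr1.
by apply: ler_pM => //; rewrite ?expR_ge0// lerDr ltW.
Qed.

Lemma greedy_cvg_in_probability (R : realType) (piU piV : probability nat R) (KU KV muU muV : R) (G : R -> R)
    (X : forall N T, outcome N T -> R) (s : R) :
  0 < KU -> 0 < KV -> 0 < muU -> 0 < muV ->
  sub_gaussian_with piU KU -> sub_gaussian_with piV KV ->
  has_mean piU muU -> has_mean piV muV ->
  is_greedy_ode_solution piU piV muU muV G ->
  0 <= s <= 1 -> (forall N T w, X N T w = matching_fraction s w) ->
  cm_cvg_in_probability piU piV (muU / muV) X (1 - gen_fun piU (1 - G s)).
Proof.
move=> KU0 KV0 muU0 muV0 sgU sgV mU mV solG s01 XE eps eta eps0 eta0.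
have [zeta [z0 hz]] := greedy_sup_bound KU0 KV0 muU0 muV0.
(* A scale above 1 and 1/eps has inverse square at most eps; the third value lets [scale_decay]
   bring the failure probability below eta. *)
pose m := Num.max 1 (Num.max eps^-1 (zeta * 41`!%:R / eta)).
have m1 : 1 <= m by rewrite /m le_max lexx.
have me : eps^-1 <= m by rewrite /m !le_max lexx orbT.
have mz : zeta * 41`!%:R / eta <= m by rewrite /m !le_max lexx !orbT.
have m0 : 0 <= m by apply: le_trans m1.
exists (Num.truncn (m ^+ 40)).+1 => // N /= hN T TE.
have mN : m ^+ 40 <= N%:R.
  by apply: ltW; apply: lt_le_trans (truncnS_gt _) _; rewrite ler_nat.
have ms := scale_le m0 mN.
have s1 : 1 <= scale N :> R by exact: le_trans ms.
have sp : 0 < scale N :> R by apply: lt_le_trans s1.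
have N0 : (0 < N)%N by apply: leq_trans hN.
set B := [set w | _]; pose A := ~` B.
have hA : ((1 - zeta * N%:R * expR (- scale N))%:E <= cm_greedy N T piU piV A)%E.
  apply: (hz piU piV sgU sgV mU mV G solG N T N0 TE A) => w hw.
  rewrite /A /B /=; apply/negP; rewrite -leNgt XE; apply: le_trans (hw s s01) _.
  rewrite -[leRHS]invrK lef_pV2 ?posrE ?invr_gt0 ?exprn_gt0//.
  by rewrite expr2; apply: le_trans me (le_trans ms _); rewrite ler_peMl ?(ltW sp).
have PB := probability_setC (cm_greedy N T piU piV) (I : measurable A).
move: PB; rewrite /A setCK -/A => ->.
rewrite leeBlDr; last by apply: fin_num_measure.
apply: le_trans (_ : (eta%:E + (1 - zeta * N%:R * expR (- scale N))%:E <= _)%E); last by rewrite leeD2l.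
rewrite -EFinD lee_fin.
by rewrite addrCA lerDl subr_ge0; exact: scale_decay eta0 (ltW z0) (le_trans mz ms) sp.
Qed.

Theorem theorem1 (R : realType) :
  (forall (piU piV : probability nat R) (muU muV : R),
    sub_gaussian piU -> sub_gaussian piV ->
    has_mean piU muU -> has_mean piV muV -> 0 < muU -> 0 < muV ->
    exists G : R -> R,
      [/\ is_greedy_ode_solution piU piV muU muV G,
          (forall H : R -> R, is_greedy_ode_solution piU piV muU muV H ->
             forall s : R, s \in `[0, 1] -> H s = G s),
          cm_cvg_in_probability piU piV (muU / muV)
            (fun N T w => #|matching_at w T|%:R / N%:R)
            (1 - gen_fun piU (1 - G 1))
        & forall s : R, s \in `[0, 1] ->
          cm_cvg_in_probability piU piV (muU / muV)
            (fun N T w => matching_fraction s w)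
            (1 - gen_fun piU (1 - G s))])
  /\
  (let c : R := 20%:R^-1 in
   forall muU muV m2U m2V : R, 0 < muU -> 0 < muV ->
   exists xi kappa : R, 0 < xi /\ 0 < kappa /\
   forall KU KV : R, 0 < KU -> 0 < KV ->
   exists zeta : R, 0 < zeta /\
   forall piU piV : probability nat R,
     sub_gaussian_with piU KU -> sub_gaussian_with piV KV ->
     has_mean piU muU -> has_mean piV muV ->
     has_second_moment piU m2U -> has_second_moment piV m2V ->
   forall G : R -> R, is_greedy_ode_solution piU piV muU muV G ->
   forall N T : nat, (0 < N)%N -> T%:R = muU / muV * N%:R ->
     ((1 - zeta * N%:R * expR (- (xi * N%:R `^ (c / 2))))%:E <=
      cm_greedy N T piU piV
        [set w | (ereal_sup [set (`| matching_fraction s w -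
                                    (1 - gen_fun piU (1 - G s)) |)%:E
                            | s in `[0%R, 1%R]]
                  <= (kappa * N%:R `^ (- c))%:E)%E])%E).
Proof.
split.
  move=> piU piV muU muV [KU KU0 sgU] [KV KV0 sgV] mU mV muU0 muV0.
  have [G solG] := greedy_ode_solution_exists KU0 KV0 muU0 muV0 sgU sgV mU mV.
  exists G; split=> //.
  - move=> H solH s; rewrite in_itv /= => s01.
    exact: (greedy_ode_solution_unique KU0 KV0 muU0 muV0 sgU sgV mU mV solG solH).
  - apply: (greedy_cvg_in_probability KU0 KV0 muU0 muV0 sgU sgV mU mV solG).
      by rewrite ler01 lexx.
    by move=> N T w; rewrite /matching_fraction mul1r natrK.
  - move=> s; rewrite in_itv /= => s01.
    exact: (greedy_cvg_in_probability KU0 KV0 muU0 muV0 sgU sgV mU mV solG).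
move=> c muU muV m2U m2V muU0 muV0; exists 1, 1; split=> //; split=> // KU KV KU0 KV0.
have [zeta [z0 hz]] := greedy_sup_bound KU0 KV0 muU0 muV0.
exists zeta; split=> // piU piV sgU sgV mU mV _ _ G solG N T N0 TE.
(* With c = 1/20, N^(c/2) is the scale and N^c its square. *)
have -> : 1 * N%:R `^ (c / 2) = scale N :> R.
  by rewrite mul1r /scale /c; congr powR; field.
apply: (hz piU piV sgU sgV mU mV G solG N T N0 TE) => w hw.
apply: ge_ereal_sup => _ [s /= s01 <-]; rewrite lee_fin mul1r powRN.
have -> : N%:R `^ c = scale N ^+ 2 :> R.
  by rewrite -powR_mulrn ?scale_ge0// /scale -powRrM /c; congr powR; field.
by apply: hw; move: s01; rewrite in_itv.
Qed.
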